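(* Let $\nu$ be a strongly irreducible and proximal probability distribution on $\mathrm{End}(E)$ and $\gamma=(\gamma_n)_{n\in\mathbb{N}}\sim\nu^{\otimes\mathbb{N}}$, $\overline\gamma_n=\gamma_0\cdots\gamma_{n-1}$. Then $\gamma\in\Omega(E)$ almost surely. Moreover, for every $\alpha<\lambda_{1-2}(\nu)$ there exist constants $C,\beta>0$ such that for all $n$, $$\mathbb{P}\big(\exists u\in U^1(\overline\gamma_n)\setminus\{0\},\ \mathrm{dist}([u],l^\infty(\gamma))\ge e^{-\alpha n}\big)\le Ce^{-\beta n},$$ and for all $v\in E$ and all $n$, $$\mathbb{P}\big(\mathrm{dist}([\overline\gamma_nv],l^\infty(\gamma))\ge e^{-\alpha n}\mid\overline\gamma_nv\neq0\big)\le Ce^{-\beta n}.$$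
   Context: $\mathbb{K}$ a local field, $E=\mathbb{K}^d$, $d\ge2$, with Euclidean/Hermitian norm if $\mathbb{K}\in\{\mathbb{R},\mathbb{C}\}$ and max-norm otherwise; $\mathrm{P}(E)$ with metric $\mathrm{dist}([x],[y])=\|x\wedge y\|/(\|x\|\|y\|)$. For $h\neq0$ and $0<\varepsilon\le1$: $V^\varepsilon(h)=\{x:\|hx\|\ge\varepsilon\|h\|\|x\|\}$, $U^\varepsilon(h)=h(V^\varepsilon(h))$; $\sigma(h)=\|h\wedge h\|/\|h\|^2$. $\Omega'(E)$ is the set of sequences $\gamma\in\mathrm{End}(E)^{\mathbb{N}}$ with $\overline\gamma_n\neq0$ for all $n$ and for which there is $l^\infty\in\mathrm{P}(E)$ with $\lim_n\max_{u\in U^\varepsilon(\overline\gamma_n)\setminus\{0\}}\mathrm{dist}(l^\infty,[u])=0$ for all $\varepsilon\in(0,1)$; this $l^\infty$ is denoted $l^\infty(\gamma)$. With $T$ the shift $(\gamma_n)\mapsto(\gamma_{n+1})$, $\Omega(E)=\{\gamma\in\bigcap_{k\ge0}T^{-k}\Omega'(E):\forall k,\ \gamma_kl^\infty(T^{k+1}\gamma)=l^\infty(T^k\gamma)\}$. $\lambda_{1-2}(\nu)\in(0,+\infty]$ is the almost sure limit of $-\frac1n\log\sigma(\overline\gamma_n)$, which exists for such $\nu$. Proximal: $\nu^{*n}\{0\}=0$ for all $n$ and $\nu^{*n}\{g:\rho_1(g)>\rho_2(g)\}>0$ for some $n$. Strongly irreducible: (a) for all $N\ge1$, $f_1,\dots,f_N\in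 E^*\setminus\{0\}$, $v\neq0$ there is $n$ with $\nu^{*n}\{g:\prod_if_igv\neq0\}>0$; (b) for all $N\ge1$, $f\neq0$, $v_1,\dots,v_N\neq0$ there is $n$ with $\nu^{*n}\{g:\prod_jfgv_j\neq0\}>0$. *)

(* Defs.v *)
From HB Require Import structures.
From mathcomp Require Import all_boot all_order all_algebra.
From mathcomp Require Import all_classical all_reals all_analysis.
Set Implicit Arguments. Unset Strict Implicit. Unset Printing Implicit Defensive.
Import Order.TTheory GRing.Theory Num.Theory.
Import numFieldNormedType.Exports.
Local Open Scope classical_set_scope.
Local Open Scope ring_scope.

Definition is_absval {R : realType} {K : fieldType} (a : K -> R) : Prop :=
  [/\ forall x, a x = 0 <-> x = 0,
      forall x y, a (x * y) = a x * a y &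
      forall x y, a (x + y) <= a x + a y].

Definition ultrametric {R : realType} {K : fieldType} (a : K -> R) : Prop :=
  forall x y, a (x + y) <= Num.max (a x) (a y).

(* K is a local field with absolute value a : a non-discrete (non-trivial)
   absolute value for which closed balls are (sequentially) compact, i.e.
   K is a non-discrete locally compact (hence complete) valued field.
   In the archimedean case (K = R or C, by Ostrowski) the absolute value is
   normalised to be the usual one, which is forced by  a (1+1) = 2. *)
Definition local_field {R : realType} {K : fieldType} (a : K -> R) : Prop :=
  [/\ is_absval a,
      exists x, 0 < a x < 1,
      ultrametric a \/ a (1 + 1) = 2 &
      forall u : nat -> K, (forall n, a (u n) <= 1) ->
        exists (phi : nat -> nat) (l : K),
          (forall n, (phi n < phi n.+1)%N) /\
          (fun n => a (u (phi n) - l)) @ \oo --> (0 : R)].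

Definition vnorm {R : realType} {K : fieldType} (a : K -> R) {d : nat}
    (x : 'cV[K]_d) : R :=
  if `[< ultrametric a >] then \big[Num.max/0]_(i < d) a (x i ord0)
  else Num.sqrt (\sum_(i < d) a (x i ord0) ^+ 2).

(* Elements of /\^2 E are represented by their coordinates w i j on the
   basis e_i /\ e_j, i < j (entries with i >= j are ignored). *)
Definition w2norm {R : realType} {K : fieldType} (a : K -> R) {d : nat}
    (w : 'M[K]_d) : R :=
  if `[< ultrametric a >] then \big[Num.max/0]_(i < d) \big[Num.max/0]_(j < d | (i < j)%N) a (w i j)
  else Num.sqrt (\sum_(i < d) \sum_(j < d | (i < j)%N) a (w i j) ^+ 2).

Definition wedge {K : fieldType} {d : nat} (x y : 'cV[K]_d) : 'M[K]_d :=
  \matrix_(i, j) (x i ord0 * y j ord0 - x j ord0 * y i ord0).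

Definition wedge2 {K : fieldType} {d : nat} (h : 'M[K]_d) (w : 'M[K]_d) : 'M[K]_d :=
  \matrix_(k, l) \sum_(i < d) \sum_(j < d | (i < j)%N)
     w i j * (h k i * h l j - h l i * h k j).

Definition opnorm {R : realType} {K : fieldType} (a : K -> R) {d : nat}
    (h : 'M[K]_d) : R :=
  sup [set vnorm a (h *m x) / vnorm a x | x in [set x : 'cV[K]_d | x != 0]].

Definition opnorm2 {R : realType} {K : fieldType} (a : K -> R) {d : nat}
    (h : 'M[K]_d) : R :=
  sup [set w2norm a (wedge2 h w) / w2norm a w
      | w in [set w : 'M[K]_d | w2norm a w != 0]].

(* dist([x],[y]) on P(E) (lines represented by nonzero vectors) *)
Definition pdist {R : realType} {K : fieldType} (a : K -> R) {d : nat}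
    (x y : 'cV[K]_d) : R :=
  w2norm a (wedge x y) / (vnorm a x * vnorm a y).

Definition sigma {R : realType} {K : fieldType} (a : K -> R) {d : nat}
    (h : 'M[K]_d) : R := opnorm2 a h / opnorm a h ^+ 2.

Definition inU {R : realType} {K : fieldType} (a : K -> R) {d : nat}
    (eps : R) (h : 'M[K]_d) (u : 'cV[K]_d) : Prop :=
  exists x : 'cV[K]_d,
    eps * opnorm a h * vnorm a x <= vnorm a (h *m x) /\ u = h *m x.

(* Spectral radii rho_1 >= rho_2 (moduli of the two largest eigenvalues),
   via Gelfand's formula: rho_1(g) = lim ||g^n||^{1/n} and
   rho_1(g) rho_2(g) = lim ||/\^2 g^n||^{1/n}.                         *)

Definition mxpow {K : fieldType} {d : nat} (g : 'M[K]_d) (n : nat) : 'M[K]_d :=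
  iter n (mulmx g) 1%:M.

Definition rho1 {R : realType} {K : fieldType} (a : K -> R) {d : nat}
    (g : 'M[K]_d) : R :=
  limn (fun n : nat => opnorm a (mxpow g n.+1) `^ (n.+1%:R^-1)).

Definition rho12 {R : realType} {K : fieldType} (a : K -> R) {d : nat}
    (g : 'M[K]_d) : R :=
  limn (fun n : nat => opnorm2 a (mxpow g n.+1) `^ (n.+1%:R^-1)).

Definition rho2 {R : realType} {K : fieldType} (a : K -> R) {d : nat}
    (g : 'M[K]_d) : R :=
  if rho1 a g == 0 then 0 else rho12 a g / rho1 a g.

Fixpoint gbar {K : fieldType} {d : nat} (g : nat -> 'M[K]_d) (n : nat) : 'M[K]_d :=
  match n with
  | 0 => 1%:M
  | n'.+1 => gbar g n' *m g n'
  end.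

Definition shift {A : Type} (k : nat) (g : nat -> A) : nat -> A :=
  fun n => g (n + k)%N.

Definition is_linf {R : realType} {K : fieldType} (a : K -> R) {d : nat}
    (g : nat -> 'M[K]_d) (l : 'cV[K]_d) : Prop :=
  l != 0 /\
  forall eps : R, 0 < eps < 1 ->
  forall delta : R, 0 < delta ->
  exists N : nat, forall n, (N <= n)%N ->
  forall u, inU a eps (gbar g n) u -> u != 0 -> pdist a l u <= delta.

Definition Omega' {R : realType} {K : fieldType} (a : K -> R) {d : nat}
    (g : nat -> 'M[K]_d) : Prop :=
  (forall n, gbar g n != 0) /\ exists l, is_linf a g l.

Definition linf {R : realType} {K : fieldType} (a : K -> R) {d : nat}
    (g : nat -> 'M[K]_d) : 'cV[K]_d :=
  xget 0 (is_linf a g).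

Definition peq {R : realType} {K : fieldType} (a : K -> R) {d : nat}
    (x y : 'cV[K]_d) : Prop :=
  x != 0 /\ y != 0 /\ pdist a x y = 0.

Definition Omega {R : realType} {K : fieldType} (a : K -> R) {d : nat}
    (g : nat -> 'M[K]_d) : Prop :=
  forall k : nat, Omega' a (shift k g) /\
    peq a (g k *m linf a (shift k.+1 g)) (linf a (shift k g)).

(* Measurable structure on End(E) = 'M[K]_d : the Borel sigma-algebra, *)
(* generated by the coordinate open balls.                             *)

(* 'M[K]_d, pointed by 0 (needed to build the measurable type) *)
Definition Mx (K : fieldType) (d : nat) := 'M[K]_d.
HB.instance Definition _ (K : fieldType) (d : nat) := Choice.on (Mx K d).
HB.instance Definition _ (K : fieldType) (d : nat) :=
  isPointed.Build (Mx K d) (0 : 'M[K]_d).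

Definition mx_balls {R : realType} {K : fieldType} (a : K -> R) (d : nat)
    : set (set (Mx K d)) :=
  [set A | exists (i j : 'I_d) (c : K) (r : R),
     A = [set g : Mx K d | a ((g : 'M[K]_d) i j - c) < r]].

Notation EndE a d := (g_sigma_algebraType (@mx_balls _ _ a d)).

Definition iid_law {R : realType} {K : fieldType} (a : K -> R) {d : nat}
    {dT : measure_display} {T : measurableType dT} (P : probability T R)
    (nu : probability (EndE a d) R) (gamma : nat -> T -> EndE a d) : Prop :=
  [/\ forall n, measurable_fun setT (gamma n),
      forall n (A : set (EndE a d)), measurable A ->
        P (gamma n @^-1` A) = nu A &
      forall (N : nat) (A : nat -> set (EndE a d)), (forall i, measurable (A i)) ->
        P (\bigcap_(i in [set k | (k < N)%N]) (gamma i @^-1` A i)) =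
        (\prod_(i < N) P (gamma i @^-1` A i))%E].

Definition gbarT {R : realType} {K : fieldType} {a : K -> R} {d : nat} {T : Type}
    (gamma : nat -> T -> EndE a d) (n : nat) (t : T) : 'M[K]_d :=
  gbar (fun i => gamma i t : 'M[K]_d) n.

(* nu^{*n}(A) = law of gamma_0 ... gamma_{n-1} *)
Definition conv {R : realType} {K : fieldType} {a : K -> R} {d : nat}
    {dT : measure_display} {T : measurableType dT} (P : probability T R)
    (gamma : nat -> T -> EndE a d) (n : nat) (A : set 'M[K]_d) : \bar R :=
  P ((gbarT gamma n) @^-1` A).

Definition strongly_irreducible {R : realType} {K : fieldType} {a : K -> R} {d : nat}
    {dT : measure_display} {T : measurableType dT} (P : probability T R)
    (gamma : nat -> T -> EndE a d) : Prop :=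
  (forall (N : nat) (f : 'I_N -> 'rV[K]_d) (v : 'cV[K]_d),
     (1 <= N)%N -> (forall i, f i != 0) -> v != 0 ->
     exists n, (0 < conv P gamma n
                  [set g | (\prod_(i < N) (f i *m g *m v) ord0 ord0 != 0)%R])%E) /\
  (forall (N : nat) (f : 'rV[K]_d) (v : 'I_N -> 'cV[K]_d),
     (1 <= N)%N -> f != 0 -> (forall j, v j != 0) ->
     exists n, (0 < conv P gamma n
                  [set g | (\prod_(j < N) (f *m g *m v j) ord0 ord0 != 0)%R])%E).

Definition proximal {R : realType} {K : fieldType} {a : K -> R} {d : nat}
    {dT : measure_display} {T : measurableType dT} (P : probability T R)
    (gamma : nat -> T -> EndE a d) : Prop :=
  (forall n, conv P gamma n [set 0] = 0%E) /\
  exists n, (0 < conv P gamma n [set g | (rho2 a g < rho1 a g)%R])%E.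

Definition lyap_term {R : realType} {K : fieldType} (a : K -> R) {d : nat}
    (h : 'M[K]_d) (n : nat) : \bar R :=
  if sigma a h == 0 then +oo%E else (- ln (sigma a h) / n%:R)%:E.

(* (outer) probability bound: P(A) <= b *)
Definition prob_le {R : realType} {dT : measure_display} {T : measurableType dT}
    (P : probability T R) (A : set T) (b : \bar R) : Prop :=
  exists B : set T, measurable B /\ A `<=` B /\ (P B <= b)%E.

(* Main.v *)
(* All norms are replaced, up to constants, by the maximum [mn] of the absolute values of the
   entries of a matrix and the maximum [mx2] of those of its 2x2 minors.

   Proximality gives an accessible rank-one matrix: one approximated, up to scalars and with
   positive probability, by products of the random matrices. Strong irreducibility moves it to
   finitely many rank-one matrices in general position, and the rotations of their product are
   all reached by words of one length M. Given any matrix g on the left and any h1, h2 on the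
   right, a random block B of M letters is therefore, with a probability bounded below, almost
   of rank one with |g B| ~ |g| |B| and |B h_i| ~ |B| |h_i|. Weighting such good blocks
   (the Schottky property) shows that j consecutive blocks are all bad with probability at most
   theta^j, whatever g, h1 and h2 are.

   Cutting a product at its last good block gives recursive inequalities for the moments
   E[sg(S_n)^s] of the gap of S_n = gamma_0 ... gamma_(n-1): they decay exponentially, and at
   rate s al for every al below the Lyapunov gap, with s small. The same cut bounds the moments
   of the angle between the images of S_n and of S_(n+1), and between S_n and S_n v. Markov's
   inequality and summation over n then give the limit line and the deviation estimates.
   Transversality (gamma_0 does not kill the limit line of the shifted sequence) holds because,
   from the first good block on, |gamma_0 S'_n| is comparable to |S'_n|. *)
Require Import Defs.
From HB Require Import structures.
From mathcomp Require Import all_boot all_order all_algebra.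
From mathcomp Require Import all_classical all_reals all_analysis.
From mathcomp Require Import measurable_realfun ring lra zify.
Import Order.TTheory GRing.Theory Num.Theory.
Import numFieldNormedType.Exports.
Set Implicit Arguments. Unset Strict Implicit. Unset Printing Implicit Defensive.
Local Open Scope classical_set_scope.
Local Open Scope ring_scope.

(** No moment of the letters is assumed and the letters may be singular, so [|S_n|] itself is never
    estimated. Only scale-free ratios are: [gapratio] is at most 2 and equals 0 when a factor
    vanishes, so all its moments are finite, and lower bounds for norms of products come from good
    blocks alone.

    Whether a block is good depends on letters on both of its sides, so no single order of
    integration controls a run of bad blocks. A left weight that sees only the past and a right
    weight that sees only the future are integrated in opposite orders and combined by the
    arithmetic-geometric inequality.

    The recursion is run twice. For large [s] each good block halves the gap ratio and the factor
    [2^-s] beats the number of cuts: some positive rate exists, whatever [lambda12] is. For rates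
    close to [lambda12], [s = x / N] with [N] large; the constant lost at a cut, raised to the power
    [s], is then at most 2, and the gap in probability at times between [N] and [2 N] makes the sum
    over the cuts smaller than one half. *)

Definition nneg_absval {R : realType} {K : fieldType} (a : K -> R) : Prop :=
  is_absval a /\ forall x, 0 <= a x.

(** * Max-norms and 2x2 minors *)

Section AbsoluteValue.
Variables (R : realType) (K : fieldType) (a : K -> R).
Hypothesis aP : nneg_absval a.

Lemma av_ge0 x : 0 <= a x. Proof. by case: aP => _; apply. Qed.

Lemma av0 : a 0 = 0. Proof. by case: aP => -[h _ _] _; apply/h. Qed.

Lemma av_eq0 x : (a x == 0) = (x == 0).
Proof. by case: aP => -[h _ _] _; apply/eqP/eqP => /h. Qed.

Lemma av_gt0 x : (0 < a x) = (x != 0).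
Proof. by rewrite lt_neqAle av_ge0 andbT eq_sym av_eq0. Qed.

Lemma avM x y : a (x * y) = a x * a y. Proof. by case: aP => -[_ h _] _. Qed.

Lemma avD x y : a (x + y) <= a x + a y. Proof. by case: aP => -[_ _ h] _. Qed.

Lemma av1 : a 1 = 1.
Proof.
have h : a 1 != 0 by rewrite av_eq0 oner_eq0.
by apply: (mulfI h); rewrite mulr1 -avM mulr1.
Qed.

Lemma avN x : a (- x) = a x.
Proof.
suff h : a (-1) = 1 by rewrite -mulN1r avM h mul1r.
have : a (-1) ^+ 2 = 1 by rewrite expr2 -avM mulrNN mulr1 av1.
by move/eqP; rewrite sqrp_eq1 ?av_ge0// => /eqP.
Qed.

Lemma avB x y : a (x - y) <= a x + a y.
Proof. by rewrite -(avN y) avD. Qed.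

Lemma avBC x y : a (x - y) = a (y - x).
Proof. by rewrite -avN opprB. Qed.

Lemma avV x : a x^-1 = (a x)^-1.
Proof.
have [->|x0] := eqVneq x 0; first by rewrite invr0 av0 invr0.
apply: (mulfI (x := a x)); first by rewrite av_eq0.
by rewrite -avM divff// divff ?av1// av_eq0.
Qed.

Lemma avX x n : a (x ^+ n) = a x ^+ n.
Proof. by elim: n => [|n IH]; rewrite ?expr0 ?av1// !exprS avM IH. Qed.

Lemma av_sum (I : Type) (r : seq I) (Q : pred I) (f : I -> K) :
  a (\sum_(i <- r | Q i) f i) <= \sum_(i <- r | Q i) a (f i).
Proof.
elim/big_ind2: _ => [|x1 x2 y1 y2 h1 h2|//]; first by rewrite av0.
by apply: le_trans (avD _ _) _; apply: lerD.
Qed.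

Lemma av_sum_le (n : nat) (f : 'I_n -> K) (c : R) :
  (forall i, a (f i) <= c) -> a (\sum_i f i) <= n%:R * c.
Proof.
move=> h; apply: le_trans (av_sum _ _ _) _.
apply: le_trans (ler_sum _ (fun i _ => h i)) _.
by rewrite sumr_const card_ord mulr_natl.
Qed.

Definition mn p q (A : 'M[K]_(p, q)) : R :=
  \big[Num.max/0]_(x : 'I_p * 'I_q) a (A x.1 x.2).

(** These are the coordinates of the wedge of each column of [A] with each column of [B]; for
    [A = B] they are the entries of the second exterior power. A value small compared with
    [mn A * mn B] says that the large columns of both matrices lie near one common line. *)
Definition mx2 p q q' (A : 'M[K]_(p, q)) (B : 'M[K]_(p, q')) : R :=
  \big[Num.max/0]_(x : ('I_p * 'I_p) * ('I_q * 'I_q'))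
    a (A x.1.1 x.2.1 * B x.1.2 x.2.2 - A x.1.2 x.2.1 * B x.1.1 x.2.2).

Lemma mn_ge0 p q (A : 'M[K]_(p, q)) : 0 <= mn A.
Proof. by rewrite /mn; elim/big_ind: _ => [//|x y h1 h2|x _]; rewrite ?av_ge0// le_max h1. Qed.

Lemma mn_ub p q (A : 'M[K]_(p, q)) i j : a (A i j) <= mn A.
Proof. exact: (le_bigmax _ (fun x : 'I_p * 'I_q => a (A x.1 x.2)) (i, j)). Qed.

Lemma mn_le p q (A : 'M[K]_(p, q)) c :
  0 <= c -> (forall i j, a (A i j) <= c) -> mn A <= c.
Proof. by move=> c0 h; apply: bigmax_le => // -[i j] _ /=. Qed.

Lemma mn_lt p q (A : 'M[K]_(p, q)) c :
  0 < c -> (forall i j, a (A i j) < c) -> mn A < c.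
Proof. by move=> c0 h; apply: bigmax_lt => // -[i j] _ /=. Qed.

Lemma mn_eq0 p q (A : 'M[K]_(p, q)) : (mn A == 0) = (A == 0).
Proof.
apply/eqP/eqP => [h|->].
  apply/matrixP => i j; rewrite mxE; apply/eqP; rewrite -av_eq0 eq_le av_ge0 andbT.
  by rewrite -h mn_ub.
by apply/eqP; rewrite eq_le mn_ge0 andbT; apply: mn_le => // i j; rewrite mxE av0.
Qed.

Lemma mn0 p q : mn (0 : 'M[K]_(p, q)) = 0.
Proof. by apply/eqP; rewrite mn_eq0. Qed.

Lemma mn_gt0 p q (A : 'M[K]_(p, q)) : (0 < mn A) = (A != 0).
Proof. by rewrite lt_neqAle mn_ge0 andbT eq_sym mn_eq0. Qed.

Lemma mn_max p q (A : 'M[K]_(p, q)) : A != 0 -> exists i j, mn A = a (A i j).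
Proof.
rewrite -mn_gt0 => A0; apply: contrapT => h.
suff: mn A < mn A by rewrite ltxx.
apply: mn_lt => // i j; rewrite lt_neqAle mn_ub andbT.
by apply/eqP => e; apply: h; exists i, j.
Qed.

Lemma mnD p q (A B : 'M[K]_(p, q)) : mn (A + B) <= mn A + mn B.
Proof.
apply: mn_le => [|i j]; first by rewrite addr_ge0 ?mn_ge0.
by rewrite mxE; apply: le_trans (avD _ _) _; rewrite lerD ?mn_ub.
Qed.

Lemma mnZ p q (c : K) (A : 'M[K]_(p, q)) : mn (c *: A) = a c * mn A.
Proof.
apply/eqP; rewrite eq_le; apply/andP; split.
  apply: mn_le => [|i j]; first by rewrite mulr_ge0 ?mn_ge0 ?av_ge0.
  by rewrite mxE avM ler_wpM2l ?av_ge0 ?mn_ub.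
have [->|A0] := eqVneq A 0; first by rewrite scaler0 mn0 mulr0.
have [i [j ->]] := mn_max A0.
by rewrite -avM; apply: le_trans (mn_ub _ i j); rewrite mxE.
Qed.

Lemma mnN p q (A : 'M[K]_(p, q)) : mn (- A) = mn A.
Proof. by rewrite -scaleN1r mnZ avN av1 mul1r. Qed.

Lemma mnBC p q (A B : 'M[K]_(p, q)) : mn (A - B) = mn (B - A).
Proof. by rewrite -mnN opprB. Qed.

Lemma mn_subr p q (A B : 'M[K]_(p, q)) : mn A - mn B <= mn (A - B).
Proof. by rewrite lerBlDr -{1}(subrK B A) mnD. Qed.

Lemma mnM p d q (A : 'M[K]_(p, d)) (B : 'M[K]_(d, q)) :
  mn (A *m B) <= d%:R * (mn A * mn B).
Proof.
apply: mn_le => [|i j]; first by rewrite !mulr_ge0 ?mn_ge0.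
rewrite mxE; apply: av_sum_le => k.
by rewrite avM ler_pM ?av_ge0 ?mn_ub.
Qed.

Lemma mn_col p q (A : 'M[K]_(p, q)) j : mn (col j A) <= mn A.
Proof. by apply: mn_le => [|i k]; rewrite ?mn_ge0// mxE mn_ub. Qed.

Lemma mn_col_max p q (A : 'M[K]_(p, q)) :
  (0 < q)%N -> exists j, mn (col j A) = mn A.
Proof.
move=> q0; have [->|A0] := eqVneq A 0.
  exists (Ordinal q0); rewrite mn0; apply/eqP; rewrite mn_eq0.
  by apply/eqP/matrixP => i k; rewrite !mxE.
have [i [j e]] := mn_max A0.
exists j; apply/eqP; rewrite eq_le mn_col /= e.
by apply: le_trans (mn_ub _ i ord0); rewrite mxE.
Qed.

Lemma mx2_ge0 p q q' (A : 'M[K]_(p, q)) (B : 'M[K]_(p, q')) : 0 <= mx2 A B.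
Proof. by rewrite /mx2; elim/big_ind: _ => [//|x y h1 h2|x _]; rewrite ?av_ge0// le_max h1. Qed.

Lemma mx2_ub p q q' (A : 'M[K]_(p, q)) (B : 'M[K]_(p, q')) i i' j j' :
  a (A i j * B i' j' - A i' j * B i j') <= mx2 A B.
Proof.
exact: (le_bigmax _ (fun x : ('I_p * 'I_p) * ('I_q * 'I_q') =>
  a (A x.1.1 x.2.1 * B x.1.2 x.2.2 - A x.1.2 x.2.1 * B x.1.1 x.2.2))
  ((i, i'), (j, j'))).
Qed.

Lemma mx2_le p q q' (A : 'M[K]_(p, q)) (B : 'M[K]_(p, q')) c : 0 <= c ->
  (forall i i' j j', a (A i j * B i' j' - A i' j * B i j') <= c) -> mx2 A B <= c.
Proof. by move=> c0 h; apply: bigmax_le => // -[[i i'] [j j']] _ /=. Qed.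

Lemma mx2C p q q' (A : 'M[K]_(p, q)) (B : 'M[K]_(p, q')) : mx2 A B = mx2 B A.
Proof.
have h r r' (C : 'M[K]_(p, r)) (D : 'M[K]_(p, r')) : mx2 C D <= mx2 D C.
  apply: mx2_le => [|i i' j j']; rewrite ?mx2_ge0// avBC.
  by rewrite [X in a (X - _)]mulrC [X in a (_ - X)]mulrC mx2_ub.
by apply/eqP; rewrite eq_le !h.
Qed.

Lemma mx2_mn p q q' (A : 'M[K]_(p, q)) (B : 'M[K]_(p, q')) :
  mx2 A B <= 2%:R * (mn A * mn B).
Proof.
apply: mx2_le => [|i i' j j']; first by rewrite !mulr_ge0 ?mn_ge0.
apply: le_trans (avB _ _) _; rewrite mulr_natl mulr2n !avM.
by apply: lerD; apply: ler_pM; rewrite ?av_ge0 ?mn_ub.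
Qed.

Lemma mx2D p q q' (A : 'M[K]_(p, q)) (B C : 'M[K]_(p, q')) :
  mx2 A (B + C) <= mx2 A B + mx2 A C.
Proof.
apply: mx2_le => [|i i' j j']; first by rewrite addr_ge0 ?mx2_ge0.
rewrite !mxE !mulrDr opprD addrACA.
by apply: le_trans (avD _ _) _; rewrite lerD ?mx2_ub.
Qed.

Lemma mx2Z p q q' (c : K) (A : 'M[K]_(p, q)) (B : 'M[K]_(p, q')) :
  mx2 A (c *: B) = a c * mx2 A B.
Proof.
have h e (D : 'M[K]_(p, q')) : mx2 A (e *: D) <= a e * mx2 A D.
  apply: mx2_le => [|i i' j j']; first by rewrite mulr_ge0 ?av_ge0 ?mx2_ge0.
  rewrite !mxE mulrCA [X in _ - X]mulrCA -mulrBr avM ler_wpM2l ?av_ge0//.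
  exact: mx2_ub.
apply/eqP; rewrite eq_le h /=; have [->|c0] := eqVneq c 0.
  by rewrite av0 mul0r mx2_ge0.
rewrite -ler_pdivlMl ?av_gt0// -avV.
by apply: le_trans (h c^-1 (c *: B)); rewrite scalerK.
Qed.

(** Every coordinate is a combination of 2x2 minors of [H]. An almost rank one [H] therefore sends
    everything near one line, as long as the images do not lose too much norm. *)
Lemma mx2M p d q q' (H : 'M[K]_(p, d)) (A : 'M[K]_(d, q)) (B : 'M[K]_(d, q')) :
  mx2 (H *m A) (H *m B) <= d%:R * (d%:R * (mx2 H H * (mn A * mn B))).
Proof.
apply: mx2_le => [|i i' j j'].
  by rewrite !mulr_ge0 ?mx2_ge0 ?mn_ge0.
rewrite !mxE !big_distrlr /= -sumrB; apply: av_sum_le => k.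
rewrite -sumrB; apply: av_sum_le => k'.
have -> : H i k * A k j * (H i' k' * B k' j') - H i' k * A k j * (H i k' * B k' j')
  = (H i k * H i' k' - H i' k * H i k') * (A k j * B k' j') by ring.
by rewrite avM avM ler_pM ?mulr_ge0 ?av_ge0 ?mx2_ub ?ler_pM ?av_ge0 ?mn_ub.
Qed.

Lemma mx2Mr p q q' r r' (A : 'M[K]_(p, q)) (B : 'M[K]_(p, q'))
    (X : 'M[K]_(q, r)) (Y : 'M[K]_(q', r')) :
  mx2 (A *m X) (B *m Y) <= q%:R * (q'%:R * (mx2 A B * (mn X * mn Y))).
Proof.
apply: mx2_le => [|i i' j j'].
  by rewrite !mulr_ge0 ?mx2_ge0 ?mn_ge0.
rewrite !mxE !big_distrlr /= -sumrB; apply: av_sum_le => k.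
rewrite -sumrB; apply: av_sum_le => k'.
have -> : A i k * X k j * (B i' k' * Y k' j') - A i' k * X k j * (B i k' * Y k' j')
  = (A i k * B i' k' - A i' k * B i k') * (X k j * Y k' j') by ring.
by rewrite avM avM ler_pM ?mulr_ge0 ?av_ge0 ?mx2_ub ?ler_pM ?av_ge0 ?mn_ub.
Qed.

(* Cauchy-Binet: the double sum over (k, k') is antisymmetric in (k, k'), so it
   folds onto k < k' (no division by 2, the characteristic is arbitrary) *)
Lemma mx2_mul p d q (G : 'M[K]_(p, d)) (A : 'M[K]_(d, q)) :
  mx2 (G *m A) (G *m A) <= d%:R * (d%:R * (mx2 G G * mx2 A A)).
Proof.
apply: mx2_le => [|i i' j j'].
  by rewrite !mulr_ge0 ?mx2_ge0.
pose m k k' := G i k * G i' k' - G i' k * G i k'.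
have -> : (G *m A) i j * (G *m A) i' j' - (G *m A) i' j * (G *m A) i j'
  = \sum_(k < d) \sum_(k' < d) m k k' * (A k j * A k' j').
  rewrite !mxE !big_distrlr /= -sumrB; apply: eq_bigr => k _.
  by rewrite -sumrB; apply: eq_bigr => k' _; rewrite /m; ring.
have -> : \sum_(k < d) \sum_(k' < d) m k k' * (A k j * A k' j') =
    \sum_(k < d) \sum_(k' < d | (k < k')%N)
       m k k' * (A k j * A k' j' - A k' j * A k j').
  have split1 k : \sum_(k' < d) m k k' * (A k j * A k' j') =
      \sum_(k' < d | (k < k')%N) m k k' * (A k j * A k' j') +
      \sum_(k' < d | (k' < k)%N) m k k' * (A k j * A k' j').
    rewrite (bigID (fun k' : 'I_d => (k < k')%N)) /=; congr (_ + _).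
    rewrite (bigID (fun k' : 'I_d => (k' < k)%N)) /= [X in _ + X]big1 => [|k'].
      rewrite addr0; apply: eq_bigl => k'; rewrite -leqNgt.
      by apply: andb_idl => /ltnW.
    rewrite -!leqNgt -eqn_leq => /eqP e.
    have -> : k' = k by apply/val_inj.
    by rewrite /m [X in X - _]mulrC subrr mul0r.
  under eq_bigr do rewrite split1.
  rewrite big_split /= [X in _ + X](exchange_big_dep xpredT) //= -big_split /=.
  apply: eq_bigr => k _; rewrite -big_split /=; apply: eq_bigr => k' _.
  by rewrite /m; ring.
apply: av_sum_le => k; rewrite big_mkcond /=; apply: av_sum_le => k'.
case: ifP => _; last by rewrite av0 mulr_ge0 ?mx2_ge0.
by rewrite avM ler_pM ?av_ge0 ?mx2_ub// [X in a (_ - X)]mulrC mx2_ub.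
Qed.

(** The coefficient is read off at the largest coordinate of [u], where the difference vanishes.
    This replaces orthogonal projection over every local field. *)
Lemma line_proj n (u v : 'cV[K]_n) : u != 0 ->
  exists c, mn (v - c *: u) * mn u <= mx2 u v.
Proof.
move=> u0; have [i [j e]] := mn_max u0.
have ui0 : u i j != 0 by rewrite -av_gt0 -e mn_gt0.
exists (v i j / u i j); rewrite -ler_pdivlMr ?mn_gt0//.
apply: mn_le => [|k l]; first by rewrite divr_ge0 ?mx2_ge0 ?mn_ge0.
rewrite ler_pdivlMr ?mn_gt0// e -avM !mxE (ord1 l) (ord1 j) in ui0 *.
have -> : (v k ord0 - v i ord0 / u i ord0 * u k ord0) * u i ord0
   = u i ord0 * v k ord0 - u k ord0 * v i ord0 by field.
exact: mx2_ub.
Qed.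

(** The large columns of an almost rank one [B] are nearly parallel. Choose a column [u] of [B] on
    which [G] acts with a large image, and a large column [w] of [B *m H]: then [w] is close to a
    multiple [c u], and [G w] is close to [c (G u)]. The condition on [tau] makes the error at most
    half of the main term. *)
Lemma mul3_lb p d q (G : 'M[K]_(p, d)) (B : 'M[K]_d) (H : 'M[K]_(d, q))
    (e tau : R) : (0 < d)%N -> (0 < q)%N -> 0 < e ->
  2%:R * d%:R ^+ 3 * (e + d%:R) * tau <= e ^+ 3 ->
  mx2 B B <= tau * mn B ^+ 2 ->
  e * (mn G * mn B) <= mn (G *m B) -> e * (mn B * mn H) <= mn (B *m H) ->
  e ^+ 2 / 2%:R * (mn G * mn B * mn H) <= mn (G *m B *m H).
Proof.
move=> d0 q0 e0 he hB hG hH.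
have [->|G0] := eqVneq G 0; first by rewrite mn0 !(mul0r, mulr0) mn_ge0.
have [->|B0] := eqVneq B 0; first by rewrite mn0 !(mul0r, mulr0) mn_ge0.
have [->|H0] := eqVneq H 0; first by rewrite mn0 !(mul0r, mulr0) mn_ge0.
have [j hj] := mn_col_max (G *m B) d0.
have [l hl] := mn_col_max (B *m H) q0.
have D1 : 1 <= d%:R :> R by rewrite ler1n.
set D : R := d%:R in he hj hl D1 *.
move: G0 B0 H0; rewrite -!mn_gt0 => g0 b0 h0.
set g := mn G in hG g0 *; set b := mn B in hB hG hH b0 *; set h := mn H in hH h0 *.
pose u := B *m delta_mx j (ord0 : 'I_1); pose w := B *m col l H.
have eu : G *m u = col j (G *m B) by rewrite mulmxA colE.
have ew : w = col l (B *m H) by rewrite /w !colE mulmxA.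
have gu : e * (g * b) <= mn (G *m u) by rewrite eu hj.
have wH : e * (b * h) <= mn w by rewrite ew hl.
have gu' : mn (G *m u) <= D * (g * mn u) by exact: mnM.
have ub : e / D * b <= mn u.
  have := le_trans gu gu'; rewrite mulrCA (mulrCA D) ler_pM2l// => h1.
  by rewrite mulrAC ler_pdivrMr ?(lt_le_trans ltr01)// [mn u * _]mulrC.
have eD0 : 0 < e / D by rewrite divr_gt0// (lt_le_trans ltr01).
have u_gt0 : 0 < mn u by apply: lt_le_trans ub; rewrite mulr_gt0.
have u0 : u != 0 by rewrite -mn_gt0.
have ule : mn u <= b.
  rewrite /u -colE; exact: mn_col.
have [c hc] := line_proj w u0.
set r := w - c *: u in hc.
(* Both vectors are images under [B], so the minors of [B] control the angle between them. *)
have hx : mx2 u w <= D * (D * (tau * b ^+ 2 * h)).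
  apply: le_trans (mx2M _ _ _) _; rewrite ler_pM2l ?(lt_le_trans ltr01)//.
  rewrite ler_pM2l ?(lt_le_trans ltr01)//.
  apply: ler_pM; rewrite ?mx2_ge0 ?mulr_ge0 ?mn_ge0//.
  rewrite -[X in _ <= X]mul1r; apply: ler_pM; rewrite ?mn_ge0 ?mn_col//.
  apply: mn_le => // i k; rewrite mxE; case: (_ && _) => /=; by rewrite ?av0 ?av1.
have rle : mn r * e <= D ^+ 3 * tau * b * h.
  rewrite -(ler_pM2r (x := b))//.
  have h1 : D * (mn r * (e / D * b)) <= D * (D * (D * (tau * b ^+ 2 * h))).
    rewrite ler_pM2l ?(lt_le_trans ltr01)//.
    by apply: le_trans hx; apply: le_trans hc; apply: ler_wpM2l; rewrite ?mn_ge0.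
  have -> : mn r * e * b = D * (mn r * (e / D * b)).
    by field; rewrite gt_eqF ?(lt_le_trans ltr01).
  by apply: le_trans h1 _; lra.
have gw : G *m w = c *: (G *m u) + G *m r by rewrite /r mulmxBr scalemxAr addrC subrK.
have gr : mn (G *m r) <= D * (g * mn r) by exact: mnM.
have gw1 : a c * mn (G *m u) - D * (g * mn r) <= mn (G *m w).
  rewrite gw; have := mn_subr (c *: (G *m u)) (- (G *m r)).
  rewrite opprK mnN mnZ; lra.
have cu : mn w - mn r <= a c * mn u.
  by have := mn_subr w r; rewrite /r subKr mnZ.
have gwle : mn (G *m w) <= mn (G *m B *m H).
  by rewrite /w colE !mulmxA -colE mn_col.
apply: le_trans gwle; apply: le_trans gw1.
have ac0 := av_ge0 c.
have h1 : e * g * (mn w - mn r) <= a c * mn (G *m u).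
  apply: le_trans (_ : e * g * (a c * mn u) <= _).
    by rewrite ler_pM2l ?mulr_gt0.
  rewrite mulrCA ler_wpM2l//; apply: le_trans gu.
  by rewrite -mulrA ler_pM2l// ler_pM2l.
have h2 : e * g * (e * (b * h)) <= e * g * mn w by rewrite ler_pM2l// mulr_gt0.
suff h3 : g * ((e + D) * mn r) <= g * (e ^+ 2 / 2%:R * (b * h)) by nra.
rewrite ler_pM2l// -(ler_pM2l e0).
have h4 : (e + D) * (mn r * e) <= (e + D) * (D ^+ 3 * tau * b * h).
  by rewrite ler_wpM2l//; lra.
have h5 : 2%:R * D ^+ 3 * (e + D) * tau * (b * h) <= e ^+ 3 * (b * h).
  by rewrite ler_wpM2r// mulr_ge0// ltW.
lra.
Qed.

End AbsoluteValue.

(** Nonnegativity is not among the axioms of [is_absval]. A negative value forces [a (-1) = -1], so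
    [a] is odd. For [a z > 1] the points [- z ^+ n] then have negative values and meet the bound in
    the compactness axiom, but no subsequence can converge because [a (z ^+ n)] is unbounded. *)
Lemma local_field_nneg (R : realType) (K : fieldType) (a : K -> R) :
  local_field a -> nneg_absval a.
Proof.
case=> aA [y /andP[y0 y1]] _ cpt; split=> // x0; rewrite leNgt; apply/negP => x0_lt.
have [a0 aM aD] := aA.
have az : a 0 = 0 by apply/a0.
have a1 : a 1 = 1.
  have h : a 1 != 0 by apply/eqP => /a0/eqP; rewrite oner_eq0.
  by apply: (mulfI h); rewrite mulr1 -aM mulr1.
have aN1 : a (-1) = -1.
  have : a (-1) ^+ 2 = 1 by rewrite expr2 -aM mulrNN mulr1 a1.
  move/eqP; rewrite sqrf_eq1 => /orP[|] /eqP// h.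
  have := aD x0 (- x0); rewrite subrr az -[- x0]mulN1r aM h mul1r => h2.
  by exfalso; lra.
have aN x : a (- x) = - a x by rewrite -mulN1r aM aN1 mulN1r.
have y_neq0 : y != 0 by apply/eqP => /a0; lra.
have az1 : 1 < a y^-1.
  have : a y * a y^-1 = 1 by rewrite -aM divff.
  by nra.
set z := y^-1 in az1.
have aX n : a (z ^+ n) = a z ^+ n.
  by elim: n => [|n IH]; rewrite ?expr0// !exprS aM IH.
have [n|phi [l [phiS /cvgrPdist_lt h]]] := cpt (fun n => - z ^+ n).
  rewrite aN aX; apply: (@le_trans _ _ 0) => //.
  by rewrite oppr_le0 exprn_ge0// (le_trans ler01)// ltW.
have phi_ge n : (n <= phi n)%N by elim: n => // n IH; apply: leq_ltn_trans IH (phiS n).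
have [N _ HN] := h 1 ltr01.
have lb n : a z ^+ phi n <= a (z ^+ phi n + l) + a (- l).
  by rewrite -aX; apply: le_trans (aD _ _); rewrite addrK.
have bern n : 1 + n%:R * (a z - 1) <= a z ^+ n.
  elim: n => [|n IH]; first by rewrite mul0r addr0 expr0.
  rewrite exprS -natr1.
  have : (1 + n%:R * (a z - 1)) * a z <= a z ^+ n * a z.
    by rewrite ler_pM2r// (lt_trans ltr01).
  have : 0 <= n%:R * (a z - 1) * (a z - 1) :> R.
    by rewrite !mulr_ge0// subr_ge0 ltW.
  lra.
have [M HM] : exists M : nat, 1 + a (-l) < M%:R * (a z - 1).
  exists (Num.truncn ((1 + a (- l)) / (a z - 1))).+1.
  by rewrite -ltr_pdivrMr ?subr_gt0// truncnS_gt.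
pose n := maxn N M.
have := HN n (leq_maxl _ _); rewrite /= sub0r normrN -opprD aN normrN => h1.
have h2 : a (z ^+ phi n + l) < 1 by apply: le_lt_trans h1; rewrite ler_norm.
have h3 := bern (phi n); have h4 := lb n.
have : M%:R * (a z - 1) <= (phi n)%:R * (a z - 1).
  by rewrite ler_pM2r ?subr_gt0// ler_nat (leq_trans (leq_maxr N M)).
lra.
Qed.

(** * Compactness and separability of the local field *)

Section LocalField.
Variables (R : realType) (K : fieldType) (a : K -> R).
Hypothesis lf : local_field a.
Let aP := local_field_nneg lf.

Definition acvg (u : nat -> K) (l : K) : Prop :=
  forall e : R, 0 < e -> exists N : nat, forall n, (N <= n)%N -> a (u n - l) < e.

Definition mcvg p q (u : nat -> 'M[K]_(p, q)) (l : 'M[K]_(p, q)) : Prop :=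
  forall e : R, 0 < e -> exists N : nat, forall n, (N <= n)%N -> mn a (u n - l) < e.

Lemma mono_ge (phi : nat -> nat) : (forall n, (phi n < phi n.+1)%N) ->
  forall n, (n <= phi n)%N.
Proof. by move=> h; elim=> // n IH; apply: leq_ltn_trans IH (h n). Qed.

Lemma mono_comp (phi psi : nat -> nat) : (forall n, (phi n < phi n.+1)%N) ->
  (forall n, (psi n < psi n.+1)%N) -> forall n, (phi (psi n) < phi (psi n.+1))%N.
Proof.
move=> h1 h2 n; apply: (homo_ltn ltn_trans h1); exact: h2.
Qed.

Lemma acvg_sub u l (phi : nat -> nat) : (forall n, (phi n < phi n.+1)%N) ->
  acvg u l -> acvg (u \o phi) l.
Proof.
move=> h c e /c[N HN]; exists N => n Nn /=; apply: HN.
exact: leq_trans Nn (mono_ge h n).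
Qed.

Lemma nat_unbounded (x c : R) : 0 < x -> exists n : nat, c < n%:R * x.
Proof.
move=> x0; exists (Num.truncn (c / x)).+1.
by rewrite -ltr_pdivrMr// truncnS_gt.
Qed.

Lemma bernoulli (x : R) n : 0 <= x -> 1 + n%:R * x <= (1 + x) ^+ n.
Proof.
move=> x0; elim: n => [|n IH]; first by rewrite mul0r addr0 expr0.
rewrite exprS -natr1.
have : (1 + n%:R * x) * (1 + x) <= (1 + x) ^+ n * (1 + x) by rewrite ler_wpM2r//; lra.
have : 0 <= n%:R * x * x :> R by rewrite !mulr_ge0.
lra.
Qed.

Lemma big_scalar (r : R) : exists z : K, r < a z.
Proof.
have [_ [y /andP[y0 y1]] _ _] := lf.
have az1 : 0 < a y^-1 - 1 by rewrite (avV aP) subr_gt0 invf_gt1.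
have [n hn] := nat_unbounded r az1.
exists (y^-1 ^+ n); rewrite (avX aP).
by have := bernoulli n (ltW az1); rewrite [1 + (_ - 1)]addrC subrK; lra.
Qed.

(** The axiom speaks of the unit ball only; dividing by a scalar of large absolute value reduces to
    it. *)
Lemma bounded_subseq (u : nat -> K) (r : R) : (forall n, a (u n) <= r) ->
  exists (phi : nat -> nat) (l : K),
    (forall n, (phi n < phi n.+1)%N) /\ acvg (u \o phi) l.
Proof.
move=> ur; have [z hz] := big_scalar r.
have z0 : 0 < a z by apply: le_lt_trans hz; exact: le_trans (av_ge0 aP _) (ur 0%N).
have zn0 : z != 0 by rewrite -(av_gt0 aP).
have [_ _ _ cpt] := lf.
have [n|phi [l [h /cvgrPdist_lt c]]] := cpt (fun n => u n / z).
  by rewrite (avM aP) (avV aP) ler_pdivrMr// mul1r (le_trans (ur n))// ltW.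
exists phi, (l * z); split=> // e e0.
have [N _ HN] := c (e / a z) (divr_gt0 e0 z0).
exists N => n Nn; have := HN n Nn; rewrite /= sub0r normrN ger0_norm ?(av_ge0 aP)//.
rewrite ltr_pdivlMr// -(avM aP); congr (a _ < _).
by rewrite mulrBl divfK.
Qed.

Lemma bounded_subseq_mx p q (u : nat -> 'M[K]_(p, q)) (r : R) :
  (forall n, mn a (u n) <= r) ->
  exists (phi : nat -> nat) (l : 'M[K]_(p, q)),
    (forall n, (phi n < phi n.+1)%N) /\ mcvg (u \o phi) l.
Proof.
move=> ur.
(* Subsequences are extracted one entry after the other; a further extraction keeps the limits
   already obtained. *)
have H (s : seq ('I_p * 'I_q)) : exists (phi : nat -> nat) (l : 'M[K]_(p, q)),
    (forall n, (phi n < phi n.+1)%N) /\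
    forall x, x \in s -> acvg (fun n => u (phi n) x.1 x.2) (l x.1 x.2).
  elim: s => [|x s [phi [l [h c]]]]; first by exists id, 0; split.
  have [n|psi [k [h' c']]] := @bounded_subseq (fun n => u (phi n) x.1 x.2) r.
    by apply: le_trans (ur (phi n)); exact: mn_ub.
  exists (phi \o psi), (\matrix_(i, j) if (i, j) == x then k else l i j); split.
    exact: (mono_comp h h').
  move=> y; rewrite in_cons mxE -surjective_pairing; have [->//|yx /= ys] := eqVneq y x.
  exact: (acvg_sub h' (c _ ys)).
have [phi [l [h c]]] := H (enum {: 'I_p * 'I_q}).
exists phi, l; split=> // e e0.
have [N HN] : exists N : ('I_p * 'I_q) -> nat, forall x n, (N x <= n)%N ->
    a (u (phi n) x.1 x.2 - l x.1 x.2) < e.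
  have := fun x : 'I_p * 'I_q => c x (mem_enum _ x) e e0.
  by move/choice => [N HN]; exists N => x n; exact: HN.
exists (\max_x N x) => n Nn; apply: mn_lt => // i j; rewrite !mxE.
by apply: (HN (i, j)); apply: leq_trans Nn; exact: leq_bigmax.
Qed.

Lemma cauchy_cvg p q (u : nat -> 'M[K]_(p, q)) (r : R) :
  (forall n, mn a (u n) <= r) ->
  (forall e : R, 0 < e -> exists N : nat, forall n m, (N <= n)%N -> (N <= m)%N ->
     mn a (u n - u m) < e) -> exists l, mcvg u l.
Proof.
move=> ur cu; have [phi [l [h c]]] := bounded_subseq_mx ur.
exists l => e e0; have e20 : 0 < e / 2%:R by rewrite divr_gt0.
have [N HN] := cu _ e20; have [M HM] := c _ e20.
exists N => n Nn; pose m := maxn N M.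
have -> : u n - l = (u n - u (phi m)) + (u (phi m) - l) by rewrite addrA subrK.
apply: le_lt_trans (mnD aP _ _) _; rewrite [ltRHS]splitr ltrD//.
  by apply: HN => //; apply: leq_trans (leq_maxl N M) (mono_ge h _).
by apply: HM; exact: leq_maxr.
Qed.

(** Otherwise points could be picked successively at distance at least [e] from all the earlier
    ones, and such a sequence has no convergent subsequence. *)
Lemma finite_net (r e : R) : 0 < e -> exists s : seq K,
  forall x, a x <= r -> exists2 y, y \in s & a (x - y) < e.
Proof.
move=> e0; apply: contrapT => H.
have /choice[F HF] : forall s : seq K, exists x, a x <= r /\
    forall y, y \in s -> e <= a (x - y).
  move=> s; apply: contrapT => h; apply: H; exists s => x xr.
  apply: contrapT => h2; apply: h; exists x; split=> // y ys.
  by rewrite leNgt; apply/negP => h3; apply: h2; exists y.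
(* [L n] lists the first [n] picks, and [F (L n)] is the next one. *)
pose L := fix L n := if n is n'.+1 then F (L n') :: L n' else [::].
have Lin m n : (m < n)%N -> F (L m) \in L n.
  elim: n => // n IH; rewrite ltnS leq_eqVlt => /orP[/eqP->|/IH h] /=.
    by rewrite inE eqxx.
  by rewrite inE h orbT.
have [n|phi [l [h c]]] := @bounded_subseq (fun n => F (L n)) r.
  by case: (HF (L n)).
have [N HN] := c (e / 2%:R) (divr_gt0 e0 (ltr0Sn R 1)).
have h1 := HN N (leqnn _); have h2 := HN N.+1 (leqnSn _); rewrite /= in h1 h2.
have [_ /(_ _ (Lin _ _ (h N)))] := HF (L (phi N.+1)).
rewrite leNgt => /negP; apply.
have -> : F (L (phi N.+1)) - F (L (phi N)) =
  (F (L (phi N.+1)) - l) - (F (L (phi N)) - l) by ring.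
by apply: le_lt_trans (avB aP _ _) _; rewrite [ltRHS]splitr ltrD.
Qed.

Lemma dense_seq : exists Q : nat -> K, forall x (e : R), 0 < e ->
  exists n, a (x - Q n) < e.
Proof.
have /choice[S HS] : forall m : nat, exists s : seq K,
    forall x, a x <= m%:R -> exists2 y, y \in s & a (x - y) < m.+1%:R^-1.
  by move=> m; apply: finite_net; rewrite invr_gt0.
exists (fun n => if (unpickle n : option (nat * nat)) is Some (m, i)
                 then nth 0 (S m) i else 0) => x e e0.
have [m1 hm1] := nat_unbounded (a x) ltr01.
have [m2 hm2] := nat_unbounded 1 e0.
pose m := maxn m1 m2.
have [|y yS hy] := HS m x.
  rewrite mulr1 in hm1; apply: le_trans (ltW hm1) _.
  by rewrite ler_nat leq_maxl.
exists (pickle (m, index y (S m))); rewrite pickleK nth_index//.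
apply: lt_le_trans hy _; rewrite invf_ple ?posrE// -div1r ler_pdivrMr//.
by apply: le_trans (ltW hm2) _; rewrite ler_pM2r// ler_nat (leq_trans (leq_maxr m1 m2)).
Qed.

End LocalField.

Lemma inv_small (R : realType) (e : R) : 0 < e -> exists n : nat, n.+1%:R^-1 < e.
Proof.
move=> e0; have [n hn] := nat_unbounded 1 e0; exists n.
rewrite invf_plt ?posrE//; apply: lt_trans (_ : n%:R < _); last by rewrite ltr_nat.
by rewrite -div1r ltr_pdivrMr.
Qed.

(** * Measurability of functions with values in the field and in matrices *)

Section KMeasurable.
Variables (R : realType) (K : fieldType) (a : K -> R).
Hypothesis lf : local_field a.
Let aP := local_field_nneg lf.
Context (dX : measure_display) (X : measurableType dX).

Definition kmeas (f : X -> K) : Prop :=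
  forall (c : K) (r : R), measurable [set x | a (f x - c) < r].

Lemma kmeas_cst k : kmeas (fun=> k).
Proof.
move=> c r; have [h|h] := boolP (a (k - c) < r).
  by rewrite (_ : [set _ | _] = setT)//; apply/seteqP; split.
by rewrite (_ : [set _ | _] = set0)//; apply/seteqP; split=> // x /=; rewrite (negbTE h).
Qed.

(** By separability the preimage of a ball is a countable union of products of small balls centred
    in a dense sequence. Sums and products of measurable functions are the instances needed. *)
Lemma kmeas_cts2 (F : K -> K -> K) (f g : X -> K) :
  (forall x y (e : R), 0 < e -> exists2 dl : R, 0 < dl &
     forall x' y', a (x' - x) < dl -> a (y' - y) < dl -> a (F x' y' - F x y) < e) ->
  kmeas f -> kmeas g -> kmeas (fun x => F (f x) (g x)).
Proof.
move=> cF mf mg c r; have [Q HQ] := dense_seq lf.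
pose ok (z : nat * (nat * nat)) := forall x' y',
  a (x' - Q z.2.1) < z.1.+1%:R^-1 -> a (y' - Q z.2.2) < z.1.+1%:R^-1 ->
  a (F x' y' - c) < r.
pose G (z : nat * (nat * nat)) : set X := if `[< ok z >] then
  [set x | a (f x - Q z.2.1) < z.1.+1%:R^-1] `&` [set x | a (g x - Q z.2.2) < z.1.+1%:R^-1]
  else set0.
rewrite (_ : [set x | _] = \bigcup_z G z); last first.
  apply/seteqP; split=> x /=.
    move=> h; have h' : 0 < r - a (F (f x) (g x) - c) by rewrite subr_gt0.
    have [dl dl0 Hdl] := cF (f x) (g x) _ h'.
    have [m Hm] := inv_small (divr_gt0 dl0 (ltr0Sn R 1)).
    have m0 : 0 < m.+1%:R^-1 :> R by rewrite invr_gt0.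
    have [i Hi] := HQ (f x) _ m0; have [j Hj] := HQ (g x) _ m0.
    have okz : ok (m, (i, j)).
      move=> x' y' /= hx hy.
      have -> : F x' y' - c = (F x' y' - F (f x) (g x)) + (F (f x) (g x) - c) by ring.
      apply: le_lt_trans (avD aP _ _) _; rewrite -ltrBrDr; apply: Hdl.
        have -> : x' - f x = (x' - Q i) - (f x - Q i) by ring.
        apply: le_lt_trans (avB aP _ _) _; rewrite [ltRHS]splitr; apply: ltrD; exact: lt_trans Hm.
      have -> : y' - g x = (y' - Q j) - (g x - Q j) by ring.
      apply: le_lt_trans (avB aP _ _) _; rewrite [ltRHS]splitr; apply: ltrD; exact: lt_trans Hm.
    by exists (m, (i, j)) => //; rewrite /G asboolT.
  move=> [z _]; rewrite /G; case: asboolP => // okz [h1 h2].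
  exact: okz.
apply: countable_bigcupT_measurable => [|z]; first exact: countableP.
rewrite /G; case: ifP => // _; apply: measurableI; [exact: mf|exact: mg].
Qed.

Lemma kmeasD (f g : X -> K) : kmeas f -> kmeas g -> kmeas (fun x => f x + g x).
Proof.
apply: (kmeas_cts2 (F := +%R)) => x y e e0.
exists (e / 2%:R) => [|x' y' hx hy]; first by rewrite divr_gt0.
have -> : x' + y' - (x + y) = (x' - x) + (y' - y) by ring.
by apply: le_lt_trans (avD aP _ _) _; rewrite [ltRHS]splitr ltrD.
Qed.

Lemma kmeasM (f g : X -> K) : kmeas f -> kmeas g -> kmeas (fun x => f x * g x).
Proof.
apply: (kmeas_cts2 (F := *%R)) => x y e e0.
have x0 := av_ge0 aP x; have y0 := av_ge0 aP y.
pose c := a x + a y + 1.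
have c0 : 0 < c by rewrite /c; lra.
exists (Num.min 1 (e / c / 2%:R)) => [|x' y' hx hy].
  by rewrite lt_min ltr01 !divr_gt0.
have -> : x' * y' - x * y = (x' - x) * (y' - y) + (x' - x) * y + x * (y' - y) by ring.
apply: le_lt_trans (avD aP _ _) _.
have h1 : a ((x' - x) * (y' - y) + (x' - x) * y) <= a (x' - x) * (1 + a y).
  rewrite -mulrDr (avM aP) ler_wpM2l ?(av_ge0 aP)//.
  apply: le_trans (avD aP _ _) _; rewrite lerD2r ltW//.
  by apply: lt_le_trans hy _; rewrite ge_min lexx.
apply: le_lt_trans (lerD h1 (lexx _)) _; rewrite (avM aP).
have hx' : a (x' - x) < e / c / 2%:R by apply: lt_le_trans hx _; rewrite ge_min lexx orbT.
have hy' : a (y' - y) < e / c / 2%:R by apply: lt_le_trans hy _; rewrite ge_min lexx orbT.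
have h2 : a (x' - x) * (1 + a y) <= e / c / 2%:R * (1 + a y).
  by rewrite ler_wpM2r ?(ltW hx')// addr_ge0.
have h3 : a x * a (y' - y) <= a x * (e / c / 2%:R) by rewrite ler_wpM2l ?(ltW hy').
have h4 : e / c / 2%:R * (1 + a y) + a x * (e / c / 2%:R) = e / 2%:R.
  by rewrite /c; field; rewrite gt_eqF.
have := av_ge0 aP x; lra.
Qed.

Lemma kmeas_sum n (f : 'I_n -> X -> K) :
  (forall i, kmeas (f i)) -> kmeas (fun x => \sum_i f i x).
Proof.
move=> mf; elim: n f mf => [|n IH] f mf.
  by rewrite (_ : (fun x => _) = fun=> 0); [exact: kmeas_cst|apply/funext => x; rewrite big_ord0].
rewrite (_ : (fun x => _) = fun x => f ord0 x + \sum_(i < n) f (lift ord0 i) x).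
  by apply: kmeasD => //; exact: IH.
by apply/funext => x; rewrite big_ord_recl.
Qed.

Lemma kmeasN (f : X -> K) : kmeas f -> kmeas (fun x => - f x).
Proof.
move=> mf c r; have := mf (- c) r; congr (measurable _); apply/funext => x /=.
by rewrite -(avN aP) opprB addrC.
Qed.

Lemma kmeas_av (f : X -> K) : kmeas f -> measurable_fun setT (fun x => a (f x)).
Proof.
move=> mf; apply: (measurability _ (RGenInftyO.measurableE R)).
move=> _ [_ [r ->] <-]; rewrite setTI.
have := mf 0 r; congr (measurable _); apply/funext => x /=.
by rewrite subr0 in_itv.
Qed.

Lemma kmeas_comp (dY : measure_display) (Y : measurableType dY) (h : Y -> X) (f : X -> K) :
  kmeas f -> measurable_fun setT h -> forall c r, measurable [set y | a (f (h y) - c) < r].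
Proof.
by move=> mf mh c r; have := mh measurableT _ (mf c r); rewrite setTI.
Qed.

Definition mkmeas p q (g : X -> 'M[K]_(p, q)) : Prop :=
  forall i j, kmeas (fun x => g x i j).

Lemma mkmeas_cst p q (A : 'M[K]_(p, q)) : mkmeas (fun=> A).
Proof. by move=> i j; exact: kmeas_cst. Qed.

Lemma mkmeasM p d q (g : X -> 'M[K]_(p, d)) (h : X -> 'M[K]_(d, q)) :
  mkmeas g -> mkmeas h -> mkmeas (fun x => g x *m h x).
Proof.
move=> mg mh i j.
rewrite (_ : (fun x => _) = fun x => \sum_k g x i k * h x k j).
  by apply: kmeas_sum => k; exact: kmeasM.
by apply/funext => x; rewrite mxE.
Qed.

Lemma mkmeasB p q (g h : X -> 'M[K]_(p, q)) :
  mkmeas g -> mkmeas h -> mkmeas (fun x => g x - h x).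
Proof.
move=> mg mh i j.
rewrite (_ : (fun x => _) = fun x => g x i j + - h x i j).
  by apply: kmeasD => //; exact: kmeasN.
by apply/funext => x; rewrite !mxE.
Qed.

Lemma measurable_bigmaxr (I : Type) (s : seq I) (f : I -> X -> R) :
  (forall i, measurable_fun setT (f i)) ->
  measurable_fun setT (fun x => \big[Num.max/0]_(i <- s) f i x).
Proof.
move=> mf; elim: s => [|i s IH].
  by rewrite (_ : (fun x => _) = cst 0)//; apply/funext => x; rewrite big_nil.
rewrite (_ : (fun x => _) = fun x => Num.max (f i x) (\big[Num.max/0]_(i <- s) f i x)).
  exact: measurable_maxr.
by apply/funext => x; rewrite big_cons.
Qed.

Lemma measurable_mn p q (g : X -> 'M[K]_(p, q)) :
  mkmeas g -> measurable_fun setT (fun x => mn a (g x)).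
Proof. by move=> mg; apply: measurable_bigmaxr => ij; exact: kmeas_av. Qed.

Lemma measurable_mx2 p q q' (g : X -> 'M[K]_(p, q)) (h : X -> 'M[K]_(p, q')) :
  mkmeas g -> mkmeas h -> measurable_fun setT (fun x => mx2 a (g x) (h x)).
Proof.
move=> mg mh; apply: measurable_bigmaxr => ij; apply: kmeas_av.
by apply: kmeasD; [|apply: kmeasN]; exact: kmeasM.
Qed.

(** If each point of [A] had a neighbourhood of measure zero, it would lie in a null ball taken from
    a countable family, and [A] would be null. This is how positive probabilities are turned into
    actual matrices of the support. *)
Lemma support_point (mu : {measure set X -> \bar R}) p q (g : X -> 'M[K]_(p, q))
    (A : set X) : mkmeas g -> measurable A -> (0 < mu A)%E ->
  exists2 x, A x & forall e : R, 0 < e -> (0 < mu [set y | (mn a (g y - g x) < e)%R])%E.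
Proof.
move=> mg mA A0; have [Q HQ] := dense_seq lf.
pose D := (nat * {ffun 'I_p * 'I_q -> nat})%type.
pose ball (z : D) : set X := \bigcap_(ij in [set: 'I_p * 'I_q])
   [set y | a (g y ij.1 ij.2 - Q (z.2 ij)) < z.1.+1%:R^-1].
have mball z : measurable (ball z).
  by apply: fin_bigcap_measurable => // ij _; exact: mg.
apply: contrapT => H.
have H' x : A x -> exists z, ball z x /\ mu (ball z) = 0.
  move=> Ax; have [e e0 he] : exists2 e : R, 0 < e & mu [set y | mn a (g y - g x) < e] = 0.
    apply: contrapT => h; apply: H; exists x => // e e0; rewrite lt_neqAle measure_ge0 andbT.
    by apply/eqP => h'; apply: h; exists e.
  have [m Hm] := inv_small (divr_gt0 e0 (ltr0Sn R 1)).
  have m0 : 0 < m.+1%:R^-1 :> R by rewrite invr_gt0.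
  have [N HN] := choice (fun ij : 'I_p * 'I_q => HQ (g x ij.1 ij.2) _ m0).
  exists (m, [ffun ij => N ij]); split; first by move=> ij _ /=; rewrite ffunE.
  apply/eqP; rewrite eq_le measure_ge0 andbT -he; apply: le_measure.
  - by rewrite inE.
  - rewrite inE -[X in measurable X]setTI.
    have := measurable_mn (mkmeasB mg (mkmeas_cst (g x))).
    move=> /(_ measurableT [set r | r < e]); rewrite /preimage; apply.
    by rewrite (_ : [set _ | _] = `]-oo, e[%classic)//; apply/seteqP; split=> r; rewrite /= in_itv.
  move=> y hy /=; apply: mn_lt => // i j; rewrite !mxE.
  have := hy (i, j) I; rewrite /= ffunE => h1; have h2 := HN (i, j); rewrite /= in h2.
  have -> : g y i j - g x i j = (g y i j - Q (N (i, j))) - (g x i j - Q (N (i, j))) by ring.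
  by apply: le_lt_trans (avB aP _ _) _; rewrite [ltRHS]splitr; apply: ltrD; exact: lt_trans Hm.
pose B n : set X := if (unpickle n : option D) is Some z then
   (if mu (ball z) == 0 then ball z else set0) else set0.
have AB : A `<=` \bigcup_n B n.
  by move=> x /H'[z [bz mz]]; exists (pickle z) => //; rewrite /B pickleK mz eqxx.
have nB n : mu.-negligible (B n).
  rewrite /B; case: unpickle => [z|]; last exact: negligible_set0.
  by case: eqP => [h|_]; [apply/negligibleP|exact: negligible_set0].
have : mu.-negligible A by apply: negligibleS AB _; exact: negligible_bigcup.
by move/negligibleP => /(_ mA) h; rewrite h ltxx in A0.
Qed.

End KMeasurable.

(** * The space of sequences *)

Definition coord_sets {R : realType} {K : fieldType} (a : K -> R) (d : nat)
    : set (set (nat -> EndE a d)) :=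
  [set A | exists (i : nat) (B : set (EndE a d)), measurable B /\ A = [set x | B (x i)]].

Arguments coord_sets {R K} a d.
Notation SeqE a d := (g_sigma_algebraType (coord_sets a d)).

Definition splice {A : Type} (k : nat) (x y : nat -> A) : nat -> A :=
  fun n => if (n < k)%N then x n else y (n - k)%N.

Section Sequences.
Variables (R : realType) (K : fieldType) (a : K -> R) (d : nat).

Lemma measurable_coord i : measurable_fun setT (fun x : SeqE a d => x i).
Proof.
move=> _ B mB; rewrite setTI; apply: sub_sigma_algebra.
by exists i, B.
Qed.

Lemma measurable_to_seq (dX : measure_display) (X : measurableType dX)
    (f : X -> SeqE a d) :
  (forall i, measurable_fun setT (fun x => f x i)) -> measurable_fun setT f.
Proof.
move=> mf; refine (@measurability _ _ X (SeqE a d) setT f (coord_sets a d) erefl _).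
move=> _ [_ [i [B [mB ->]]] <-]; rewrite setTI.
by have := mf i measurableT B mB; rewrite setTI.
Qed.

Lemma measurable_shift k : measurable_fun setT (fun x : SeqE a d => Defs.shift k x : SeqE a d).
Proof. by apply: measurable_to_seq => i; exact: measurable_coord. Qed.

Lemma measurable_splice k :
  measurable_fun setT (fun z : SeqE a d * SeqE a d => splice k z.1 z.2 : SeqE a d).
Proof.
apply: measurable_to_seq => i; rewrite /splice; case: (i < k)%N.
  by apply: (measurableT_comp (measurable_coord i)); exact: measurable_fst.
by apply: (measurableT_comp (measurable_coord _)); exact: measurable_snd.
Qed.

Definition box (B : nat -> set (EndE a d)) : set (SeqE a d) := [set x | forall i, B i (x i)].

Definition boxes : set (set (SeqE a d)) :=
  [set A | exists (n : nat) (B : nat -> set (EndE a d)),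
     [/\ forall i, measurable (B i), forall i, (n <= i)%N -> B i = setT & A = box B]].

Lemma measurable_box B : (forall i, measurable (B i)) -> measurable (box B).
Proof.
move=> mB; rewrite (_ : box B = \bigcap_i [set x : SeqE a d | B i (x i)]); last first.
  by apply/seteqP; split=> [x h i _|x h i]; [exact: h|exact: (h i I)].
apply: bigcap_measurableType => i _.
by have := measurable_coord i measurableT (mB i); rewrite setTI.
Qed.

Lemma sigma_boxes : @measurable _ (SeqE a d) = <<s boxes >>.
Proof.
apply/seteqP; split.
  apply: smallest_sub; first exact: smallest_sigma_algebra.
  move=> _ [i [B [mB ->]]]; apply: sub_sigma_algebra.
  exists i.+1, (fun j => if j == i then B else setT); split.
  - by move=> j; case: ifP.
  - by move=> j ij; rewrite gtn_eqF.
  - apply/seteqP; split=> x /=; first by move=> h j; case: eqP => // ->.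
    by move=> /(_ i); rewrite eqxx.
apply: smallest_sub; first exact: sigma_algebra_measurable.
by move=> _ [n [B [mB _ ->]]]; exact: measurable_box.
Qed.

Lemma boxes_setI : setI_closed boxes.
Proof.
move=> _ _ [n [B [mB hB ->]]] [m [C [mC hC ->]]].
exists (maxn n m), (fun i => B i `&` C i); split.
- by move=> i; exact: measurableI.
- by move=> i; rewrite geq_max => /andP[/hB-> /hC->]; rewrite setTI.
- by apply/seteqP; split=> x; [move=> [h1 h2] i; split|move=> h; split=> i; case: (h i)].
Qed.

Variables (nu : probability (EndE a d) R) (mu : probability (SeqE a d) R).
Hypothesis mu_box : forall n B, (forall i, measurable (B i)) ->
  (forall i, (n <= i)%N -> B i = setT) -> mu (box B) = (\prod_(i < n) nu (B i))%E.

(** The two measures agree on boxes with finitely many constraints, and these are stable under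
    intersection and generate the sigma-algebra. *)
Lemma splice_law k (A : set (SeqE a d)) : measurable A ->
  mu A = (mu \x mu)%E [set z | A (splice k z.1 z.2)].
Proof.
move=> mA; pose X := fun z : SeqE a d * SeqE a d => splice k z.1 z.2 : SeqE a d.
rewrite -/(pushforward (mu \x mu)%E X A).
have boxT (i : nat) : boxes setT.
  exists 0%N, (fun=> setT); split=> //.
  by apply/seteqP; split.
apply: (@measure_unique _ R (SeqE a d) boxes (fun=> setT) sigma_boxes boxes_setI
   boxT _ mu (measure_function_pushforward__canonical__measure_function_Measure
   (mu \x mu)%E (measurable_splice k))) => //.
- by rewrite bigcup_const.
- move=> _ [n [B [mB hB ->]]].
  pose C i := if (i < k)%N then B i else setT.
  pose D i := B (i + k)%N.
  have mC i : measurable (C i) by rewrite /C; case: ifP.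
  have mD i : measurable (D i) by exact: mB.
  transitivity ((mu \x mu)%E (box C `*` box D)); last first.
    rewrite -[RHS]/((mu \x mu)%E (X @^-1` box B)); apply/esym; congr ((mu \x mu)%E _); apply/seteqP; split=> -[x y] /=.
      move=> h; split=> i /=; rewrite /C /D.
        by case: ifP => // ik; have := h i; rewrite /X /splice ik.
      by have := h (i + k)%N; rewrite /X /splice ltnNge leq_addl /= addnK.
    move=> [h1 h2] i; rewrite /X /splice; case: ltnP => ik.
      by have := h1 i; rewrite /C ik.
    by have := h2 (i - k)%N; rewrite /D subnK.
  rewrite product_measure1E; [|exact: measurable_box|exact: measurable_box].
  have e1 : mu (box B) = (\prod_(i < n + k) nu (B i))%E.
    by apply: mu_box => // i /(leq_trans (leq_addr k n)); exact: hB.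
  have e2 : mu (box C) = (\prod_(i < k) nu (C i))%E.
    by apply: mu_box => // i ki; rewrite /C ltnNge ki.
  have e3 : mu (box D) = (\prod_(i < n) nu (D i))%E.
    by apply: mu_box => // i ni; rewrite /D hB// (leq_trans ni)// leq_addr.
  apply: (etrans e1); apply: esym; apply: (etrans (congr2 mule e2 e3)); apply: esym.
  rewrite addnC big_split_ord /=; congr (_ * _)%E.
    by apply: eq_bigr => i _; rewrite /C ltn_ord.
  by apply: eq_bigr => i _; rewrite /D addnC.
- by move=> i; rewrite (le_lt_trans (probability_le1 _ _))// ltry.
Qed.

Lemma integral_splice k (F : SeqE a d -> \bar R) : measurable_fun setT F ->
  (forall x, 0 <= F x)%E ->
  (\int[mu]_x F x = \int[mu]_x \int[mu]_y F (splice k x y))%E.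
Proof.
move=> mF F0; have mX := measurable_splice k.
transitivity (\int[mu]_x fubini_F mu (fun z : SeqE a d * SeqE a d => F (splice k z.1 z.2)) x)%E => //.
rewrite -fubini_tonelli1; last 2 first.
  exact: (measurableT_comp mF mX).
  by move=> z; exact: F0.
have := @ge0_integral_pushforward _ _ _ _ R _ mX (mu \x mu)%E setT F measurableT mF.
rewrite preimage_setT => <-; last by move=> y _; exact: F0.
apply: eq_measure_integral => A mA _; exact: splice_law.
Qed.

End Sequences.

Section Products.
Variables (R : realType) (K : fieldType) (a : K -> R) (d : nat).
Hypothesis lf : local_field a.
Let aP := local_field_nneg lf.

Definition prodn (n : nat) (x : SeqE a d) : 'M[K]_d := gbar (x : nat -> 'M[K]_d) n.

Lemma prodn0 x : prodn 0 x = 1%:M. Proof. by []. Qed.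

Lemma prodnD m n x : prodn (m + n) x = prodn m x *m prodn n (Defs.shift m x).
Proof.
elim: n => [|n IH]; first by rewrite addn0 mulmx1.
by rewrite addnS /= /prodn /= -/(prodn _ _) IH mulmxA /Defs.shift addnC.
Qed.

Lemma prodnS n x : prodn n.+1 x = prodn 1 x *m prodn n (Defs.shift 1 x).
Proof. by rewrite -add1n prodnD. Qed.

Lemma prodn1 x : prodn 1 x = x 0%N.
Proof. by rewrite /prodn /= mul1mx. Qed.

Lemma shiftD m n (x : SeqE a d) : Defs.shift m (Defs.shift n x) = Defs.shift (n + m) x.
Proof. by apply/funext => i; rewrite /Defs.shift -addnA [(m + n)%N]addnC. Qed.

Lemma shift0 (x : SeqE a d) : Defs.shift 0 x = x.
Proof. by apply/funext => i; rewrite /Defs.shift addn0. Qed.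

Lemma eq_prodn n (x y : SeqE a d) : (forall i, (i < n)%N -> x i = y i) -> prodn n x = prodn n y.
Proof.
elim: n => // n IH h; rewrite /prodn /= -!/(prodn _ _) IH ?h// => i ni.
by apply: h; exact: ltnW.
Qed.

Lemma prodn_splice n k (x y : SeqE a d) : (n <= k)%N -> prodn n (splice k x y) = prodn n x.
Proof.
by move=> nk; apply: eq_prodn => i ni; rewrite /splice (leq_trans ni nk).
Qed.

Lemma shift_splice k (x y : SeqE a d) : Defs.shift k (splice k x y) = y.
Proof. by apply/funext => i; rewrite /Defs.shift /splice ltnNge leq_addl /= addnK. Qed.

Lemma shift_splice_add k m (x y : SeqE a d) :
  Defs.shift (k + m) (splice k x y) = Defs.shift m y.
Proof. by rewrite -shiftD shift_splice. Qed.

Section Measurability.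
Context (dX : measure_display) (X : measurableType dX).

Lemma kmeas_EndE (f : X -> EndE a d) : measurable_fun setT f ->
  mkmeas a (fun x => f x : 'M[K]_d).
Proof.
move=> mf i j c r.
have := mf measurableT [set g : EndE a d | a ((g : 'M[K]_d) i j - c) < r].
rewrite setTI; apply; apply: sub_sigma_algebra.
by exists i, j, c, r.
Qed.

Lemma mkmeas_prodn n (f : X -> SeqE a d) : measurable_fun setT f ->
  mkmeas a (fun x => prodn n (f x)).
Proof.
move=> mf; elim: n => [|n IH]; first exact: mkmeas_cst.
rewrite (_ : (fun x => _) = fun x => prodn n (f x) *m (f x n : 'M[K]_d)) //.
apply: mkmeasM => //; apply: kmeas_EndE.
exact: (measurableT_comp (@measurable_coord R K a d n) mf).
Qed.

Lemma measurable_shiftT k (f : X -> SeqE a d) : measurable_fun setT f ->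
  measurable_fun setT (fun x => Defs.shift k (f x) : SeqE a d).
Proof. by move=> mf; exact: (measurableT_comp (@measurable_shift R K a d k) mf). Qed.

End Measurability.

Variable mu : probability (SeqE a d) R.
(* [mu] is the law of an i.i.d. sequence: resampling all letters from index [k] on does not
   change it. *)
Hypothesis mu_splice : forall k (F : SeqE a d -> \bar R), measurable_fun setT F ->
  (forall x, 0 <= F x)%E ->
  (\int[mu]_x F x = \int[mu]_x \int[mu]_y F (splice k x y))%E.

Implicit Types (f g : SeqE a d -> R) (c : R).

Definition Ex (f : SeqE a d -> R) : \bar R := (\int[mu]_x (f x)%:E)%E.

Lemma Ex_ge0 f : (forall x, 0 <= f x) -> (0 <= Ex f)%E.
Proof. by move=> h; apply: integral_ge0 => x _; rewrite lee_fin. Qed.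

Lemma int_cst (c : \bar R) : (\int[mu]_x c = c)%E.
Proof.
have h := probability_setT mu.
by rewrite integral_cst// -[RHS]mule1; congr (_ * _)%E.
Qed.

Lemma Ex_cst c : Ex (fun=> c) = c%:E.
Proof. exact: int_cst. Qed.

Lemma Ex_le f g : measurable_fun setT f -> measurable_fun setT g ->
  (forall x, 0 <= f x) -> (forall x, f x <= g x) -> (Ex f <= Ex g)%E.
Proof.
move=> mf mg f0 fg; apply: ge0_le_integral => //.
- by move=> x _; rewrite lee_fin.
- exact/measurable_EFinP.
- exact/measurable_EFinP.
- by move=> x _; rewrite lee_fin.
Qed.

Lemma Ex_le_cst f c : measurable_fun setT f ->
  (forall x, 0 <= f x <= c) -> (Ex f <= c%:E)%E.
Proof.
move=> mf h; rewrite -Ex_cst; apply: Ex_le => // x; by case/andP: (h x).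
Qed.

Lemma ExZ c f : 0 <= c -> measurable_fun setT f -> (forall x, 0 <= f x) ->
  Ex (fun x => c * f x) = (c%:E * Ex f)%E.
Proof.
move=> c0 mf f0; rewrite /Ex.
under eq_integral do rewrite EFinM.
rewrite ge0_integralZl//; first exact/measurable_EFinP.
by move=> x _; rewrite lee_fin.
Qed.

Lemma ExD f g : measurable_fun setT f -> measurable_fun setT g ->
  (forall x, 0 <= f x) -> (forall x, 0 <= g x) ->
  Ex (fun x => f x + g x) = (Ex f + Ex g)%E.
Proof.
move=> mf mg f0 g0; rewrite /Ex.
under eq_integral do rewrite EFinD.
rewrite ge0_integralD//; try exact/measurable_EFinP.
all: by move=> x _; rewrite lee_fin.
Qed.

Lemma Ex_sum n (f : 'I_n -> SeqE a d -> R) : (forall i, measurable_fun setT (f i)) ->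
  (forall i x, 0 <= f i x) ->
  Ex (fun x => \sum_i f i x) = (\sum_i Ex (f i))%E.
Proof.
move=> mf f0; rewrite /Ex.
under eq_integral do rewrite -sumEFin.
rewrite ge0_integral_sum//; first by move=> i; exact/measurable_EFinP.
by move=> i x _; rewrite lee_fin.
Qed.

Lemma Ex_indic (A : set (SeqE a d)) : measurable A -> Ex (\1_A) = mu A.
Proof. by move=> mA; rewrite /Ex integral_indic// setIT. Qed.

(** Plays the part of conditioning on the first [k] letters: the bound is proved with the past [x]
    frozen and then integrated. *)
Lemma Ex_splice_le k (F G : SeqE a d -> R) :
  measurable_fun setT F -> (forall x, 0 <= F x) -> measurable_fun setT G ->
  (forall x, Ex (fun y => F (splice k x y)) <= (G x)%:E)%E -> (Ex F <= Ex G)%E.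
Proof.
move=> mF F0 mG FG; rewrite /Ex (mu_splice k); last 2 first.
- exact/measurable_EFinP.
- by move=> x; rewrite lee_fin.
have mFs : measurable_fun setT (fun z : SeqE a d * SeqE a d => (F (splice k z.1 z.2))%:E).
  by apply/measurable_EFinP; exact: (measurableT_comp mF (@measurable_splice R K a d k)).
apply: ge0_le_integral => //.
- by move=> x _; apply: integral_ge0 => y _; rewrite lee_fin.
- apply: (measurable_fun_fubini_tonelli_F (fun z : SeqE a d * SeqE a d => (F (splice k z.1 z.2))%:E)) => //.
  by move=> z; rewrite lee_fin.
- exact/measurable_EFinP.
- by move=> x _; exact: FG.
Qed.

(** Here the future [y] is frozen and the past integrated first, after exchanging the two
    integrals. *)
Lemma Ex_splice_le' k (F G : SeqE a d -> R) :
  measurable_fun setT F -> (forall x, 0 <= F x) -> measurable_fun setT G ->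
  (forall y, Ex (fun x => F (splice k x y)) <= (G y)%:E)%E -> (Ex F <= Ex G)%E.
Proof.
move=> mF F0 mG FG; rewrite /Ex (mu_splice k); last 2 first.
- exact/measurable_EFinP.
- by move=> x; rewrite lee_fin.
have mFs : measurable_fun setT (fun z : SeqE a d * SeqE a d => (F (splice k z.1 z.2))%:E).
  by apply/measurable_EFinP; exact: (measurableT_comp mF (@measurable_splice R K a d k)).
have Fs0 (z : SeqE a d * SeqE a d) : (0 <= (F (splice k z.1 z.2))%:E)%E by rewrite lee_fin.
have := fubini_tonelli (m1 := mu) (m2 := mu) _ mFs Fs0; rewrite /= => ->.
apply: ge0_le_integral => //.
- by move=> x _; apply: integral_ge0 => y _; rewrite lee_fin.
- exact: (measurable_fun_fubini_tonelli_G (fun z : SeqE a d * SeqE a d => (F (splice k z.1 z.2))%:E)).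
- exact/measurable_EFinP.
- by move=> x _; exact: FG.
Qed.

Lemma Ex_shift k (F : SeqE a d -> R) : measurable_fun setT F -> (forall x, 0 <= F x) ->
  Ex (fun x => F (Defs.shift k x)) = Ex F.
Proof.
move=> mF F0; rewrite {1}/Ex (mu_splice k); last 2 first.
- apply/measurable_EFinP; exact: (measurableT_comp mF (@measurable_shift R K a d k)).
- by move=> x; rewrite lee_fin.
under eq_integral => x _ do under eq_integral => y _ do rewrite shift_splice.
exact: int_cst.
Qed.

End Products.

(** * Good blocks *)

Section Windows.
Variables (R : realType) (K : fieldType) (a : K -> R) (d : nat).
Hypothesis lf : local_field a.
Let aP := local_field_nneg lf.
Notation mn := (mn a).
Notation mx2 := (mx2 a).
Implicit Types (g h B : 'M[K]_d).

Section Weights.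
Variables (T : 'M[K]_d -> R) (e : R).

(** Two matrices are carried on the right because the angle between the images of [S_n] and of
    [S_n *m H] requires one block that is aligned with both continuations. *)
Definition good g B h1 h2 : bool :=
  [&& 0 < T B, e * (mn g * mn B) <= mn (g *m B),
      e * (mn B * mn h1) <= mn (B *m h1) & e * (mn B * mn h2) <= mn (B *m h2)].

Definition lweight g B : R :=
  if e * (mn g * mn B) <= mn (g *m B) then 1 - T B else 1 + 2%:R * T B.

Definition rweight h1 h2 B : R :=
  if (e * (mn B * mn h1) <= mn (B *m h1)) && (e * (mn B * mn h2) <= mn (B *m h2))
  then 1 - T B else 1 + 2%:R * T B.

End Weights.

(* T weights the blocks of M letters; [lweight] and [rweight] have mean at most
   theta < 1, and their product is at least 1 at every block which is not good *)
Definition schottky (mu : probability (SeqE a d) R) (M : nat) (T : 'M[K]_d -> R)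
    (e theta tau : R) : Prop :=
  [/\ (0 < M)%N, 0 < e, 0 < theta < 1,
      (forall B, 0 <= T B <= 2%:R^-1) /\ (forall B, 0 < T B -> mx2 B B <= tau * mn B ^+ 2) &
  [/\ (forall (dX : measure_display) (X : measurableType dX) (f : X -> 'M[K]_d),
        mkmeas a f -> measurable_fun setT (fun x => T (f x))),
      (forall g, Ex mu (fun x => lweight T e g (prodn M x)) <= theta%:E)%E &
      (forall h1 h2, Ex mu (fun x => rweight T e h1 h2 (prodn M x)) <= theta%:E)%E]].

Variable mu : probability (SeqE a d) R.
Hypothesis mu_splice : forall k (F : SeqE a d -> \bar R), measurable_fun setT F ->
  (forall x, 0 <= F x)%E ->
  (\int[mu]_x F x = \int[mu]_x \int[mu]_y F (splice k x y))%E.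

Variables (M : nat) (T : 'M[K]_d -> R) (e theta tau : R).
Hypothesis sch : schottky mu M T e theta tau.

Let mT (dX : measure_display) (X : measurableType dX) (f : X -> 'M[K]_d) :
  mkmeas a f -> measurable_fun setT (fun x => T (f x)).
Proof. by case: sch => _ _ _ _ [h _ _]; exact: h. Qed.

Let T0 B : 0 <= T B. Proof. by case: sch => _ _ _ [h _] _; case/andP: (h B). Qed.

Let T1 B : T B <= 2%:R^-1. Proof. by case: sch => _ _ _ [h _] _; case/andP: (h B). Qed.

Let theta0 : 0 < theta. Proof. by case: sch => _ _ /andP[]. Qed.
Let theta1 : theta < 1. Proof. by case: sch => _ _ /andP[]. Qed.

Let lw := lweight T e.
Let rw := rweight T e.
Let gd := good T e.

Lemma lweight_ge0 g B : 0 <= lw g B.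
Proof. by rewrite /lw /lweight; have := T0 B; have := T1 B; case: ifP => _; lra. Qed.

Lemma rweight_ge0 h1 h2 B : 0 <= rw h1 h2 B.
Proof. by rewrite /rw /rweight; have := T0 B; have := T1 B; case: ifP => _; lra. Qed.

(** If [T B = 0] both weights are 1. Otherwise some alignment fails and the product is at least
    [(1 + 2 T) (1 - T) = 1 + T - 2 T^2], which is at least 1 as [T <= 1/2]. The factor 2 of the
    penalty lets one failure outweigh one success. *)
Lemma not_good_ge1 g B h1 h2 : ~~ gd g B h1 h2 -> 1 <= lw g B * rw h1 h2 B.
Proof.
rewrite /gd /good /lw /rw /lweight /rweight; have t0 := T0 B; have t1 := T1 B.
have [TB|TB] := ltP 0 (T B); last first.
  have -> : T B = 0 by apply/eqP; rewrite eq_le TB t0.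
  by rewrite mulr0 addr0 subr0 !if_same mul1r.
rewrite /=; case: ifP => /= _; case: ifP => // _ _; nra.
Qed.

Section MeasurableWeights.
Context (dX : measure_display) (X : measurableType dX).
Variables (G B H1 H2 : X -> 'M[K]_d).
Hypotheses (mG : mkmeas a G) (mB : mkmeas a B) (mH1 : mkmeas a H1) (mH2 : mkmeas a H2).

Lemma measurable_align (A C : X -> 'M[K]_d) : mkmeas a A -> mkmeas a C ->
  measurable_fun setT (fun x => e * (mn (A x) * mn (C x)) <= mn (A x *m C x)).
Proof.
move=> mA mC; apply: measurable_fun_ler.
  apply: measurable_funM => //; apply: measurable_funM; exact: measurable_mn.
by apply: measurable_mn => //; exact: mkmeasM.
Qed.

Lemma measurable_lweight : measurable_fun setT (fun x => lw (G x) (B x)).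
Proof.
apply: measurable_fun_ifT; first exact: measurable_align.
  by apply: measurable_funB => //; exact: mT.
by apply: measurable_funD => //; apply: measurable_funM => //; exact: mT.
Qed.

Lemma measurable_rweight : measurable_fun setT (fun x => rw (H1 x) (H2 x) (B x)).
Proof.
apply: measurable_fun_ifT; first by apply: measurable_and; exact: measurable_align.
  by apply: measurable_funB => //; exact: mT.
by apply: measurable_funD => //; apply: measurable_funM => //; exact: mT.
Qed.

Lemma measurable_good : measurable_fun setT (fun x => gd (G x) (B x) (H1 x) (H2 x)).
Proof.
apply: measurable_and; first by apply: measurable_fun_ltr => //; exact: mT.
by do 2?[apply: measurable_and; first exact: measurable_align]; exact: measurable_align.
Qed.
End MeasurableWeights.

(** The left weight of a block involves only the letters up to its end; the right weight in [rprod]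
    involves only the letters from its beginning on. Each product can therefore be integrated block
    by block, in opposite orders. *)
Fixpoint lprod j g (x : SeqE a d) : R := if j is j'.+1
  then lw g (prodn M x) * lprod j' (g *m prodn M x) (Defs.shift M x) else 1.

Fixpoint rprod j h1 h2 (x : SeqE a d) : R := if j is j'.+1
  then rw (prodn (j' * M) (Defs.shift M x) *m h1) (prodn (j' * M) (Defs.shift M x) *m h2)
          (prodn M x) * rprod j' h1 h2 (Defs.shift M x) else 1.

Fixpoint bad j g h1 h2 (x : SeqE a d) : bool := if j is j'.+1
  then ~~ gd g (prodn M x) (prodn (j' * M) (Defs.shift M x) *m h1)
             (prodn (j' * M) (Defs.shift M x) *m h2)
       && bad j' (g *m prodn M x) h1 h2 (Defs.shift M x) else true.

Lemma lprod_ge0 j g x : 0 <= lprod j g x.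
Proof. by elim: j g x => //= j IH g x; rewrite mulr_ge0 ?lweight_ge0. Qed.

Lemma rprod_ge0 j h1 h2 x : 0 <= rprod j h1 h2 x.
Proof. by elim: j x => //= j IH x; rewrite mulr_ge0 ?rweight_ge0. Qed.

Lemma bad_ge1 j g h1 h2 x : bad j g h1 h2 x -> 1 <= lprod j g x * rprod j h1 h2 x.
Proof.
elim: j g x => [|j IH] g x /=; first by rewrite mul1r.
move=> /andP[/not_good_ge1 h /IH h']; rewrite mulrACA.
by rewrite -[X in X <= _]mul1r; apply: ler_pM.
Qed.

(** Arithmetic-geometric inequality: on the bad event the two products multiply to at least 1, so
    their mean is at least 1. This separates past from future, which the product of the two does
    not. *)
Lemma bad_le j g h1 h2 x : (bad j g h1 h2 x)%:R <= 2%:R^-1 * (lprod j g x + rprod j h1 h2 x).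
Proof.
move: (lprod_ge0 j g x) (rprod_ge0 j h1 h2 x) (@bad_ge1 j g h1 h2 x).
move: (lprod _ _ _) (rprod _ _ _ _) => p q p0 q0.
case: (bad j g h1 h2 x) => [/(_ isT) h|_] /=; last by rewrite mulr_ge0 ?addr_ge0.
have h2' : 4%:R <= (p + q) ^+ 2 by have := sqr_ge0 (p - q); nra.
rewrite ler_pdivlMl// mulr1 leNgt; apply/negP => h3.
have : (p + q) ^+ 2 <= 2%:R * (p + q) by rewrite expr2 ler_wpM2r ?addr_ge0// ltW.
lra.
Qed.

Lemma bad_splice j g h1 h2 (x y : SeqE a d) k : (j * M <= k)%N ->
  bad j g h1 h2 (splice k x y) = bad j g h1 h2 x.
Proof.
elim: j g x k => //= j IH g x k; rewrite mulSn => jk.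
have Mk : (M <= k)%N by apply: leq_trans jk; rewrite leq_addr.
have sE : Defs.shift M (splice k x y) = splice (k - M) (Defs.shift M x) y.
  apply/funext => i; rewrite /Defs.shift /splice ltn_subRL addnC.
  by case: ifP => // _; congr (y _); lia.
have jkM : (j * M <= k - M)%N by lia.
by rewrite prodn_splice// sE IH// prodn_splice.
Qed.

Section MeasurableProducts.
Context (dX : measure_display) (X : measurableType dX).

Lemma measurable_lprod j (G : X -> 'M[K]_d) (f : X -> SeqE a d) :
  mkmeas a G -> measurable_fun setT f -> measurable_fun setT (fun x => lprod j (G x) (f x)).
Proof.
elim: j G f => [|j IH] G f mG mf /=; first exact: measurable_cst.
have mp := mkmeas_prodn lf M mf.
apply: measurable_funM; first exact: measurable_lweight.
by apply: IH; [exact: mkmeasM|exact: measurable_shiftT].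
Qed.

Lemma measurable_rprod j (H1 H2 : X -> 'M[K]_d) (f : X -> SeqE a d) :
  mkmeas a H1 -> mkmeas a H2 -> measurable_fun setT f ->
  measurable_fun setT (fun x => rprod j (H1 x) (H2 x) (f x)).
Proof.
move=> mH1 mH2; elim: j f => [|j IH] f mf /=; first exact: measurable_cst.
have mp := mkmeas_prodn lf M mf; have ms := measurable_shiftT M mf.
apply: measurable_funM; last exact: IH.
by apply: measurable_rweight => //; apply: mkmeasM => //; exact: mkmeas_prodn.
Qed.

Lemma measurable_bad j (G H1 H2 : X -> 'M[K]_d) (f : X -> SeqE a d) :
  mkmeas a G -> mkmeas a H1 -> mkmeas a H2 -> measurable_fun setT f ->
  measurable_fun setT (fun x => bad j (G x) (H1 x) (H2 x) (f x)).
Proof.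
move=> mG mH1 mH2; elim: j G f mG => [|j IH] G f mG mf /=; first exact: measurable_cst.
have mp := mkmeas_prodn lf M mf; have ms := measurable_shiftT M mf.
apply: measurable_and; last by apply: IH => //; exact: mkmeasM.
apply: measurable_neg; apply: measurable_good => //; apply: mkmeasM => //; exact: mkmeas_prodn.
Qed.
End MeasurableProducts.

(** Once the first block is frozen, the remaining product has mean at most [theta ^+ j] for every
    left matrix; the first weight is integrated last. *)
Lemma Ex_lprod j g : (Ex mu (lprod j g) <= (theta ^+ j)%:E)%E.
Proof.
elim: j g => [|j IH] g; first by rewrite /= Ex_cst.
have mp : mkmeas a (fun x : SeqE a d => prodn M x) by exact: mkmeas_prodn.
apply: (@le_trans _ _ (Ex mu (fun x => theta ^+ j * lw g (prodn M x)))).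
  apply: (Ex_splice_le mu_splice (k := M)).
  - by apply: measurable_lprod => //; exact: mkmeas_cst.
  - by move=> x; exact: lprod_ge0.
  - by apply: measurable_funM => //; apply: measurable_lweight => //; exact: mkmeas_cst.
  move=> x; rewrite (_ : (fun y => _) =
      fun y => lw g (prodn M x) * lprod j (g *m prodn M x) y); last first.
    by apply/funext => y /=; rewrite prodn_splice// shift_splice.
  rewrite ExZ ?lweight_ge0//; last 2 first.
  - by apply: measurable_lprod => //; exact: mkmeas_cst.
  - by move=> y; exact: lprod_ge0.
  by rewrite mulrC EFinM; apply: lee_wpmul2l; rewrite ?lee_fin ?lweight_ge0.
rewrite ExZ ?exprn_ge0 ?(ltW theta0)//; last 2 first.
- by apply: measurable_lweight => //; exact: mkmeas_cst.
- by move=> x; exact: lweight_ge0.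
rewrite exprSr EFinM; apply: lee_wpmul2l; first by rewrite lee_fin exprn_ge0 ?ltW.
by case: sch => _ _ _ _ [_ h _]; exact: h.
Qed.

(** The later blocks are frozen, since the first weight depends on them through the matrices on its
    right; its mean over the first block is at most [theta] for all of these. *)
Lemma Ex_rprod j h1 h2 : (Ex mu (rprod j h1 h2) <= (theta ^+ j)%:E)%E.
Proof.
elim: j => [|j IH]; first by rewrite /= Ex_cst.
have mp : mkmeas a (fun x : SeqE a d => prodn M x) by exact: mkmeas_prodn.
have mr : measurable_fun setT (rprod j h1 h2).
  by apply: measurable_rprod => //; exact: mkmeas_cst.
apply: (@le_trans _ _ (Ex mu (fun x => theta * rprod j h1 h2 x))).
  apply: (Ex_splice_le' mu_splice (k := M)).
  - by apply: (measurable_rprod j.+1) => //; exact: mkmeas_cst.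
  - by move=> x; exact: (rprod_ge0 j.+1).
  - exact: measurable_funM.
  move=> y; rewrite (_ : (fun x => _) = fun x => rprod j h1 h2 y *
      rw (prodn (j * M) y *m h1) (prodn (j * M) y *m h2) (prodn M x)); last first.
    by apply/funext => x /=; rewrite prodn_splice// shift_splice mulrC.
  rewrite ExZ ?rprod_ge0//; last 2 first.
  - by apply: measurable_rweight => //; exact: mkmeas_cst.
  - by move=> x; exact: rweight_ge0.
  rewrite mulrC EFinM; apply: lee_wpmul2l; first by rewrite lee_fin rprod_ge0.
  by case: sch => _ _ _ _ [_ _ h]; exact: h.
rewrite ExZ ?(ltW theta0)//; last by move=> x; exact: rprod_ge0.
by rewrite exprS EFinM; apply: lee_wpmul2l; rewrite ?lee_fin ?(ltW theta0).
Qed.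

Lemma measurable_natr (dX : measure_display) (X : measurableType dX) (b : X -> bool) :
  measurable_fun setT b -> measurable_fun setT (fun x => (b x)%:R : R).
Proof.
move=> mb; rewrite (_ : (fun x => _) = fun x => if b x then 1 else 0); last first.
  by apply/funext => x; case: (b x).
by apply: measurable_fun_ifT => //; exact: measurable_cst.
Qed.

Lemma Ex_bad j g h1 h2 : (Ex mu (fun x => (bad j g h1 h2 x)%:R) <= (theta ^+ j)%:E)%E.
Proof.
have ml : measurable_fun setT (lprod j g).
  by apply: measurable_lprod => //; exact: mkmeas_cst.
have mr : measurable_fun setT (rprod j h1 h2).
  by apply: measurable_rprod => //; exact: mkmeas_cst.
apply: (@le_trans _ _ (Ex mu (fun x => 2%:R^-1 * (lprod j g x + rprod j h1 h2 x)))).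
  apply: Ex_le => //; last by move=> x; exact: bad_le.
    by apply/measurable_natr/measurable_bad => //; exact: mkmeas_cst.
  by apply: measurable_funM => //; exact: measurable_funD.
rewrite ExZ ?invr_ge0//; last 2 first.
- exact: measurable_funD.
- by move=> x; rewrite addr_ge0 ?lprod_ge0 ?rprod_ge0.
rewrite ExD//; last 2 first.
- by move=> x; exact: lprod_ge0.
- by move=> x; exact: rprod_ge0.
apply: (@le_trans _ _ (2%:R^-1%:E * ((theta ^+ j)%:E + (theta ^+ j)%:E))%E).
  apply: lee_wpmul2l; first by rewrite lee_fin invr_ge0.
  by apply: leeD; [exact: Ex_lprod|exact: Ex_rprod].
by rewrite -EFinD -EFinM lee_fin; lra.
Qed.

(** [Ex_bad] is uniform in the right-hand matrices, so these may be random provided they only read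
    the letters after the [j] blocks. *)
Lemma Ex_bad_tail j g (H1 H2 : SeqE a d -> 'M[K]_d) : mkmeas a H1 -> mkmeas a H2 ->
  (Ex mu (fun z => (bad j g (H1 (Defs.shift (j * M) z)) (H2 (Defs.shift (j * M) z)) z)%:R)
     <= (theta ^+ j)%:E)%E.
Proof.
move=> mH1 mH2; rewrite -(Ex_cst mu); apply: (Ex_splice_le' mu_splice (k := (j * M)%N)) => //.
  apply/measurable_natr/measurable_bad => //; first exact: mkmeas_cst.
  - by move=> i i'; apply: (kmeas_comp (mH1 i i')); exact: measurable_shift.
  - by move=> i i'; apply: (kmeas_comp (mH2 i i')); exact: measurable_shift.
move=> y; rewrite (_ : (fun x => _) = fun x => (bad j g (H1 y) (H2 y) x)%:R) ?Ex_bad//.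
by apply/funext => x; rewrite shift_splice bad_splice.
Qed.

(** The induction removes the first block and tests it only when all the later ones are bad, so the
    block found is the last good one. *)
Lemma last_good J g h1 h2 (z : SeqE a d) : bad J g h1 h2 z \/
  exists2 k, (k < J)%N &
    gd (g *m prodn (k * M) z) (prodn M (Defs.shift (k * M) z))
       (prodn ((J - k.+1) * M) (Defs.shift (k.+1 * M) z) *m h1)
       (prodn ((J - k.+1) * M) (Defs.shift (k.+1 * M) z) *m h2) /\
    bad (J - k.+1) (g *m prodn (k.+1 * M) z) h1 h2 (Defs.shift (k.+1 * M) z).
Proof.
elim: J g z => [|J IH] g z; first by left.
have [b|[k kJ [h1' h2']]] := IH (g *m prodn M z) (Defs.shift M z); last first.
  rewrite !shiftD -!mulmxA -!prodnD -!mulSn in h1' h2'.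
  by right; exists k.+1.
case: (boolP (gd g (prodn M z) (prodn (J * M) (Defs.shift M z) *m h1)
   (prodn (J * M) (Defs.shift M z) *m h2))) => G; last by left; rewrite /= G b.
by right; exists 0%N => //; rewrite subn1 /= mul1n mul0n prodn0 mulmx1 shift0.
Qed.

End Windows.

(** * The inequality obtained by cutting at the last good block *)

Section Recursion.
Variables (R : realType) (K : fieldType) (a : K -> R) (d : nat).
Hypothesis lf : local_field a.
Let aP := local_field_nneg lf.
Variable mu : probability (SeqE a d) R.
Hypothesis mu_splice : forall k (F : SeqE a d -> \bar R), measurable_fun setT F ->
  (forall x, 0 <= F x)%E ->
  (\int[mu]_x F x = \int[mu]_x \int[mu]_y F (splice k x y))%E.
Variables (M : nat) (T : 'M[K]_d -> R) (e theta tau : R).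
Hypothesis sch : schottky mu M T e theta tau.
Let theta0 : 0 < theta. Proof. by case: sch => _ _ /andP[]. Qed.
Let theta1 : theta < 1. Proof. by case: sch => _ _ /andP[]. Qed.
Let bd := @bad R K a d M T e.
Let gd := @good R K a d T e.
Let ps : forall k, measurable_fun setT (fun x : SeqE a d => Defs.shift k x : SeqE a d) :=
  fun k => @measurable_shift R K a d k.
Let mp n k : mkmeas a (fun x : SeqE a d => prodn n (Defs.shift k x)) := mkmeas_prodn lf n (ps k).
Let mp0 n : mkmeas a (fun x : SeqE a d => prodn n x) :=
  mkmeas_prodn lf n (@measurable_id _ (SeqE a d) setT).

(** The first [r] letters are a remainder, and [H1], [H2] read the letters after the [J] blocks.
    When block [k] is the last good one, [W] is bounded by a factor [V] of the letters before it and
    a factor [U] of the letters from it on. The bound [c k] on the latter, restricted to the later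
    blocks being bad, is uniform in the left matrix, so the expectation factorises. The first term
    is the case where all blocks are bad. *)
Lemma window_rec (r J : nat) (H1 H2 : SeqE a d -> 'M[K]_d) (W : SeqE a d -> R)
    (V : 'M[K]_d -> R) (U : nat -> SeqE a d -> R) (w0 : R) (c v : nat -> R) :
  mkmeas a H1 -> mkmeas a H2 -> measurable_fun setT W -> (forall z, 0 <= W z <= w0) ->
  (forall n, measurable_fun setT (fun x : SeqE a d => V (prodn n x))) -> (forall g, 0 <= V g) ->
  (forall k, measurable_fun setT (U k)) -> (forall k z, 0 <= U k z) ->
  (forall k z, (k < J)%N ->
     gd (prodn (r + k * M) z) (prodn M (Defs.shift (r + k * M) z))
        (prodn ((J - k.+1) * M) (Defs.shift (r + k.+1 * M) z) *m H1 (Defs.shift (r + J * M) z))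
        (prodn ((J - k.+1) * M) (Defs.shift (r + k.+1 * M) z) *m H2 (Defs.shift (r + J * M) z)) ->
     W z <= V (prodn (r + k * M) z) * U k (Defs.shift (r + k * M) z)) ->
  (forall k, 0 <= c k) ->
  (forall k g, (k < J)%N -> (Ex mu (fun y => (U k y *
     (bd (J - k.+1) (g *m prodn M y) (H1 (Defs.shift ((J - k) * M) y))
         (H2 (Defs.shift ((J - k) * M) y)) (Defs.shift M y))%:R)%R) <= (c k)%:E)%E) ->
  (forall k, (k < J)%N -> (Ex mu (fun x => V (prodn (r + k * M) x)) <= (v k)%:E)%E) ->
  (Ex mu W <= (w0 * theta ^+ J + \sum_(k < J) c k * v k)%:E)%E.
Proof.
move=> mH1 mH2 mW Wb mV V0 mU U0 hW c0 hc hv.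
have mHs (H : SeqE a d -> 'M[K]_d) k : mkmeas a H -> mkmeas a (fun z : SeqE a d => H (Defs.shift k z)).
  by move=> mH i j; apply: (kmeas_comp (mH i j)); exact: ps.
have w00 : 0 <= w0 by have /andP[h1 h2] := Wb point; exact: le_trans h2.
pose B (z : SeqE a d) := (bd J (prodn r z) (H1 (Defs.shift (r + J * M) z)) (H2 (Defs.shift (r + J * M) z))
              (Defs.shift r z))%:R : R.
pose F k (z : SeqE a d) := V (prodn (r + k * M) z) * (U k (Defs.shift (r + k * M) z) *
  (bd (J - k.+1) (prodn (r + k * M) z *m prodn M (Defs.shift (r + k * M) z))
    (H1 (Defs.shift ((J - k) * M) (Defs.shift (r + k * M) z)))
    (H2 (Defs.shift ((J - k) * M) (Defs.shift (r + k * M) z)))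
    (Defs.shift M (Defs.shift (r + k * M) z)))%:R).
have mB : measurable_fun setT B.
  by apply/measurable_natr/(measurable_bad lf sch) => //; exact: mHs.
have mUb k g : measurable_fun setT (fun y : SeqE a d => U k y *
     (bd (J - k.+1) (g *m prodn M y) (H1 (Defs.shift ((J - k) * M) y))
         (H2 (Defs.shift ((J - k) * M) y)) (Defs.shift M y))%:R).
  apply: measurable_funM => //; apply/measurable_natr/(measurable_bad lf sch) => //; try exact: mHs.
  by apply: mkmeasM => //; exact: mkmeas_cst.
have mF k : measurable_fun setT (F k).
  apply: measurable_funM => //; apply: measurable_funM.
    exact: (measurableT_comp (mU k) (ps _)).
  apply/measurable_natr/(measurable_bad lf sch) => //.
  - exact: mkmeasM.
  - by move=> i j; apply: (kmeas_comp (mHs H1 _ mH1 i j)); exact: ps.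
  - by move=> i j; apply: (kmeas_comp (mHs H2 _ mH2 i j)); exact: ps.
  - exact: (measurableT_comp (ps _) (ps _)).
have F0 k z : 0 <= F k z by rewrite !mulr_ge0.
have B0 z : 0 <= B z by [].
(* Pointwise, [W] is at most [w0] if all blocks are bad, and at most the term of the last good block
   otherwise; the remaining terms are nonnegative. *)
apply: (@le_trans _ _ (Ex mu (fun z => w0 * B z + \sum_(k < J) F k z))).
  apply: Ex_le => //.
  - apply: measurable_funD; first exact: measurable_funM.
    by apply: measurable_sum => k; exact: mF.
  - by move=> z; case/andP: (Wb z).
  move=> z; have [b|[k kJ [G b]]] := @last_good R K a d M T e J (prodn r z)
     (H1 (Defs.shift (r + J * M) z)) (H2 (Defs.shift (r + J * M) z)) (Defs.shift r z).
    rewrite /B /bd b mulr1; case/andP: (Wb z) => _ /le_trans; apply.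
    by rewrite lerDl sumr_ge0.
  rewrite !shiftD -!prodnD in G b.
  rewrite (bigD1 (Ordinal kJ)) //= addrCA; apply: le_trans (hW _ _ kJ G) _.
  apply: (@le_trans _ _ (F k z)); last by rewrite lerDl addr_ge0 ?mulr_ge0 ?sumr_ge0.
  rewrite /F !shiftD -prodnD.
  have -> : (r + k * M + (J - k) * M = r + J * M)%N by rewrite -addnA -mulnDl subnKC// ltnW.
  have -> : (r + k * M + M = r + k.+1 * M)%N by rewrite mulSn; lia.
  by rewrite /bd b mulr1.
rewrite ExD//; last 4 first.
- exact: measurable_funM.
- by apply: measurable_sum => k; exact: mF.
- by move=> z; rewrite mulr_ge0.
- by move=> z; rewrite sumr_ge0.
rewrite ExZ// Ex_sum// EFinD; apply: leeD.
  rewrite EFinM; apply: lee_wpmul2l; first by rewrite lee_fin.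
  rewrite -(Ex_cst mu); apply: (Ex_splice_le mu_splice (k := r)) => // x.
  rewrite (_ : (fun y => _) = fun y => (bd J (prodn r x) (H1 (Defs.shift (J * M) y))
     (H2 (Defs.shift (J * M) y)) y)%:R).
    exact: (Ex_bad_tail lf mu_splice sch).
  by apply/funext => y; rewrite /B prodn_splice// shift_splice_add shift_splice.
rewrite -sumEFin; apply: lee_sum => k _.
apply: (@le_trans _ _ (Ex mu (fun x => c k * V (prodn (r + k * M) x)))).
  apply: (Ex_splice_le mu_splice (k := (r + k * M)%N)) => //.
    exact: measurable_funM.
  move=> x; rewrite mulrC.
  rewrite (_ : (fun y => _) = fun y => V (prodn (r + k * M) x) * (U k y *
     (bd (J - k.+1) (prodn (r + k * M) x *m prodn M y) (H1 (Defs.shift ((J - k) * M) y))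
         (H2 (Defs.shift ((J - k) * M) y)) (Defs.shift M y))%:R)); last first.
    by apply/funext => y; rewrite /F prodn_splice// shift_splice.
  rewrite ExZ//; last by move=> y; rewrite mulr_ge0.
  by rewrite EFinM; apply: lee_wpmul2l; rewrite ?lee_fin ?hc.
rewrite ExZ// EFinM; apply: lee_wpmul2l; rewrite ?lee_fin//.
exact: hv.
Qed.

End Recursion.

(** * Moments of the gap *)

Section Gap.
Variables (R : realType) (K : fieldType) (a : K -> R) (d : nat).
Hypothesis aP : nneg_absval a.
Hypothesis d0 : (0 < d)%N.
Notation D := (d%:R : R).

Let D1 : 1 <= D. Proof. by rewrite ler1n. Qed.
Let D0 : 0 < D. Proof. exact: lt_le_trans D1. Qed.

Let Dc (c : R) : 0 < c -> 0 <= D ^+ 2 / c ^+ 2.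
Proof. by move=> c0; rewrite divr_ge0// exprn_ge0// ltW. Qed.

Definition gapratio p q q' (A : 'M[K]_(p, q)) (B : 'M[K]_(p, q')) : R :=
  mx2 a A B / (mn a A * mn a B).

(* The max-norm analogue of [sigma], equal to 0 at [h = 0] since [x / 0 = 0]. *)
Definition sg (h : 'M[K]_d) : R := gapratio h h.

Lemma gapratio_ge0 p q q' (A : 'M[K]_(p, q)) (B : 'M[K]_(p, q')) : 0 <= gapratio A B.
Proof. by rewrite divr_ge0 ?mulr_ge0 ?(mx2_ge0 aP) ?(mn_ge0 aP). Qed.

Lemma gapratio_le2 p q q' (A : 'M[K]_(p, q)) (B : 'M[K]_(p, q')) : gapratio A B <= 2%:R.
Proof.
have [h|h] := ltP 0 (mn a A * mn a B).
  by rewrite /gapratio ler_pdivrMr// (mx2_mn aP).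
have -> : gapratio A B = 0; last by [].
rewrite /gapratio (_ : mn a A * mn a B = 0) ?invr0 ?mulr0//.
by apply/eqP; rewrite eq_le h mulr_ge0 ?(mn_ge0 aP).
Qed.

Lemma sg_ge0 h : 0 <= sg h. Proof. exact: gapratio_ge0. Qed.

Lemma sg_le2 h : sg h <= 2%:R. Proof. exact: gapratio_le2. Qed.

Lemma mx2_sg h : mx2 a h h = sg h * mn a h ^+ 2.
Proof.
have [->|h0] := eqVneq h 0.
  rewrite (mn0 aP) expr0n /= mulr0; apply/eqP; rewrite eq_le (mx2_ge0 aP) andbT.
  by apply: le_trans (mx2_mn aP _ _) _; rewrite (mn0 aP) !mulr0.
by rewrite /sg /gapratio -expr2 divfK// expf_neq0// (mn_eq0 aP).
Qed.

(** [mx2M] bounds the numerator by the gap of [S], and the two alignments prevent the norms in the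
    denominator from collapsing. *)
Lemma gapratio_mul (c : R) (S X Y : 'M[K]_d) : 0 < c ->
  c * (mn a S * mn a X) <= mn a (S *m X) -> c * (mn a S * mn a Y) <= mn a (S *m Y) ->
  gapratio (S *m X) (S *m Y) <= D ^+ 2 / c ^+ 2 * sg S.
Proof.
move=> c0 hX hY; have rhs0 : 0 <= D ^+ 2 / c ^+ 2 * sg S.
  by rewrite mulr_ge0 ?sg_ge0// divr_ge0 ?exprn_ge0 ?ltW.
have [h|h] := ltP 0 (mn a (S *m X) * mn a (S *m Y)); last first.
  rewrite /gapratio (_ : mn a _ * mn a _ = 0) ?invr0 ?mulr0//.
  by apply/eqP; rewrite eq_le h mulr_ge0 ?(mn_ge0 aP).
rewrite /gapratio ler_pdivrMr//; apply: le_trans (mx2M aP _ _ _) _.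
rewrite mx2_sg.
have s0 := mn_ge0 aP S; have x0 := mn_ge0 aP X; have y0 := mn_ge0 aP Y.
have hXY : c ^+ 2 * (mn a S ^+ 2 * (mn a X * mn a Y)) <= mn a (S *m X) * mn a (S *m Y).
  apply: le_trans (ler_pM _ _ hX hY); rewrite ?mulr_ge0 ?(ltW c0)//.
  by rewrite le_eqVlt; apply/orP; left; apply/eqP; ring.
apply: (@le_trans _ _ (D ^+ 2 / c ^+ 2 * sg S * (c ^+ 2 * (mn a S ^+ 2 * (mn a X * mn a Y))))).
  rewrite le_eqVlt; apply/orP; left; apply/eqP; field; exact: lt0r_neq0.
exact: ler_wpM2l.
Qed.

(** The second exterior power is submultiplicative up to a constant, and the alignment makes the
    norm supermultiplicative; their quotient behaves accordingly. *)
Lemma sg_mul (c : R) (g h : 'M[K]_d) : 0 < c -> c * (mn a g * mn a h) <= mn a (g *m h) ->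
  sg (g *m h) <= D ^+ 2 / c ^+ 2 * (sg g * sg h).
Proof.
move=> c0 gh; have [->|] := eqVneq (g *m h) 0.
  rewrite {1}/sg /gapratio (mn0 aP) mulr0 invr0 mulr0.
  by apply: mulr_ge0; [exact: Dc|rewrite mulr_ge0 ?sg_ge0].
rewrite -(mn_gt0 aP) => h0.
rewrite {1}/sg /gapratio ler_pdivrMr ?mulr_gt0//.
apply: le_trans (mx2_mul aP _ _) _; rewrite !mx2_sg.
have g0 := mn_ge0 aP g; have h0' := mn_ge0 aP h.
have hh : c ^+ 2 * (mn a g ^+ 2 * mn a h ^+ 2) <= mn a (g *m h) * mn a (g *m h).
  apply: le_trans (ler_pM _ _ gh gh); rewrite ?mulr_ge0 ?(ltW c0)//.
  by rewrite le_eqVlt; apply/orP; left; apply/eqP; ring.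
apply: (@le_trans _ _ (D ^+ 2 / c ^+ 2 * (sg g * sg h) * (c ^+ 2 * (mn a g ^+ 2 * mn a h ^+ 2)))).
  rewrite le_eqVlt; apply/orP; left; apply/eqP; field; exact: lt0r_neq0.
apply: ler_wpM2l => //.
by apply: mulr_ge0; [exact: Dc|rewrite mulr_ge0 ?sg_ge0].
Qed.

Variables (T : 'M[K]_d -> R) (e tau : R).
Hypotheses (tau0 : 0 <= tau) (e0 : 0 < e) (Ttau : forall B, 0 < T B -> mx2 a B B <= tau * mn a B ^+ 2).
Hypothesis tau1 : 2%:R * D ^+ 3 * (e + D) * tau <= e ^+ 3.
Hypothesis tau2 : 16%:R * D ^+ 6 * tau <= e ^+ 6.

(** [mul3_lb] yields [e^2 / 2] times the three norms, and [|B h|] is at most [D |B| |h|]: this is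
    the resulting constant when [g B h] is split just after [g]. *)
Definition calign : R := e ^+ 2 / 2%:R / D.

Lemma calign_gt0 : 0 < calign.
Proof. by rewrite /calign !divr_gt0 ?exprn_gt0. Qed.

Lemma good_sym g B h1 h2 : good a T e g B h1 h2 -> good a T e g B h2 h1.
Proof. by rewrite /good => /and4P[-> -> -> ->]. Qed.

Lemma good_mul3 g B h1 h2 : good a T e g B h1 h2 ->
  e ^+ 2 / 2%:R * (mn a g * mn a B * mn a h1) <= mn a (g *m B *m h1).
Proof.
rewrite /good => /and4P[/Ttau hB hg h _].
exact: (mul3_lb aP d0 d0 e0 tau1 hB hg h).
Qed.

Lemma good_align g B h1 h2 : good a T e g B h1 h2 ->
  calign * (mn a g * mn a (B *m h1)) <= mn a (g *m (B *m h1)).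
Proof.
move=> G; rewrite mulmxA; apply: le_trans (good_mul3 G).
rewrite /calign -[X in X <= _]mulrA; apply: ler_wpM2l.
  by rewrite divr_ge0// exprn_ge0// ltW.
rewrite ler_pdivrMl// -[mn a g * _ * _]mulrA mulrCA; apply: ler_wpM2l; first exact: mn_ge0.
exact: mnM.
Qed.

Lemma good_neq0 g B h1 h2 : good a T e g B h1 h2 -> g != 0 -> B != 0 -> h1 != 0 ->
  g *m B *m h1 != 0.
Proof.
move=> G; rewrite -!(mn_gt0 aP) => g0 B0 h0; apply: lt_le_trans (good_mul3 G).
by rewrite !mulr_gt0// ?exprn_gt0// invr_gt0.
Qed.

(** The block has gap at most [tau] and [h1] has gap at most 2, so [B *m h1] has gap at most
    [2 tau D^2 / e^2]. Splitting after [g] costs [D^2 / calign^2]. The total factor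
    [8 D^6 tau / e^6] is at most 1/2 by [tau2]. *)
Lemma good_contract g B h1 h2 : good a T e g B h1 h2 ->
  sg (g *m (B *m h1)) <= 2%:R^-1 * sg g.
Proof.
move=> G; apply: le_trans (sg_mul calign_gt0 (good_align G)) _.
have : sg (B *m h1) <= D ^+ 2 / e ^+ 2 * (sg B * sg h1).
  by apply: sg_mul => //; case/and4P: G.
have sB : sg B <= tau.
  case/and4P: G => TB _ _ _; have [->|B0] := eqVneq B 0.
    by rewrite /sg /gapratio (mn0 aP) mulr0 invr0 mulr0.
  by rewrite /sg /gapratio ler_pdivrMr -expr2 ?Ttau// exprn_gt0// (mn_gt0 aP).
move=> h.
have {}h : sg (B *m h1) <= D ^+ 2 / e ^+ 2 * (tau * 2%:R).
  apply: le_trans h _; apply: ler_wpM2l; first exact: Dc.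
  by apply: ler_pM; rewrite ?sg_ge0 ?sg_le2.
apply: (@le_trans _ _ (D ^+ 2 / calign ^+ 2 * (sg g * (D ^+ 2 / e ^+ 2 * (tau * 2%:R))))).
  apply: ler_wpM2l; first exact: (Dc calign_gt0).
  by apply: ler_wpM2l; rewrite ?sg_ge0.
rewrite mulrCA [X in _ <= X]mulrC; apply: ler_wpM2l; first exact: sg_ge0.
have -> : D ^+ 2 / calign ^+ 2 * (D ^+ 2 / e ^+ 2 * (tau * 2%:R)) =
   8%:R * D ^+ 6 * tau / e ^+ 6.
  rewrite /calign; field.
  by rewrite !lt0r_neq0.
rewrite ler_pdivrMr ?exprn_gt0// ler_pdivlMl//; apply: le_trans tau2.
by rewrite le_eqVlt; apply/orP; left; apply/eqP; ring.
Qed.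
End Gap.

Section GapMoments.
Variables (R : realType) (K : fieldType) (a : K -> R) (d : nat).
Hypothesis lf : local_field a.
Let aP := local_field_nneg lf.

Lemma measurable_gapratio (dX : measure_display) (X : measurableType dX) p q q'
    (G : X -> 'M[K]_(p, q)) (H : X -> 'M[K]_(p, q')) :
  mkmeas a G -> mkmeas a H -> measurable_fun setT (fun x => gapratio a (G x) (H x)).
Proof.
move=> mG mH; rewrite (_ : (fun x => _) =
  fun x => mx2 a (G x) (H x) * (mn a (G x) * mn a (H x)) `^ (-1)); last first.
  by apply/funext => x; rewrite powR_inv1// mulr_ge0 ?mn_ge0.
apply: measurable_funM; first exact: measurable_mx2.
apply: (measurableT_comp (measurable_powR (-1))).
by apply: measurable_funM; exact: measurable_mn.
Qed.

Lemma measurable_powRs (dX : measure_display) (X : measurableType dX) (f : X -> R) (s : R) :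
  measurable_fun setT f -> measurable_fun setT (fun x => f x `^ s).
Proof. by move=> mf; exact: (measurableT_comp (measurable_powR s) mf). Qed.

Lemma le_powR (s x y : R) : 0 <= s -> 0 <= x -> x <= y -> x `^ s <= y `^ s.
Proof.
by move=> s0 x0 xy; apply: ge0_ler_powR => //; rewrite nnegrE// (le_trans x0).
Qed.

Lemma prodn_cut M r J k m (z : SeqE a d) : (k < J)%N ->
  prodn (r + J * M + m) z = prodn (r + k * M) z *m (prodn M (Defs.shift (r + k * M) z) *m
    (prodn ((J - k.+1) * M) (Defs.shift (r + k.+1 * M) z) *m
     prodn m (Defs.shift (r + J * M) z))).
Proof.
move=> kJ.
have -> : (r + J * M + m = (r + k * M) + (M + ((J - k.+1) * M + m)))%N.
  have -> : (J * M = k.+1 * M + (J - k.+1) * M)%N by rewrite -mulnDl subnKC.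
  by rewrite mulSn; lia.
rewrite !prodnD !shiftD; congr (_ *m (_ *m (prodn _ (Defs.shift _ z) *m prodn _ (Defs.shift _ z)))).
  by rewrite mulSn; lia.
have -> : (J * M = k.+1 * M + (J - k.+1) * M)%N by rewrite -mulnDl subnKC.
by rewrite mulSn; lia.
Qed.

Lemma prodn_tail M r J k m (z : SeqE a d) : (k < J)%N ->
  prodn ((J - k) * M + m) (Defs.shift (r + k * M) z) = prodn M (Defs.shift (r + k * M) z) *m
    (prodn ((J - k.+1) * M) (Defs.shift (r + k.+1 * M) z) *m
     prodn m (Defs.shift (r + J * M) z)).
Proof.
move=> kJ.
have -> : ((J - k) * M + m = M + ((J - k.+1) * M + m))%N.
  by rewrite -(subnSK kJ) mulSn addnA.
rewrite !prodnD !shiftD; congr (_ *m (prodn _ (Defs.shift _ z) *m prodn _ (Defs.shift _ z))).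
  by rewrite mulSn; lia.
have -> : (J * M = k.+1 * M + (J - k.+1) * M)%N by rewrite -mulnDl subnKC.
by rewrite mulSn; lia.
Qed.

Variable mu : probability (SeqE a d) R.
Hypothesis mu_splice : forall k (F : SeqE a d -> \bar R), measurable_fun setT F ->
  (forall x, 0 <= F x)%E ->
  (\int[mu]_x F x = \int[mu]_x \int[mu]_y F (splice k x y))%E.
Variables (M : nat) (T : 'M[K]_d -> R) (e theta tau : R).
Hypothesis sch : schottky mu M T e theta tau.
Hypothesis d0 : (0 < d)%N.
Notation D := (d%:R : R).
Hypotheses (tau0 : 0 <= tau).
Hypothesis tau1 : 2%:R * D ^+ 3 * (e + D) * tau <= e ^+ 3.
Hypothesis tau2 : 16%:R * D ^+ 6 * tau <= e ^+ 6.

Let M0 : (0 < M)%N. Proof. by case: sch. Qed.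
Let e0 : 0 < e. Proof. by case: sch. Qed.
Let theta0 : 0 < theta. Proof. by case: sch => _ _ /andP[]. Qed.
Let theta1 : theta < 1. Proof. by case: sch => _ _ /andP[]. Qed.
Let Ttau : forall B, 0 < T B -> mx2 a B B <= tau * mn a B ^+ 2.
Proof. by case: sch => _ _ _ []. Qed.
Let ps : forall k, measurable_fun setT (fun x : SeqE a d => Defs.shift k x : SeqE a d) :=
  fun k => @measurable_shift R K a d k.
Let mp n k : mkmeas a (fun x : SeqE a d => prodn n (Defs.shift k x)) := mkmeas_prodn lf n (ps k).
Let mp0 n : mkmeas a (fun x : SeqE a d => prodn n x) :=
  mkmeas_prodn lf n (@measurable_id _ (SeqE a d) setT).
Let bd := @bad R K a d M T e.
Let kc : R := D ^+ 2 / calign d e ^+ 2.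

Let kc0 : 0 <= kc.
Proof. by rewrite divr_ge0 ?exprn_ge0// ltW// calign_gt0. Qed.

Definition gapmom (s : R) (n : nat) : R := fine (Ex mu (fun x => sg a (prodn n x) `^ s)).

Lemma measurable_sgs n s : measurable_fun setT (fun x : SeqE a d => sg a (prodn n x) `^ s).
Proof. by apply: measurable_powRs; exact: measurable_gapratio. Qed.

Lemma sgs_bound s (h : 'M[K]_d) : 0 <= s -> 0 <= sg a h `^ s <= 2%:R `^ s.
Proof. by move=> s0; rewrite powR_ge0 le_powR ?sg_ge0 ?sg_le2. Qed.

Lemma gapmomE s n : 0 <= s -> Ex mu (fun x => sg a (prodn n x) `^ s) = (gapmom s n)%:E.
Proof.
move=> s0; rewrite /gapmom fineK// ge0_fin_numE; last first.
  by apply: Ex_ge0 => x; exact: powR_ge0.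
apply: (@le_lt_trans _ _ (2%:R `^ s)%:E); last exact: ltry.
by apply: Ex_le_cst => [|x]; [exact: measurable_sgs|exact: sgs_bound].
Qed.

Lemma gapmom_ge0 s n : 0 <= gapmom s n.
Proof. by apply: fine_ge0; apply: Ex_ge0 => x; exact: powR_ge0. Qed.

Lemma gapmom_le s n : 0 <= s -> gapmom s n <= 2%:R `^ s.
Proof.
move=> s0; rewrite -lee_fin -gapmomE//.
by apply: Ex_le_cst => [|x]; [exact: measurable_sgs|exact: sgs_bound].
Qed.

Lemma Ex_bad_shift j g (H1 H2 : SeqE a d -> 'M[K]_d) : mkmeas a H1 -> mkmeas a H2 ->
  (Ex mu (fun y => (bd j (g *m prodn M y) (H1 (Defs.shift (j.+1 * M) y))
     (H2 (Defs.shift (j.+1 * M) y)) (Defs.shift M y))%:R) <= (theta ^+ j)%:E)%E.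
Proof.
move=> mH1 mH2; rewrite -(Ex_cst mu); apply: (Ex_splice_le mu_splice (k := M)) => //.
  apply/measurable_natr/(measurable_bad lf sch) => //.
  - by apply: mkmeasM => //; exact: mkmeas_cst.
  - by move=> i i'; apply: (kmeas_comp (mH1 i i')); exact: ps.
  - by move=> i i'; apply: (kmeas_comp (mH2 i i')); exact: ps.
move=> x; rewrite (_ : (fun y => _) = fun y => (bd j (g *m prodn M x) (H1 (Defs.shift (j * M) y))
     (H2 (Defs.shift (j * M) y)) y)%:R); first exact: (Ex_bad_tail lf mu_splice sch).
by apply/funext => y; rewrite prodn_splice// mulSn shift_splice_add shift_splice.
Qed.

(** The factor of the suffix is the constant [2^-s] of [good_contract], which large [s] makes as
    small as desired. This version gives a positive rate but not the right one. *)
Lemma gapmom_rec_contract s n : 0 <= s ->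
  gapmom s n <= 2%:R `^ s * theta ^+ (n %/ M) +
    \sum_(k < n %/ M) 2%:R^-1 `^ s * theta ^+ (n %/ M - k.+1) * gapmom s (n %% M + k * M).
Proof.
move=> s0; rewrite -lee_fin -gapmomE//.
set J := (n %/ M)%N; set r := (n %% M)%N.
have nE : n = (r + J * M + 0)%N by rewrite addn0 addnC -divn_eq.
apply: (window_rec lf mu_splice sch (r := r) (J := J) (H1 := fun=> 1%:M) (H2 := fun=> 1%:M)
   (W := fun x => sg a (prodn n x) `^ s) (V := fun g => sg a g `^ s)
   (U := fun _ _ => 2%:R^-1 `^ s) (w0 := 2%:R `^ s)
   (c := fun k => 2%:R^-1 `^ s * theta ^+ (J - k.+1)) (v := fun k => gapmom s (r + k * M))).
- exact: mkmeas_cst.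
- exact: mkmeas_cst.
- exact: measurable_sgs.
- by move=> z; exact: sgs_bound.
- by move=> k; exact: measurable_sgs.
- by move=> g; exact: powR_ge0.
- by move=> k; exact: measurable_cst.
- by move=> k z; exact: powR_ge0.
- move=> k z kJ G; rewrite nE (prodn_cut M r 0 z kJ) prodn0 mulrC -powRM ?invr_ge0 ?sg_ge0//.
  apply: le_powR => //; first exact: sg_ge0.
  exact: (good_contract aP d0 tau0 e0 Ttau tau1 tau2 G).
- by move=> k; rewrite mulr_ge0 ?powR_ge0 ?exprn_ge0// ltW.
- move=> k g kJ; rewrite ExZ ?powR_ge0//; last first.
    apply/measurable_natr/(measurable_bad lf sch) => //; try exact: mkmeas_cst.
    by apply: mkmeasM => //; exact: mkmeas_cst.
  rewrite EFinM; apply: lee_wpmul2l; first by rewrite lee_fin powR_ge0.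
  by apply: (Ex_bad_shift _ g (H1 := fun=> 1%:M) (H2 := fun=> 1%:M)); exact: mkmeas_cst.
- by move=> k kJ; rewrite gapmomE.
Qed.

(** Here the gap of the suffix is kept. The last [N] letters are reserved as the right-hand matrix,
    so every suffix has length at least [N], where the gap in probability is available. The suffix
    is estimated either by its own moment or by the probability that its later blocks are bad,
    whence the minimum. *)
Lemma gapmom_rec s N n : 0 <= s -> (N <= n)%N ->
  gapmom s n <= 2%:R `^ s * theta ^+ ((n - N) %/ M) +
    \sum_(k < (n - N) %/ M) kc `^ s *
       Num.min (2%:R `^ s * theta ^+ ((n - N) %/ M - k.+1)) (gapmom s (((n - N) %/ M - k) * M + N)) *
       gapmom s ((n - N) %% M + k * M).
Proof.
move=> s0 Nn; rewrite -lee_fin -gapmomE//.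
set J := ((n - N) %/ M)%N; set r := ((n - N) %% M)%N.
have nE : n = (r + J * M + N)%N by rewrite addnC [(r + _)%N]addnC -divn_eq subnKC.
apply: (window_rec lf mu_splice sch (r := r) (J := J) (H1 := fun x => prodn N x) (H2 := fun x => prodn N x)
   (W := fun x => sg a (prodn n x) `^ s) (V := fun g => sg a g `^ s)
   (U := fun k y => kc `^ s * sg a (prodn ((J - k) * M + N) y) `^ s) (w0 := 2%:R `^ s)
   (c := fun k => kc `^ s * Num.min (2%:R `^ s * theta ^+ (J - k.+1)) (gapmom s ((J - k) * M + N)))
   (v := fun k => gapmom s (r + k * M))).
- exact: mp0.
- exact: mp0.
- exact: measurable_sgs.
- by move=> z; exact: sgs_bound.
- by move=> k; exact: measurable_sgs.
- by move=> g; exact: powR_ge0.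
- by move=> k; apply: measurable_funM => //; exact: measurable_sgs.
- by move=> k z; rewrite mulr_ge0 ?powR_ge0.
- move=> k z kJ G; rewrite {1}nE (prodn_cut M r N z kJ) mulrCA -powRM ?sg_ge0//.
  rewrite -(powRM _ kc0 (mulr_ge0 (sg_ge0 aP _) (sg_ge0 aP _))); apply: le_powR => //; first exact: sg_ge0.
  rewrite (prodn_tail M r N z kJ); apply: sg_mul => //; first exact: calign_gt0.
  exact: (good_align aP d0 e0 Ttau tau1 G).
- move=> k; rewrite mulr_ge0 ?powR_ge0// le_min gapmom_ge0 andbT.
  by rewrite mulr_ge0 ?powR_ge0 ?exprn_ge0// ltW.
- move=> k g kJ.
  have mb : measurable_fun setT (fun y : SeqE a d => (bd (J - k.+1) (g *m prodn M y)
       (prodn N (Defs.shift ((J - k) * M) y)) (prodn N (Defs.shift ((J - k) * M) y))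
       (Defs.shift M y))%:R : R).
    apply/measurable_natr/(measurable_bad lf sch) => //.
    by apply: mkmeasM => //; exact: mkmeas_cst.
  rewrite (_ : (fun y => _) = fun y => kc `^ s * (sg a (prodn ((J - k) * M + N) y) `^ s *
     (bd (J - k.+1) (g *m prodn M y)
       (prodn N (Defs.shift ((J - k) * M) y)) (prodn N (Defs.shift ((J - k) * M) y))
       (Defs.shift M y))%:R)); last by apply/funext => y; rewrite mulrA.
  have ms := measurable_sgs ((J - k) * M + N) s.
  rewrite ExZ ?powR_ge0//; last 2 first.
  - exact: measurable_funM.
  - by move=> y; rewrite mulr_ge0 ?powR_ge0.
  rewrite EFinM; apply: lee_wpmul2l; first by rewrite lee_fin powR_ge0.
  rewrite EFin_min le_min; apply/andP; split; last first.
    rewrite -gapmomE//; apply: Ex_le => //; first exact: measurable_funM.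
      by move=> y; rewrite mulr_ge0 ?powR_ge0.
    move=> y; rewrite -[X in _ <= X]mulr1; apply: ler_wpM2l; rewrite ?powR_ge0//.
    by case: (bd _ _ _ _ _).
  apply: (@le_trans _ _ (Ex mu (fun y => 2%:R `^ s * (bd (J - k.+1) (g *m prodn M y)
       (prodn N (Defs.shift ((J - k) * M) y)) (prodn N (Defs.shift ((J - k) * M) y))
       (Defs.shift M y))%:R))).
    apply: Ex_le => //; [exact: measurable_funM|exact: measurable_funM| |].
      by move=> y; rewrite mulr_ge0 ?powR_ge0.
    by move=> y; apply: ler_wpM2r => //; case/andP: (sgs_bound (prodn ((J - k) * M + N) y) s0).
  rewrite ExZ ?powR_ge0// EFinM; apply: lee_wpmul2l; first by rewrite lee_fin powR_ge0.
  rewrite -(subnSK kJ).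
  exact: (Ex_bad_shift _ g (H1 := fun x => prodn N x) (H2 := fun x => prodn N x)).
- by move=> k kJ; rewrite gapmomE.
Qed.

End GapMoments.

(** * Elementary estimates and the choice of parameters *)

Section RealEstimates.
Variable R : realType.

Lemma geometric_tail (x : R) L J : x < 1 ->
  (1 - x) * (\sum_(i < J) (L <= i)%N%:R * x ^+ (i - L)) = 1 - x ^+ (J - L).
Proof.
move=> x1; elim: J => [|J IH]; first by rewrite big_ord0 mulr0 sub0n expr0 subrr.
rewrite big_ord_recr /= mulrDr IH; case: (leqP L J) => h.
  by rewrite mul1r subSn// exprS; ring.
have -> : (J - L = 0)%N by apply/eqP; rewrite subn_eq0 ltnW.
have -> : (J.+1 - L = 0)%N by apply/eqP; rewrite subn_eq0.
by rewrite mul0r mulr0 addr0.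
Qed.

Lemma geometric_tail_le (x : R) L J : 0 <= x < 1 ->
  \sum_(i < J) (L <= i)%N%:R * x ^+ (i - L) <= (1 - x)^-1.
Proof.
move=> /andP[x0 x1]; have h : 0 < 1 - x by rewrite subr_gt0.
rewrite -(ler_pM2l h) geometric_tail// divff ?gt_eqF// lerBlDr lerDl exprn_ge0//.
Qed.

Lemma geometric_le (x : R) J : 0 <= x < 1 -> \sum_(i < J) x ^+ (J - i.+1) <= (1 - x)^-1.
Proof.
move=> h; apply: le_trans (geometric_tail_le 0 J h).
rewrite (reindex_inj rev_ord_inj) /=; apply: ler_sum => i _.
by rewrite mul1r subn0 (_ : (J - (J - i.+1).+1 = i)%N)//; have := ltn_ord i; lia.
Qed.

Lemma sum_ltn_le J L : \sum_(i < J) (i < L)%N%:R <= L%:R :> R.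
Proof.
rewrite -natr_sum ler_nat.
suff -> : (\sum_(i < J) (i < L) = minn J L)%N by exact: geq_minr.
elim: J => [|J IH]; first by rewrite big_ord0 min0n.
rewrite big_ord_recr /= IH; case: ltnP => h /=; lia.
Qed.

Lemma sqrt_lt1 (th : R) : 0 < th < 1 -> 0 < Num.sqrt th < 1 /\ Num.sqrt th ^+ 2 = th.
Proof.
move=> /andP[h0 h1]; rewrite sqrtr_gt0 h0 sqr_sqrtr ?ltW//; split=> //=.
by rewrite -[ltRHS]sqrtr1 ltr_sqrt.
Qed.

Lemma expR_ge_sqr (u : R) : 0 <= u -> (u / 2%:R) ^+ 2 <= expR u.
Proof.
move=> u0; rewrite {2}(_ : u = 2%:R * (u / 2%:R)); last by field.
rewrite expRM_natl; rewrite lerXn2r ?nnegrE ?expR_ge0 ?divr_ge0//.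
by apply: le_trans (expR_ge1Dx _); rewrite lerDr.
Qed.

Lemma eventually_small (x c c' : R) : 0 <= x -> 0 < c' ->
  exists N0 : nat, forall N, (N0 <= N)%N -> x / N%:R * c <= c'.
Proof.
move=> x0 c0; have [N1 h1] := nat_unbounded (x * c) c0.
exists N1.+1 => N hN; have N0 : 0 < N%:R :> R by rewrite ltr0n (leq_trans _ hN).
rewrite mulrAC ler_pdivrMr//; apply: le_trans (ltW h1) _.
by rewrite mulrC ler_pM2l// ler_nat ltnW.
Qed.

(** The inequality states that the sum over the cuts in [gapmom_rec] has total weight at most one
    half. The order of choices matters: [x] is large; [L] is proportional to [x], so that
    [eta ^+ L.-1] is at most [expR (- ((al + 1) * x))]; then [dl] is small; and [N0] comes last, so
    that the exponent [x / N] neutralises [kc] and the length [M] of a block. *)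
Lemma tune (al al' th kc : R) (M : nat) : 0 < al < al' -> 0 < th < 1 -> 0 <= kc ->
  exists (L N0 : nat) (x dl : R), [/\ 0 < x, (0 < L)%N, 0 < dl,
    2%:R * (L%:R * (expR (- (x * (al' - al))) + 2%:R * dl * expR (2%:R * (x * al)))
       + 2%:R * expR (x * al) * (Num.sqrt th ^+ L.-1 / (1 - Num.sqrt th))) <= 2%:R^-1 &
    forall N, (N0 <= N)%N -> let s := x / N%:R in
      [/\ (0 < N)%N, (L * M <= N)%N, s <= 1, kc `^ s <= 2%:R &
          expR (s * al * M%:R) * Num.sqrt th <= 1]].
Proof.
move=> /andP[al0 al1] th01 kc0; have [/andP[e0 e1] e2] := sqrt_lt1 th01.
set eta := Num.sqrt th in e0 e1 e2 *.
pose Dl := al' - al; have Dl0 : 0 < Dl by rewrite subr_gt0.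
have lne : 0 < - ln eta by rewrite oppr_gt0 ln_lt0// e0 e1.
have [A0 hA0] := nat_unbounded (al + 1) lne.
have e1' : 0 < 1 - eta by rewrite subr_gt0.
(* Each of the three terms is to be at most 1/12: [x1] serves the geometric tail, [x2] the term in
   [al' - al], and [dl] is adjusted to the middle one. *)
have [x1 hx1] := nat_unbounded 24%:R e1'.
have [x2 hx2] := nat_unbounded (48%:R * A0.+1%:R) (exprn_gt0 2 Dl0).
pose xn := (maxn x1 x2).+1; pose x : R := xn%:R.
have x0 : 0 < x by rewrite ltr0n.
have x1le : x1%:R <= x by rewrite ler_nat leqW// leq_maxl.
have x2le : x2%:R <= x by rewrite ler_nat leqW// leq_maxr.
pose L := (A0 * xn).+1.
pose dl := (24%:R * L%:R * expR (2%:R * (x * al)))^-1.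
have L0 : 0 < L%:R :> R by rewrite ltr0n.
have dl0 : 0 < dl by rewrite invr_gt0 !mulr_gt0 ?expR_gt0.
have part3 : expR (x * al) * eta ^+ L.-1 <= x^-1.
  have -> : eta ^+ L.-1 = expR (x * (A0%:R * ln eta)).
    by rewrite /L /= exprM /x !expRM_natl lnK// posrE.
  rewrite -expRD -mulrDr.
  apply: (@le_trans _ _ (expR (- x))).
    rewrite ler_expR -[X in _ <= X]mulrN1 ler_pM2l//; lra.
  rewrite expRN lef_pV2 ?posrE ?expR_gt0//.
  by apply: le_trans (expR_ge1Dx x); rewrite lerDr.
have part1 : L%:R * expR (- (x * Dl)) <= 12%:R^-1.
  rewrite expRN ler_pdivrMr ?expR_gt0//.
  have h : (x * Dl / 2%:R) ^+ 2 <= expR (x * Dl) by rewrite expR_ge_sqr// mulr_ge0// ltW.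
  have hL : L%:R <= A0.+1%:R * x :> R.
    by rewrite -natrM ler_nat /L mulSn -add1n leq_add2r.
  apply: (@le_trans _ _ (12%:R^-1 * (x * Dl / 2%:R) ^+ 2)); last first.
    by rewrite ler_pM2l// invr_gt0.
  apply: le_trans hL _.
  have : 48%:R * A0.+1%:R <= x * Dl ^+ 2.
    by apply: le_trans (ltW hx2) _; rewrite ler_pM2r// exprn_gt0.
  rewrite -(ler_pM2r x0) => h'.
  have -> : 12%:R^-1 * (x * Dl / 2%:R) ^+ 2 = 48%:R^-1 * (x * Dl ^+ 2 * x) by field.
  rewrite ler_pdivlMl//; lra.
have part2 : L%:R * (2%:R * dl * expR (2%:R * (x * al))) = 12%:R^-1.
  rewrite /dl; field; rewrite !gt_eqF ?expR_gt0 //.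
have part3' : 2%:R * expR (x * al) * (eta ^+ L.-1 / (1 - eta)) <= 12%:R^-1.
  have -> : 2%:R * expR (x * al) * (eta ^+ L.-1 / (1 - eta)) =
     2%:R / (1 - eta) * (expR (x * al) * eta ^+ L.-1) by field; rewrite gt_eqF.
  apply: le_trans (ler_wpM2l _ part3) _; first by rewrite divr_ge0 ?ltW.
  have h : 24%:R <= x * (1 - eta).
    by apply: le_trans (ltW hx1) _; rewrite ler_pM2r.
  have -> : 2%:R / (1 - eta) / x = 2%:R / (x * (1 - eta)).
    by field; rewrite !gt_eqF.
  by rewrite ler_pdivrMr ?mulr_gt0//; lra.
have [N1 hN1] := eventually_small 1 (ltW x0) ltr01.
have ln2 : 0 < ln 2%:R :> R by rewrite ln_gt0// ltr1n.
have [N2 hN2] := eventually_small (ln (Num.max kc 1)) (ltW x0) ln2.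
have [N3 hN3] := eventually_small (al * M%:R) (ltW x0) lne.
exists L, (maxn (maxn 1 (L * M)) (maxn N1 (maxn N2 N3))), x, dl; split=> //.
  rewrite mulrDr; lra.
move=> N; rewrite !geq_max => /andP[/andP[h1 h2] /andP[h3 /andP[h4 h5]]].
split=> //.
- by have := hN1 _ h3; rewrite mulr1.
- have mx1 : 0 < Num.max kc 1 by rewrite lt_max ltr01 orbT.
  apply: (@le_trans _ _ (Num.max kc 1 `^ (x / N%:R))).
    by apply: le_powR => //; rewrite ?divr_ge0 ?(ltW x0)// le_max lexx.
  rewrite /powR gt_eqF// -[X in _ <= X]lnK ?posrE// ler_expR; exact: hN2.
- have h := hN3 _ h5; rewrite mulrA in h.
  apply: (@le_trans _ _ (expR (- ln eta) * eta)).
    by rewrite ler_pM2r// ler_expR.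
  by rewrite expRN lnK ?posrE// mulVf// gt_eqF.
Qed.

End RealEstimates.

(** * Exponential decay of the moments *)

Section Decay.
Variables (R : realType) (K : fieldType) (a : K -> R) (d : nat).
Hypothesis lf : local_field a.
Let aP := local_field_nneg lf.
Variable mu : probability (SeqE a d) R.
Hypothesis mu_splice : forall k (F : SeqE a d -> \bar R), measurable_fun setT F ->
  (forall x, 0 <= F x)%E ->
  (\int[mu]_x F x = \int[mu]_x \int[mu]_y F (splice k x y))%E.
Variables (M : nat) (T : 'M[K]_d -> R) (e theta tau : R).
Hypothesis sch : schottky mu M T e theta tau.
Hypothesis d0 : (0 < d)%N.
Notation D := (d%:R : R).
Hypotheses (tau0 : 0 <= tau).
Hypothesis tau1 : 2%:R * D ^+ 3 * (e + D) * tau <= e ^+ 3.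
Hypothesis tau2 : 16%:R * D ^+ 6 * tau <= e ^+ 6.

Let M0 : (0 < M)%N. Proof. by case: sch. Qed.
Let e0 : 0 < e. Proof. by case: sch. Qed.
Let theta0 : 0 < theta. Proof. by case: sch => _ _ /andP[]. Qed.
Let theta1 : theta < 1. Proof. by case: sch => _ _ /andP[]. Qed.
Let theta01 : 0 < theta < 1. Proof. by rewrite theta0 theta1. Qed.
Let Ttau : forall B, 0 < T B -> mx2 a B B <= tau * mn a B ^+ 2.
Proof. by case: sch => _ _ _ []. Qed.
Let ps : forall k, measurable_fun setT (fun x : SeqE a d => Defs.shift k x : SeqE a d) :=
  fun k => @measurable_shift R K a d k.
Let mp0 n : mkmeas a (fun x : SeqE a d => prodn n x) :=
  mkmeas_prodn lf n (@measurable_id _ (SeqE a d) setT).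
Let bd := @bad R K a d M T e.
Let kc : R := D ^+ 2 / calign d e ^+ 2.
Let kc0 : 0 <= kc.
Proof. by rewrite divr_ge0 ?exprn_ge0// ltW// calign_gt0. Qed.
Notation gm := (gapmom mu).

(** Induction on the number of blocks, with rate [eta], the square root of [theta]. Half of
    [theta ^+ i] pays for the rate and the other half sums to at most [1 / (1 - eta)], which is
    beaten by taking [s] with [2^-s <= eta (1 - eta) / 2]. *)
Lemma gapmom_decay : exists s C t : R,
  [/\ 0 < s, 0 < C, 0 < t & forall n, gm s n <= C * expR (- (t * n%:R))].
Proof.
have [/andP[h0 h1] h2] := sqrt_lt1 theta01; set eta := Num.sqrt theta in h0 h1 h2.
have e1 : 0 < 1 - eta by rewrite subr_gt0.
have [S hS] : exists S : nat, 2%:R^-1 ^+ S.+1 <= eta * (1 - eta) / 2%:R.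
  have [S hS] := nat_unbounded (2%:R / (eta * (1 - eta))) ltr01.
  exists S; rewrite mulr1 in hS.
  have hp : 0 < 2%:R / (eta * (1 - eta)) by rewrite divr_gt0// mulr_gt0.
  rewrite -[_ / 2%:R]invrK invf_div exprVn lef_pV2 ?posrE// ?exprn_gt0//.
  apply: le_trans (ltW hS) _; rewrite -natrX ler_nat.
  by apply: leq_trans (ltnW (ltn_expl S (ltnSn 1))) _; rewrite leq_exp2l.
pose s : R := S.+1%:R.
have s0 : 0 < s by rewrite ltr0n.
pose C := 2%:R * 2%:R `^ s; have C0 : 0 < C by rewrite mulr_gt0// powR_gt0.
have hs : 2%:R^-1 `^ s <= eta * (1 - eta) / 2%:R by rewrite /s powR_mulrn ?invr_ge0.
have main J r : (r < M)%N -> gm s (r + J * M) <= C * eta ^+ J.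
  elim/ltn_ind: J r => J IH r rM.
  have := gapmom_rec_contract lf mu_splice sch d0 tau0 tau1 tau2 (r + J * M) (ltW s0).
  have -> : ((r + J * M) %/ M = J)%N by rewrite addnC divnMDl// divn_small// addn0.
  have -> : ((r + J * M) %% M = r)%N by rewrite addnC modnMDl modn_small.
  move/le_trans; apply.
  case: J IH => [|J] IH.
    rewrite big_ord0 addr0 !expr0 !mulr1 /C; have := powR_ge0 2%:R s; lra.
  have part1 : 2%:R `^ s * theta ^+ J.+1 <= 2%:R `^ s * eta ^+ J.+1.
    apply: ler_wpM2l; first exact: powR_ge0.
    by rewrite -h2 -exprM mulnC exprM expr2 ler_piMr ?exprn_ge0 ?exprn_ile1 ?(ltW h0) ?(ltW h1).
  have part2 : \sum_(k < J.+1) 2%:R^-1 `^ s * theta ^+ (J.+1 - k.+1) * gm s (r + k * M) <=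
      2%:R `^ s * eta ^+ J.+1.
    apply: (@le_trans _ _ (\sum_(k < J.+1) (2%:R^-1 `^ s * C * eta ^+ J) * eta ^+ (J.+1 - k.+1))).
      apply: ler_sum => k _.
      apply: (@le_trans _ _ (2%:R^-1 `^ s * theta ^+ (J.+1 - k.+1) * (C * eta ^+ k))).
        apply: ler_wpM2l; first by rewrite mulr_ge0 ?powR_ge0// exprn_ge0// ltW.
        exact: IH.
      have kJ := ltn_ord k; rewrite ltnS in kJ.
      rewrite -h2 -exprM subSS le_eqVlt; apply/orP; left; apply/eqP.
      have -> : eta ^+ J = eta ^+ (J - k) * eta ^+ k by rewrite -exprD subnK.
      by rewrite mulnC exprM expr2; ring.
    rewrite -mulr_sumr.
    apply: (@le_trans _ _ (2%:R^-1 `^ s * C * eta ^+ J * (1 - eta)^-1)).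
      apply: ler_wpM2l; first by rewrite !mulr_ge0 ?powR_ge0 ?exprn_ge0 ?(ltW h0).
      by apply: geometric_le; rewrite (ltW h0).
    rewrite ler_pdivrMr//.
    apply: (@le_trans _ _ (eta * (1 - eta) / 2%:R * (C * eta ^+ J))).
      rewrite -mulrA; apply: ler_wpM2r => //.
      by rewrite mulr_ge0 ?(ltW C0) ?exprn_ge0 ?(ltW h0).
    rewrite /C exprS le_eqVlt; apply/orP; left; apply/eqP; by field.
  by apply: le_trans (lerD part1 part2) _; rewrite /C; lra.
pose t := - ln eta / M%:R.
have lne : 0 < - ln eta by rewrite oppr_gt0 ln_lt0// h0 h1.
have M0' : 0 < M%:R :> R by rewrite ltr0n.
exists s, (C / eta), t; split=> //.
- by rewrite divr_gt0.
- by rewrite /t divr_gt0.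
move=> n; rewrite {1}(divn_eq n M) addnC; apply: le_trans (main _ _ _) _; first by rewrite ltn_mod.
rewrite -mulrA; apply: ler_wpM2l; first exact: ltW.
rewrite ler_pdivlMl// -exprS -{1}(lnK (x := eta)) ?posrE// -expRM_natl ler_expR.
have : n%:R <= (n %/ M).+1%:R * M%:R :> R by rewrite -natrM ler_nat ltnW// ltn_ceil.
rewrite /t -(ler_pM2l lne) => h.
have -> : - (- ln eta / M%:R * n%:R) = - (- ln eta * n%:R / M%:R) by ring.
by rewrite lerNr -mulrN ler_pdivrMr//; lra.
Qed.

(** The gap ratio is either at most [c], or larger but never above 2. *)
Lemma gapmom_le_prob s (c : R) n : 0 <= s -> 0 <= c ->
  ((gm s n)%:E <= (c `^ s)%:E +
     (2%:R `^ s)%:E * mu [set x | (c < sg a (prodn n x))%R])%E.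
Proof.
move=> s0 c0.
have mA : measurable [set x : SeqE a d | c < sg a (prodn n x)].
  rewrite -[X in measurable X]setTI.
  have mf : measurable_fun setT (fun x : SeqE a d => c < sg a (prodn n x)).
    by apply: measurable_fun_ltr => //; exact: measurable_gapratio.
  exact: (mf measurableT [set true]).
rewrite -(gapmomE lf)// -(Ex_indic mu mA) -(Ex_cst mu (c `^ s)) -ExZ ?powR_ge0// -ExD//; last 2 first.
- exact: measurable_funM.
- by move=> x; exact: powR_ge0.
apply: Ex_le.
- exact: measurable_sgs.
- by apply: measurable_funD => //; exact: measurable_funM.
- by move=> x; exact: powR_ge0.
move=> x; rewrite indicE; case: (boolP (x \in _)) => /= h.
  rewrite mulr1; apply: le_trans (_ : 2%:R `^ s <= _).
    by case/andP: (sgs_bound lf (prodn n x) s0).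
  by rewrite lerDr powR_ge0.
rewrite mulr0 addr0; apply: le_powR => //; first exact: sg_ge0.
by rewrite leNgt; apply/negP => h'; move/negP: h; apply; rewrite inE.
Qed.

(** A gap of rate [al] in probability, with no speed of convergence: this is all that the estimates
    use of [al] being below the Lyapunov gap. *)
Definition gap_at (al : R) : Prop := forall eta : R, 0 < eta ->
  exists N : nat, forall n, (N <= n)%N ->
    (mu [set x | (expR (- (al * n%:R)) < sg a (prodn n x))%R] <= eta%:E)%E.

(** Strong induction through [gapmom_rec]. Let [i] be the number of blocks after the last good one.
    If [i < L], the suffix has length between [N] and [2 N], and its moment is small by the gap in
    probability. If [i >= L], the probability that [i] blocks are bad beats the factor
    [expR (b * M)] per block lost in the induction hypothesis. [tune] bounds the sum of both
    contributions. *)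
Lemma gapmom_decay_rate al al' : 0 < al < al' -> gap_at al' -> exists s C : R,
  [/\ 0 < s, 0 < C, expR (s * al * M%:R) * Num.sqrt theta <= 1 &
      forall n, gm s n <= C * expR (- (s * al * n%:R))].
Proof.
move=> /andP[al0 al1] gap.
have al01 : 0 < al < al' by rewrite al0 al1.
have [L [N0 [x [dl [x0 L0 dl0 hnum hN0]]]]] := tune M al01 theta01 kc0.
have [N1 hN1] := gap _ dl0.
pose N := maxn N0 N1; have [Ngt LM s1 kcs hM] := hN0 N (leq_maxl _ _).
set s := x / N%:R in s1 kcs hM *.
have N0' : 0 < N%:R :> R by rewrite ltr0n.
have s0 : 0 < s by rewrite divr_gt0.
have sN : s * N%:R = x by rewrite divfK// gt_eqF.
have [/andP[h0 h1] h2] := sqrt_lt1 theta01; set eta := Num.sqrt theta in h0 h1 h2 hnum hM *.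
have two_s : 2%:R `^ s <= 2%:R.
  by rewrite -[X in _ <= X]powRr1//; apply: ler_powR => //; rewrite ler1n.
pose b := s * al; have b0 : 0 < b by rewrite mulr_gt0.
clearbody s.
have bN : b * N%:R = x * al by rewrite /b mulrAC sN.
have hM' : theta * expR (b * M%:R) <= eta.
  by rewrite -h2 expr2 -mulrA ler_piMr ?(ltW h0)// mulrC.
have gmN n : (N <= n)%N -> gm s n <= expR (- (s * al' * n%:R)) + 2%:R * dl.
  move=> Nn; rewrite -lee_fin.
  apply: le_trans (gapmom_le_prob n (ltW s0) (expR_ge0 (- (al' * n%:R)))) _.
  rewrite EFinD; apply: leeD.
    by rewrite lee_fin -expRM ler_expR mulNr [_ * s]mulrC mulrA.
  rewrite EFinM; apply: lee_pmul => //.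
  - by apply: hN1; apply: leq_trans Nn; rewrite leq_maxr.
(* The factor 4 leaves room for the all-bad term to be half of the target, and the exponential
   covers the reserved [N] letters and an incomplete block. *)
pose C := 4%:R * expR (b * (N%:R + M%:R)).
have C0 : 0 < C by rewrite mulr_gt0// expR_gt0.
exists s, C; split=> //.
elim/ltn_ind => n IH; rewrite -/b.
have [Nn|nN] := leqP N n; last first.
  apply: le_trans (gapmom_le lf mu n (ltW s0)) _; apply: le_trans two_s _.
  rewrite /C -mulrA -expRD.
  apply: (@le_trans _ _ (4%:R * 1)); first lra.
  rewrite ler_pM2l//; apply: le_trans (expR_ge1Dx _); rewrite lerDl -mulrBr mulr_ge0 ?(ltW b0)//.
  by rewrite subr_ge0 -natrD ler_nat (leq_trans (ltnW nN))// leq_addr.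
have := gapmom_rec lf mu_splice sch d0 tau1 (ltW s0) Nn.
set J := ((n - N) %/ M)%N; set r := ((n - N) %% M)%N.
have nE : n = (r + J * M + N)%N by rewrite addnC [(r + _)%N]addnC -divn_eq subnKC.
have rM : (r < M)%N by rewrite ltn_mod.
move/le_trans; apply; clearbody J r.
have part1 : 2%:R `^ s * theta ^+ J <= 2%:R^-1 * (C * expR (- (b * n%:R))).
  rewrite /C -[4%:R * _ * _]mulrA -expRD [2%:R^-1 * _]mulrA.
  have -> : 2%:R^-1 * 4%:R = 2%:R :> R by field.
  apply: ler_pM; rewrite ?powR_ge0 ?exprn_ge0 ?(ltW theta0)//.
  have -> : expR (b * (N%:R + M%:R) + - (b * n%:R)) =
     expR (b * (M%:R - r%:R)) * expR (- (b * M%:R)) ^+ J.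
    rewrite -expRM_natl -expRD; congr expR; rewrite nE !natrD natrM; ring.
  rewrite -[X in X <= _]mul1r; apply: ler_pM; rewrite ?exprn_ge0 ?(ltW theta0)//.
    by apply: le_trans (expR_ge1Dx _); rewrite lerDl mulr_ge0 ?(ltW b0)// subr_ge0 ler_nat ltnW.
  apply: lerXn2r; rewrite ?nnegrE ?expR_ge0 ?(ltW theta0)//.
  by rewrite expRN -div1r ler_pdivlMr ?expR_gt0//; apply: le_trans hM' (ltW h1).
have part2 : \sum_(k < J) kc `^ s * Num.min (2%:R `^ s * theta ^+ (J - k.+1))
     (gm s ((J - k) * M + N)) * gm s (r + k * M) <= 2%:R^-1 * (C * expR (- (b * n%:R))).
  pose Y := expR (- (x * (al' - al))) + 2%:R * dl * expR (2%:R * (x * al)).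
  pose Z := 2%:R * expR (x * al) * eta ^+ L.-1.
  apply: (@le_trans _ _ (\sum_(i < J) (2%:R * (C * expR (- (b * n%:R)))) *
     ((i < L)%N%:R * Y + Z * ((L <= i)%N%:R * eta ^+ (i - L))))).
    (* Reversed summation: from here on [i] counts the blocks after the last good one. *)
    rewrite (reindex_inj rev_ord_inj) /=; apply: ler_sum => i _.
    have iJ := ltn_ord i.
    rewrite subnSK// subKn ?(ltnW iJ)// subKn//.
    set k := (J - i.+1)%N.
    have kE : (r + k * M + (i.+1 * M + N) = n)%N.
      have JE : (J * M = k * M + i.+1 * M)%N by rewrite -mulnDl subnK.
      by rewrite nE JE !addnA.
    have IHk : gm s (r + k * M) <= C * expR (- (b * n%:R)) * expR (b * (i.+1 * M + N)%:R).
      rewrite -mulrA -expRD; apply: le_trans (IH _ _) _.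
        by rewrite -kE -{1}[(r + _)%N]addn0 ltn_add2l ltn_addr// muln_gt0 M0.
      by rewrite -/b -kE natrD le_eqVlt; apply/orP; left; apply/eqP; congr (_ * expR _); ring.
    have min0 : 0 <= Num.min (2%:R `^ s * theta ^+ i) (gm s (i.+1 * M + N)).
      by rewrite le_min gapmom_ge0 mulr_ge0 ?powR_ge0 ?exprn_ge0 ?(ltW theta0).
    apply: (@le_trans _ _ (2%:R * Num.min (2%:R `^ s * theta ^+ i) (gm s (i.+1 * M + N)) *
        (C * expR (- (b * n%:R)) * expR (b * (i.+1 * M + N)%:R)))).
      apply: ler_pM => //; rewrite ?gapmom_ge0 ?mulr_ge0 ?powR_ge0//.
      by apply: ler_wpM2r.
    set W := C * expR (- (b * n%:R)); set E := expR (b * _).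
    have -> : 2%:R * Num.min (2%:R `^ s * theta ^+ i) (gm s (i.+1 * M + N)) * (W * E) =
      2%:R * W * (Num.min (2%:R `^ s * theta ^+ i) (gm s (i.+1 * M + N)) * E) by ring.
    apply: ler_wpM2l; first by rewrite mulr_ge0// mulr_ge0 ?(ltW C0) ?expR_ge0.
    rewrite /E; case: (ltnP i L) => iL.
      rewrite mul0r mulr0 addr0 mul1r.
      apply: (@le_trans _ _ (gm s (i.+1 * M + N) * expR (b * (i.+1 * M + N)%:R))).
        by apply: ler_wpM2r; rewrite ?expR_ge0// ge_min lexx orbT.
      apply: le_trans (ler_wpM2r (expR_ge0 _) (gmN _ (leq_addl _ _))) _.
      rewrite mulrDl /Y; apply: lerD.
        rewrite -expRD ler_expR /b -sN.
        have : N%:R <= (i.+1 * M + N)%:R :> R by rewrite ler_nat leq_addl.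
        have : 0 < s * (al' - al) by rewrite mulr_gt0// subr_gt0.
        move=> hp; rewrite -(ler_pM2l hp); lra.
      apply: ler_wpM2l; first by rewrite mulr_ge0// ltW.
      rewrite ler_expR -bN mulrCA ler_pM2l// -natrM ler_nat.
      have : (i.+1 * M <= L * M)%N by rewrite leq_mul2r iL orbT.
      by move/leq_trans => /(_ _ LM) h; rewrite mul2n -addnn leq_add2r.
    rewrite mul0r add0r mul1r /Z.
    apply: (@le_trans _ _ (2%:R * theta ^+ i * expR (b * (i.+1 * M + N)%:R))).
      apply: ler_wpM2r; first exact: expR_ge0.
      rewrite ge_min; apply/orP; left.
      by apply: ler_wpM2r; rewrite ?exprn_ge0 ?(ltW theta0).
    have -> : expR (b * (i.+1 * M + N)%:R) = expR (b * M%:R) ^+ i.+1 * expR (x * al).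
      by rewrite natrD mulrDr bN expRD natrM [b * _]mulrCA expRM_natl.
    have -> : 2%:R * expR (x * al) * eta ^+ L.-1 * eta ^+ (i - L) =
       2%:R * expR (x * al) * eta ^+ (L.-1 + (i - L)) by rewrite exprD mulrA.
    have -> : 2%:R * theta ^+ i * (expR (b * M%:R) ^+ i.+1 * expR (x * al)) =
       2%:R * expR (x * al) * (theta ^+ i * expR (b * M%:R) ^+ i.+1) by ring.
    apply: ler_wpM2l; first by rewrite mulr_ge0 ?expR_ge0.
    have -> : (L.-1 + (i - L) = i.-1)%N.
      by rewrite -{2}(subnKC iL) -{3}(prednK L0) addSn.
    (* Multiplied by [theta], the claim becomes a comparison of [(theta * expR (b * M%:R)) ^+ i.+1]
       with [eta ^+ i.+1]. *)
    rewrite -(ler_pM2l theta0) mulrA -exprS -exprMn.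
    have -> : theta * eta ^+ i.-1 = eta ^+ i.+1.
      by rewrite -h2 -exprD add2n prednK// (leq_trans L0).
    apply: lerXn2r; rewrite ?nnegrE ?mulr_ge0 ?expR_ge0 ?(ltW theta0) ?(ltW h0)//.
  rewrite -mulr_sumr big_split /= -mulr_suml -mulr_sumr.
  set W := C * _; have W0 : 0 <= W by rewrite mulr_ge0 ?(ltW C0) ?expR_ge0.
  have Y0 : 0 <= Y by rewrite addr_ge0 ?expR_ge0// mulr_ge0 ?expR_ge0// mulr_ge0// ltW.
  have Z0 : 0 <= Z by rewrite !mulr_ge0 ?expR_ge0 ?exprn_ge0 ?(ltW h0).
  have s1' := ler_wpM2r Y0 (sum_ltn_le R J L).
  have s2' : Z * \sum_(i < J) (L <= i)%N%:R * eta ^+ (i - L) <= Z * (1 - eta)^-1.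
    by apply: ler_wpM2l => //; apply: geometric_tail_le; rewrite (ltW h0).
  rewrite [2%:R * W]mulrC -mulrA [X in _ <= X]mulrC; apply: ler_wpM2l => //.
  apply: le_trans hnum; rewrite ler_pM2l//; apply: lerD => //.
  apply: le_trans s2' _; rewrite /Z le_eqVlt; apply/orP; left; apply/eqP; ring.
by rewrite [X in _ <= X](_ : _ = 2%:R^-1 * (C * expR (- (b * n%:R))) +
     2%:R^-1 * (C * expR (- (b * n%:R)))); [exact: lerD|field].
Qed.

(** The cut uses [1%:M] and [H] as right-hand matrices, so the good block is aligned with both
    continuations and the angle is bounded by the gap of the prefix alone. The length of the suffix
    is paid by the probability of its bad blocks, which wins by the hypothesis on
    [expR (s * al * M%:R)]. *)
Lemma ratio_decay s al C : 0 < s -> 0 < al -> 0 < C ->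
  expR (s * al * M%:R) * Num.sqrt theta <= 1 ->
  (forall n, gm s n <= C * expR (- (s * al * n%:R))) ->
  exists2 C' : R, 0 < C' & forall (H : SeqE a d -> 'M[K]_d) n, mkmeas a H ->
    (Ex mu (fun x => (gapratio a (prodn n x) (prodn n x *m H (Defs.shift n x)) `^ s)%R)
      <= (C' * expR (- (s * al * n%:R)))%:E)%E.
Proof.
move=> s0 al0 C0 hM hg.
have [/andP[h0 h1] h2] := sqrt_lt1 theta01; set eta := Num.sqrt theta in h0 h1 h2 hM.
have e1 : 0 < 1 - eta by rewrite subr_gt0.
pose b := s * al; have b0 : 0 < b by rewrite mulr_gt0.
have hM' : theta * expR (b * M%:R) <= eta.
  by rewrite -h2 expr2 -mulrA ler_piMr ?(ltW h0)// mulrC.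
exists (2%:R `^ s * expR (b * M%:R) + kc `^ s * C / theta / (1 - eta)).
  by rewrite ltr_wpDr ?mulr_gt0 ?powR_gt0 ?expR_gt0// !divr_ge0 ?mulr_ge0 ?powR_ge0 ?ltW.
move=> H n mH; rewrite -/b.
have rM : (n %% M < M)%N by rewrite ltn_mod.
have nE : n = (n %% M + n %/ M * M + 0)%N by rewrite addn0 addnC -divn_eq.
set J := (n %/ M)%N in nE; set r := (n %% M)%N in nE rM; clearbody J r.
have mHs : mkmeas a (fun x : SeqE a d => H (Defs.shift n x)).
  by move=> i j; apply: (kmeas_comp (mH i j)); exact: ps.
apply: le_trans (window_rec lf mu_splice sch (r := r) (J := J) (H1 := fun=> 1%:M) (H2 := H)
   (W := fun x => gapratio a (prodn n x) (prodn n x *m H (Defs.shift n x)) `^ s)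
   (V := fun g => sg a g `^ s) (U := fun _ _ => kc `^ s) (w0 := 2%:R `^ s)
   (c := fun k => kc `^ s * theta ^+ (J - k.+1))
   (v := fun k => C * expR (- (b * (r + k * M)%:R)))
   _ mH _ _ _ _ _ _ _ _ _ _) _.
- exact: mkmeas_cst.
- by apply: measurable_powRs; apply: measurable_gapratio => //; exact: mkmeasM.
- move=> z; rewrite powR_ge0 /=.
  apply: le_powR; rewrite ?(ltW s0)//; [exact: gapratio_ge0|exact: gapratio_le2].
- by move=> k; exact: measurable_sgs.
- by move=> g; exact: powR_ge0.
- by move=> k; exact: measurable_cst.
- by move=> k z; exact: powR_ge0.
- move=> k z kJ G; rewrite mulrC -(powRM _ kc0 (sg_ge0 aP _)).
  apply: le_powR; [exact: ltW|exact: gapratio_ge0|].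
  have nE' : n = (r + J * M)%N by rewrite nE addn0.
  have PE : prodn n z = prodn (r + k * M) z *m (prodn M (Defs.shift (r + k * M) z) *m
     (prodn ((J - k.+1) * M) (Defs.shift (r + k.+1 * M) z) *m 1%:M)).
    by rewrite nE (prodn_cut M r 0 z kJ) prodn0.
  have PE2 : prodn n z *m H (Defs.shift n z) = prodn (r + k * M) z *m
    (prodn M (Defs.shift (r + k * M) z) *m (prodn ((J - k.+1) * M) (Defs.shift (r + k.+1 * M) z)
      *m H (Defs.shift (r + J * M) z))) by rewrite PE mulmx1 -nE' -!mulmxA.
  rewrite PE2 PE; apply: gapratio_mul => //; first exact: calign_gt0.
    exact: (good_align aP d0 e0 Ttau tau1 G).
  exact: (good_align aP d0 e0 Ttau tau1 (good_sym G)).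
- by move=> k; rewrite mulr_ge0 ?powR_ge0 ?exprn_ge0// ltW.
- move=> k g kJ; rewrite ExZ ?powR_ge0//; last first.
    apply/measurable_natr/(measurable_bad lf sch) => //; try exact: mkmeas_cst.
      by apply: mkmeasM => //; exact: mkmeas_cst.
    by move=> i j; apply: (kmeas_comp (mH i j)); exact: ps.
  rewrite EFinM; apply: lee_wpmul2l; first by rewrite lee_fin powR_ge0.
  rewrite -(subnSK kJ).
  by apply: (Ex_bad_shift lf mu_splice sch _ g (H1 := fun=> 1%:M)) => //; exact: mkmeas_cst.
- by move=> k kJ; rewrite (gapmomE lf) ?(ltW s0)// lee_fin; exact: hg.
rewrite lee_fin mulrDl; apply: lerD.
  rewrite -mulrA; apply: ler_wpM2l; first exact: powR_ge0.
  have -> : expR (b * M%:R) * expR (- (b * n%:R)) =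
     expR (b * (M%:R - r%:R)) * expR (- (b * M%:R)) ^+ J.
    by rewrite -expRM_natl -!expRD; congr expR; rewrite nE !natrD natrM; ring.
  rewrite -[X in X <= _]mul1r; apply: ler_pM; rewrite ?exprn_ge0 ?(ltW theta0)//.
    by apply: le_trans (expR_ge1Dx _); rewrite lerDl mulr_ge0 ?(ltW b0)// subr_ge0 ler_nat ltnW.
  apply: lerXn2r; rewrite ?nnegrE ?expR_ge0 ?(ltW theta0)//.
  by rewrite expRN -div1r ler_pdivlMr ?expR_gt0//; apply: le_trans hM' (ltW h1).
apply: (@le_trans _ _ (\sum_(k < J) (kc `^ s * C * expR (- (b * n%:R)) / theta) * eta ^+ (J - k.+1))).
  apply: ler_sum => k _.
  have kJ := ltn_ord k.
  have EE : expR (- (b * (r + k * M)%:R)) = expR (- (b * n%:R)) * expR (b * M%:R) ^+ (J - k).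
    have JE : (J * M = k * M + (J - k) * M)%N by rewrite -mulnDl subnKC// ltnW.
    by rewrite -expRM_natl -expRD; congr expR; rewrite nE JE !natrD !natrM; ring.
  rewrite EE.
  have -> : kc `^ s * theta ^+ (J - k.+1) * (C * (expR (- (b * n%:R)) * expR (b * M%:R) ^+ (J - k))) =
    kc `^ s * C * expR (- (b * n%:R)) * (theta ^+ (J - k.+1) * expR (b * M%:R) ^+ (J - k)) by ring.
  rewrite -[X in _ <= X]mulrA; apply: ler_wpM2l.
    by rewrite !mulr_ge0 ?powR_ge0 ?expR_ge0 ?ltW.
  rewrite ler_pdivlMl// -(subnSK kJ) mulrA -exprS -exprMn exprS.
  rewrite -[X in _ <= X]mul1r; apply: ler_pM; rewrite ?exprn_ge0 ?mulr_ge0 ?expR_ge0 ?(ltW theta0)//.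
    exact: le_trans hM' (ltW h1).
  by apply: lerXn2r; rewrite ?nnegrE ?mulr_ge0 ?expR_ge0 ?(ltW theta0) ?(ltW h0).
rewrite -mulr_sumr.
have -> : kc `^ s * C / theta / (1 - eta) * expR (- (b * n%:R)) =
  kc `^ s * C * expR (- (b * n%:R)) / theta * (1 - eta)^-1 by ring.
apply: ler_wpM2l; last by apply: geometric_le; rewrite (ltW h0).
by rewrite divr_ge0 ?mulr_ge0 ?powR_ge0 ?expR_ge0 ?ltW.
Qed.

Lemma Ex_bad_at r j (H1 H2 : SeqE a d -> 'M[K]_d) : mkmeas a H1 -> mkmeas a H2 ->
  (Ex mu (fun z => (bd j (prodn r z) (H1 (Defs.shift (r + j * M) z))
     (H2 (Defs.shift (r + j * M) z)) (Defs.shift r z))%:R%R) <= (theta ^+ j)%:E)%E.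
Proof.
move=> mH1 mH2; rewrite -(Ex_cst mu); apply: (Ex_splice_le mu_splice (k := r)) => //.
  apply/measurable_natr/(measurable_bad lf sch) => //.
  - by move=> i i'; apply: (kmeas_comp (mH1 i i')); exact: ps.
  - by move=> i i'; apply: (kmeas_comp (mH2 i i')); exact: ps.
move=> x; rewrite (_ : (fun y => _) = fun y => (bd j (prodn r x) (H1 (Defs.shift (j * M) y))
     (H2 (Defs.shift (j * M) y)) y)%:R); first exact: (Ex_bad_tail lf mu_splice sch).
by apply/funext => y; rewrite prodn_splice// shift_splice_add shift_splice.
Qed.

Lemma measurable_neq0 p q (dX : measure_display) (X : measurableType dX) (f : X -> 'M[K]_(p, q)) :
  mkmeas a f -> measurable [set x | f x != 0].
Proof.
move=> mf; have mb : measurable_fun setT (fun x => 0 < mn a (f x)).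
  by apply: measurable_fun_ltr => //; exact: measurable_mn.
rewrite (_ : [set _ | _] = setT `&` (fun x => 0 < mn a (f x)) @^-1` [set true]).
  exact: mb.
by apply/seteqP; split=> x /=; rewrite (mn_gt0 aP); [split|case].
Qed.

(** A lower bound uniform in [n] and [h], used to pass to conditional probabilities. Insert a block
    between [S_n] and [h]: with probability at least [1 - theta] it is good, and then the product of
    the three does not vanish. *)
Lemma prodn_neq0_prob (h : 'M[K]_d) n : (forall n, mu [set x | prodn n x != 0%R] = 1%E) ->
  h != 0 -> ((1 - theta)%:E <= mu [set x | prodn n x *m h != 0%R])%E.
Proof.
move=> prox h0.
pose A := [set x : SeqE a d | prodn n x *m h != 0].
have mA : measurable A by apply: measurable_neq0; apply: mkmeasM => //; exact: mkmeas_cst.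
have mf : measurable_fun setT (fun x : SeqE a d => \1_A x : R) by exact: measurable_indic.
rewrite -(Ex_indic mu mA) -(Ex_shift mu_splice M mf)//.
pose B0 := ~` [set x : SeqE a d | prodn n x != 0].
pose B1 := ~` [set x : SeqE a d | prodn M x != 0].
have mB0 : measurable B0 by apply: measurableC; exact: measurable_neq0.
have mB1 : measurable B1 by apply: measurableC; exact: measurable_neq0.
have muB0 : Ex mu (\1_B0) = 0%E.
  have := probability_setC mu (measurable_neq0 (mp0 n)).
  by rewrite Ex_indic// prox subee.
have muB1 : Ex mu (\1_B1) = 0%E.
  have := probability_setC mu (measurable_neq0 (mp0 M)).
  by rewrite Ex_indic// prox subee.
pose F1 := fun x : SeqE a d => \1_A (Defs.shift M x) : R.
pose F2 := fun x : SeqE a d => (bd 1 (prodn n x) h h (Defs.shift n x))%:R : R.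
pose F3 := fun x : SeqE a d => \1_B1 (Defs.shift n x) : R.
have mF1 : measurable_fun setT F1 by exact: (measurableT_comp mf (ps M)).
have mF2 : measurable_fun setT F2.
  by apply/measurable_natr/(measurable_bad lf sch) => //; exact: mkmeas_cst.
have mF3 : measurable_fun setT F3.
  by apply: (measurableT_comp _ (ps n)); exact: measurable_indic.
have mI0 : measurable_fun setT (\1_B0 : SeqE a d -> R) by exact: measurable_indic.
have hF2 : (Ex mu F2 <= theta%:E)%E.
  have := Ex_bad_at n 1 (mkmeas_cst a (SeqE a d) h) (mkmeas_cst a (SeqE a d) h).
  by rewrite expr1.
have hF3 : Ex mu F3 = 0%E.
  by rewrite (Ex_shift mu_splice n (F := \1_B1))//; exact: measurable_indic.
have : (1%:E <= Ex mu F1 + Ex mu F2)%E.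
  have -> : (Ex mu F1 + Ex mu F2 = Ex mu (fun x => ((F1 x + F2 x) + (\1_B0 x + F3 x))%R))%E.
    rewrite ExD//; [|exact: measurable_funD|exact: measurable_funD|by move=> x; rewrite addr_ge0..].
    by rewrite !ExD// muB0 hF3 !adde0.
  rewrite -(Ex_cst mu); apply: Ex_le => //.
    by apply: measurable_funD; exact: measurable_funD.
  move=> x; rewrite /F1 /F2 /F3 !indicE.
  have [i0|i0] := boolP (x \in B0); first by rewrite addrA addrAC lerDr !addr_ge0.
  have [i1|i1] := boolP (Defs.shift n x \in B1); first by rewrite addrA lerDr !addr_ge0.
  have [b|b] := boolP (bd 1 (prodn n x) h h (Defs.shift n x)).
    by rewrite !addr0 lerDr.
  suff -> : Defs.shift M x \in A by rewrite !addr0.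
  rewrite inE /A /=; rewrite notin_setE /B0 /= in i0; rewrite notin_setE /B1 /= in i1.
  move/contrapT: i0 => i0; move/contrapT: i1 => i1.
  rewrite /bd /= andbT negbK mul0n prodn0 mul1mx in b.
  have := good_neq0 aP d0 e0 Ttau tau1 b i0 i1 h0.
  (* The same [n + M] letters are now cut after the first [M]. The last [n] of them, whose product
     has the law of [S_n], cannot kill [h] either. *)
  rewrite -prodnD addnC prodnD -mulmxA; apply: contraNN => /eqP ->.
  by rewrite mulmx0.
move=> h1; have : (1%:E <= Ex mu F1 + theta%:E)%E by apply: le_trans h1 _; rewrite leeD2l.
by rewrite EFinB leeBlDr.
Qed.

End Decay.

(** * Accessible matrices and the Schottky property *)

Section Nearness.
Variables (R : realType) (K : fieldType) (a : K -> R) (d : nat).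
Hypothesis aP : nneg_absval a.
Hypothesis d0 : (0 < d)%N.
Notation D := (d%:R : R).
Notation mn := (mn a).
Notation mx2 := (mx2 a).
Implicit Types (A B h : 'M[K]_d).

Let D1 : 1 <= D. Proof. by rewrite ler1n. Qed.

(* A conic neighbourhood of the line of [A]: up to a relative error, [h] is a scalar multiple
   of [A] (see [near_dec]); written with the 2x2 minors of the vectorised matrices so that it
   is measurable in [h]. *)
Definition near (dl : R) A h : bool := mx2 (mxvec A)^T (mxvec h)^T < dl * mn h.

Lemma nearE dl A h : near dl A h = (mx2 (mxvec A)^T (mxvec h)^T < dl * mn h).
Proof. by []. Qed.

Lemma mn_mxvec A : mn (mxvec A)^T = mn A.
Proof.
apply/eqP; rewrite eq_le; apply/andP; split; apply: mn_le; rewrite ?mn_ge0// => i j.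
  by case/mxvec_indexP: i => i i'; rewrite mxE (ord1 j) mxvecE (mn_ub).
by have := mn_ub a (mxvec A)^T (mxvec_index i j) ord0; rewrite mxE mxvecE.
Qed.

Lemma near_ge0 dl A h : near dl A h -> 0 < dl * mn h.
Proof. by apply: le_lt_trans; exact: mx2_ge0. Qed.

Lemma near_neq0 dl A h : near dl A h -> h != 0.
Proof.
by move/near_ge0; apply: contraTneq => ->; rewrite (mn0 aP) mulr0 ltxx.
Qed.

Lemma near_le (dl dl' : R) A h : dl <= dl' -> near dl A h -> near dl' A h.
Proof.
by move=> le_dl h1; apply: lt_le_trans h1 _; apply: ler_wpM2r; rewrite ?mn_ge0.
Qed.

Lemma nearP dl A h : A != 0 -> near dl A h ->
  exists c, mn (h - c *: A) * mn A < dl * mn h.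
Proof.
move=> A0 h1; have A0' : (mxvec A)^T != 0 by rewrite -(mn_eq0 aP) mn_mxvec (mn_eq0 aP).
have [c hc] := line_proj aP (mxvec h)^T A0'.
exists c; apply: le_lt_trans h1; move: hc.
by rewrite -linearZ /= -linearZ /= -linearB /= -linearB /= !mn_mxvec.
Qed.

Lemma near_intro dl c A h : 2%:R * (mn A * mn (h - c *: A)) < dl * mn h -> near dl A h.
Proof.
apply: le_lt_trans; have := subrK (c *: A) h; move: (h - c *: A) => E <-.
rewrite linearD linearZ /= linearD linearZ /=.
apply: le_trans (mx2D aP _ _ _) _; rewrite mx2Z//.
have -> : mx2 (mxvec A)^T (mxvec A)^T = 0.
  apply/eqP; rewrite eq_le mx2_ge0// andbT; apply: mx2_le => // i i' j j'.
  by rewrite (ord1 j) (ord1 j') [X in a (X - _)]mulrC subrr (av0 aP).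
rewrite mulr0 addr0; apply: le_trans (mx2_mn aP _ _) _.
by rewrite !mn_mxvec.
Qed.

Lemma near_dec (e : R) A h : 0 < e -> A != 0 -> near (e * mn A) A h ->
  exists c, mn (h - c *: A) < e * mn h /\ a c * mn A <= (1 + e) * mn h /\
    (1 - e) * mn h <= a c * mn A.
Proof.
move=> e0 A0 /(nearP A0)[c]; rewrite mulrAC ltr_pM2r ?mn_gt0// => hc.
exists c; split=> //; have h1 := mn_subr aP (c *: A) h; have h2 := mn_subr aP h (c *: A).
by rewrite mnBC// (mnZ aP) in h1; rewrite (mnZ aP) in h2; split; lra.
Qed.

(** Write [h] as [c A] and [h'] as [c' B], each up to a small error. The number [k] measures how
    much norm is lost in [A *m B]; as it is positive, the relative error in the product stays small
    once [e] is small compared with [k]. *)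
Lemma near_mul A B : A *m B != 0 -> forall dl : R, 0 < dl -> exists2 dl' : R, 0 < dl' &
  forall h h', near dl' A h -> near dl' B h' -> near dl (A *m B) (h *m h').
Proof.
move=> AB0 dl dl0.
have A0 : A != 0 by apply: contra_neq AB0 => ->; rewrite mul0mx.
have B0 : B != 0 by apply: contra_neq AB0 => ->; rewrite mulmx0.
have := AB0; have := A0; have := B0; rewrite -!(mn_gt0 aP) => b0 a0 ab0.
pose k := mn (A *m B) / (mn A * mn B).
have k0 : 0 < k by rewrite divr_gt0// mulr_gt0.
have D0 : 0 < D by apply: lt_le_trans D1.
pose e := Num.min 2%:R^-1 (Num.min (k / (40%:R * D)) (dl * k / (81%:R * D * mn (A *m B)))).
have e0 : 0 < e.
  rewrite !lt_min; apply/and3P; split; first by rewrite invr_gt0.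
    by apply: divr_gt0 => //; rewrite ?mulr_gt0.
  by apply: divr_gt0; do ?[apply: mulr_gt0 => //].
have e1 : e <= 2%:R^-1 by rewrite ge_min lexx.
have e2 : e * (40%:R * D) <= k.
  by rewrite -ler_pdivlMr ?mulr_gt0// ge_min orbC ge_min lexx.
have e3 : e * (81%:R * D * mn (A *m B)) <= dl * k.
  by rewrite -ler_pdivlMr ?mulr_gt0// ge_min orbC ge_min lexx orbT.
exists (Num.min (e * mn A) (e * mn B)); first by rewrite lt_min !mulr_gt0.
move=> h h' hA hB.
have {}hA : near (e * mn A) A h by apply: near_le hA; rewrite ge_min lexx.
have {}hB : near (e * mn B) B h' by apply: near_le hB; rewrite ge_min lexx orbT.
have [c [hE [hc1 hc2]]] := near_dec e0 A0 hA.
have [c' [hF [hc1' hc2']]] := near_dec e0 B0 hB.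
have := near_neq0 hA; have := near_neq0 hB; rewrite -!(mn_gt0 aP) => h'0 h0.
set E := h - c *: A in hE; set F := h' - c' *: B in hF.
have hhE : h *m h' - (c * c') *: (A *m B) = c *: (A *m F) + E *m h'.
  rewrite /E /F mulmxBl mulmxBr scalerBr -!scalemxAl -!scalemxAr -scalerA.
  by rewrite [RHS]addrC addrA subrK.
have ac0 := av_ge0 aP c; have ac0' := av_ge0 aP c'.
have herr : mn (h *m h' - (c * c') *: (A *m B)) <= 3%:R * D * e * (mn h * mn h').
  rewrite hhE; apply: le_trans (mnD aP _ _) _; rewrite (mnZ aP).
  have h1 : a c * mn (A *m F) <= D * ((1 + e) * mn h * (e * mn h')).
    apply: (@le_trans _ _ (a c * (D * (mn A * mn F)))).
      by apply: ler_wpM2l => //; exact: mnM.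
    rewrite mulrCA ler_pM2l// [X in X <= _]mulrA.
    by apply: ler_pM; rewrite ?mulr_ge0 ?mn_ge0// ltW.
  have h2 : mn (E *m h') <= D * (e * mn h * mn h').
    apply: le_trans (mnM aP _ _) _; rewrite ler_pM2l//.
    by apply: ler_wpM2r; rewrite ?mn_ge0// ltW.
  have hp : 0 <= D * (mn h * mn h') * e by rewrite !mulr_ge0 ?ltW.
  apply: le_trans (lerD h1 h2) _.
  have -> : D * ((1 + e) * mn h * (e * mn h')) + D * (e * mn h * mn h') =
    (2%:R + e) * (D * (mn h * mn h') * e) by ring.
  have -> : 3%:R * D * e * (mn h * mn h') = 3%:R * (D * (mn h * mn h') * e) by ring.
  by apply: ler_wpM2r => //; lra.
have hlow : k / 8%:R * (mn h * mn h') <= mn (h *m h').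
  have h1 := mn_subr aP ((c * c') *: (A *m B)) (h *m h').
  rewrite mnBC// (mnZ aP) (avM aP) in h1.
  have h2 : (1 - e) * mn h * ((1 - e) * mn h') <= a c * mn A * (a c' * mn B).
    by apply: ler_pM => //; rewrite mulr_ge0 ?mn_ge0//; lra.
  have h3 : 4%:R^-1 * (mn h * mn h') <= a c * mn A * (a c' * mn B).
    apply: le_trans h2.
    have -> : (1 - e) * mn h * ((1 - e) * mn h') = (1 - e) ^+ 2 * (mn h * mn h') by ring.
    apply: ler_wpM2r; first by rewrite mulr_ge0 ?mn_ge0.
    have : 0 <= (1 - e - 2%:R^-1) by lra.
    nra.
  have h4 : k * (a c * mn A * (a c' * mn B)) = a c * a c' * mn (A *m B).
    by rewrite /k; field; rewrite !gt_eqF.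
  have h5 : k * (4%:R^-1 * (mn h * mn h')) <= a c * a c' * mn (A *m B).
    by rewrite -h4; apply: ler_wpM2l => //; exact: ltW.
  have h6 : 3%:R * D * e * (mn h * mn h') <= k / 8%:R * (mn h * mn h').
    apply: ler_wpM2r; first by rewrite mulr_ge0 ?mn_ge0.
    lra.
  lra.
apply: (@near_intro _ (c * c')).
apply: le_lt_trans (_ : 2%:R * (mn (A *m B) * (3%:R * D * e * (mn h * mn h'))) < _).
  by rewrite ler_pM2l// ler_pM2l.
apply: lt_le_trans (_ : dl * (k / 8%:R * (mn h * mn h')) <= _); last first.
  by rewrite ler_pM2l.
have -> : 2%:R * (mn (A *m B) * (3%:R * D * e * (mn h * mn h'))) =
  6%:R * (e * (D * mn (A *m B))) * (mn h * mn h') by ring.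
rewrite [X in _ < X]mulrA ltr_pM2r ?mulr_gt0//.
have : 0 < e * (D * mn (A *m B)) by rewrite !mulr_gt0.
lra.
Qed.

Lemma near_limit A : A != 0 -> forall dl : R, 0 < dl -> exists2 dl' : R, 0 < dl' &
  forall B b, mn (b *: B - A) < dl' -> exists2 dl'' : R, 0 < dl'' &
    forall h, near dl'' B h -> near dl A h.
Proof.
move=> A0 dl dl0; have := A0; rewrite -(mn_gt0 aP) => a0.
pose e := Num.min 2%:R^-1 (Num.min (mn A / 2%:R) (dl / (2%:R * mn A * (5%:R + 4%:R / mn A)))).
have e5 : 0 < 5%:R + 4%:R / mn A by rewrite addr_gt0// divr_gt0.
have e0 : 0 < e.
  rewrite !lt_min; apply/and3P; split; first by rewrite invr_gt0.
    by apply: divr_gt0 => //; rewrite ?mulr_gt0.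
  by apply: divr_gt0; do ?[apply: mulr_gt0 => //].
have e1 : e <= 2%:R^-1 by rewrite ge_min lexx.
have e2 : e <= mn A / 2%:R by rewrite ge_min orbC ge_min lexx.
have e3 : e * (2%:R * mn A * (5%:R + 4%:R / mn A)) <= dl.
  by rewrite -ler_pdivlMr ?mulr_gt0// ge_min orbC ge_min lexx orbT.
exists e => // B b hb.
have bB : mn A / 2%:R < a b * mn B.
  by have := mn_subr aP A (b *: B); rewrite mnBC// (mnZ aP); lra.
have bB0 : 0 < a b * mn B by apply: lt_trans bB; rewrite divr_gt0.
have B0 : B != 0 by apply: contraTneq bB0 => ->; rewrite (mn0 aP) mulr0 ltxx.
have b0 : b != 0 by apply: contraTneq bB0 => ->; rewrite (av0 aP) mul0r ltxx.
exists (e * mn B); first by rewrite mulr_gt0// (mn_gt0 aP).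
move=> h hn; have [c [hE [hc1 hc2]]] := near_dec e0 B0 hn.
have := near_neq0 hn; rewrite -(mn_gt0 aP) => h0.
apply: (@near_intro _ (c / b)).
have -> : h - (c / b) *: A = (h - c *: B) + (c / b) *: (b *: B - A).
  by rewrite scalerBr scalerA divfK// addrA subrK.
have hcb : a (c / b) * (mn A / 2%:R) <= (1 + e) * mn h.
  apply: le_trans hc1; rewrite -{2}(divfK b0 c) (avM aP (c / b)) -mulrA.
  by apply: ler_wpM2l; [exact: av_ge0|exact: ltW].
have hcb' : a (c / b) <= 2%:R / mn A * ((1 + e) * mn h).
  by rewrite mulrAC ler_pdivlMr// ; lra.
have h1 : mn (h - c *: B + (c / b) *: (b *: B - A)) < (5%:R + 4%:R / mn A) * e * mn h.
  apply: le_lt_trans (mnD aP _ _) _; rewrite (mnZ aP).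
  have : a (c / b) * mn (b *: B - A) <= 2%:R / mn A * ((1 + e) * mn h) * e.
    by apply: ler_pM => //; rewrite ?av_ge0 ?mn_ge0// ltW.
  have : 2%:R / mn A * ((1 + e) * mn h) * e <= 4%:R / mn A * e * mn h.
    have -> : 2%:R / mn A * ((1 + e) * mn h) * e = (2%:R * (1 + e)) * (e * mn h / mn A) by ring.
    have -> : 4%:R / mn A * e * mn h = 4%:R * (e * mn h / mn A) by ring.
    apply: ler_wpM2r; last lra.
    by rewrite divr_ge0 ?mulr_ge0 ?mn_ge0 ?(ltW e0).
  have : 0 < e * mn h by rewrite mulr_gt0.
  lra.
apply: lt_le_trans (_ : 2%:R * (mn A * ((5%:R + 4%:R / mn A) * e * mn h)) <= _).
  by rewrite ltr_pM2l// ltr_pM2l.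
have -> : 2%:R * (mn A * ((5%:R + 4%:R / mn A) * e * mn h)) =
  e * (2%:R * mn A * (5%:R + 4%:R / mn A)) * mn h by ring.
by rewrite ler_pM2r.
Qed.

Lemma near_ball A : A != 0 -> forall dl : R, 0 < dl -> exists2 e : R, 0 < e &
  forall h, mn (h - A) < e -> near dl A h.
Proof.
move=> A0 dl dl0; have := A0; rewrite -(mn_gt0 aP) => a0.
pose e := Num.min (mn A / 2%:R) (dl / 4%:R).
have e0 : 0 < e by rewrite lt_min !divr_gt0.
have e1 : e <= mn A / 2%:R by rewrite ge_min lexx.
have e2 : e <= dl / 4%:R by rewrite ge_min lexx orbT.
exists e => // h hh; apply: (@near_intro _ 1); rewrite scale1r.
have h1 := mn_subr aP A h; rewrite mnBC// in h1.
apply: lt_le_trans (_ : 2%:R * (mn A * e) <= _).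
  by rewrite ltr_pM2l// ltr_pM2l.
apply: (@le_trans _ _ (dl * (mn A / 2%:R))).
  have : mn A * e <= mn A * (dl / 4%:R) by rewrite ler_pM2l.
  lra.
by rewrite ler_pM2l//; lra.
Qed.

Lemma mn_outer p q (u : 'cV[K]_p) (f : 'rV[K]_q) : mn (u *m f) = mn u * mn f.
Proof.
have uE i j : (u *m f) i j = u i ord0 * f ord0 j by rewrite mxE big_ord1.
apply/eqP; rewrite eq_le; apply/andP; split.
  apply: mn_le; first by rewrite mulr_ge0 ?mn_ge0.
  by move=> i j; rewrite uE (avM aP) ler_pM ?av_ge0 ?mn_ub.
have [->|u0] := eqVneq u 0; first by rewrite (mn0 aP) mul0r mn_ge0.
have [->|f0] := eqVneq f 0; first by rewrite (mn0 aP) mulr0 mn_ge0.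
have [i [j ->]] := mn_max aP u0; have [i' [j' ->]] := mn_max aP f0.
by rewrite (ord1 j) (ord1 i') -(avM aP) -uE mn_ub.
Qed.

Lemma mx2_outer p q (u : 'cV[K]_p) (f : 'rV[K]_q) : mx2 (u *m f) (u *m f) = 0.
Proof.
apply/eqP; rewrite eq_le mx2_ge0// andbT; apply: mx2_le => // i i' j j'.
rewrite !mxE !big_ord1 (_ : _ - _ = 0) ?(av0 aP)//; ring.
Qed.

Lemma near_outer_gap (e : R) (u : 'cV[K]_d) (f : 'rV[K]_d) B : 0 < e -> e <= 1 -> u *m f != 0 ->
  near (e * mn (u *m f)) (u *m f) B -> mx2 B B <= 10%:R * e * mn B ^+ 2.
Proof.
move=> e0 e1 A0 hB; have [c [hE [hc1 _]]] := near_dec e0 A0 hB.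
set A := u *m f in A0 hB hE hc1; set E := B - c *: A in hE.
have -> : B = E + c *: A by rewrite subrK.
have b0 := mn_ge0 aP B; have E0 := mn_ge0 aP E.
apply: le_trans (mx2D aP _ _ _) _; rewrite mx2Z// (mx2C aP _ E) (mx2C aP _ A).
apply: le_trans (lerD (mx2D aP _ _ _) (ler_wpM2l (av_ge0 aP c) (mx2D aP _ _ _))) _.
rewrite !mx2Z// mx2_outer mulr0 addr0 (mx2C aP A E).
have h1 : mx2 E E <= 2%:R * (mn E * mn E) by exact: mx2_mn.
have h2 : mx2 E A <= 2%:R * (mn E * mn A) by exact: mx2_mn.
have h3 : a c * mx2 E A <= 2%:R * (mn E * ((1 + e) * mn B)).
  apply: (@le_trans _ _ (a c * (2%:R * (mn E * mn A)))).
    by apply: ler_wpM2l => //; exact: av_ge0.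
  have -> : a c * (2%:R * (mn E * mn A)) = 2%:R * (mn E * (a c * mn A)) by ring.
  by rewrite ler_pM2l//; apply: ler_wpM2l.
have h4 : mn E * ((1 + e) * mn B) <= e * mn B * (2%:R * mn B).
  apply: ler_pM => //; first by rewrite mulr_ge0//; lra.
    exact: ltW.
  by apply: ler_wpM2r => //; lra.
have h5 : mn E * mn E <= e * mn B * mn B.
  apply: ler_pM => //; first exact: ltW.
  by apply: le_trans (ltW hE) _; rewrite ler_piMl.
rewrite subrK.
nra.
Qed.

Lemma near_outer_left (e k U : R) (u : 'cV[K]_d) (f : 'rV[K]_d) B p (g : 'M[K]_(p, d)) :
  0 < e -> e <= 2%:R^-1 -> u *m f != 0 -> mn u <= U -> 0 < k -> e * (4%:R * U * D) <= k ->
  near (e * mn (u *m f)) (u *m f) B -> k * mn g <= mn (g *m u) ->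
  k / (4%:R * U) * (mn g * mn B) <= mn (g *m B).
Proof.
move=> e0 e1 A0 uU k0 ek hB hg; have [c [hE [_ hc2]]] := near_dec e0 A0 hB.
set E := B - c *: _ in hE.
have u0 : 0 < mn u.
  by rewrite (mn_gt0 aP); apply: contraNneq A0 => ->; rewrite mul0mx.
have U0 : 0 < U by exact: lt_le_trans uU.
have D0 : 0 < D by apply: lt_le_trans D1.
have g0 := mn_ge0 aP g; have b0 := mn_ge0 aP B; have ac0 := av_ge0 aP c; have f0 := mn_ge0 aP f.
have -> : g *m B = c *: ((g *m u) *m f) + g *m E.
  by rewrite /E mulmxBr -scalemxAr mulmxA addrC subrK.
have h1 := mn_subr aP (c *: ((g *m u) *m f)) (- (g *m E)).
rewrite opprK (mnN aP) (mnZ aP) mn_outer in h1.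
have h2 : mn (g *m E) <= D * (mn g * (e * mn B)).
  apply: le_trans (mnM aP _ _) _; rewrite ler_pM2l//; apply: ler_wpM2l => //; exact: ltW.
rewrite mn_outer in hc2.
have h3 : 2%:R^-1 * mn B <= a c * mn f * U.
  apply: le_trans (_ : (1 - e) * mn B <= _); first by apply: ler_wpM2r => //; lra.
  apply: le_trans hc2 _; rewrite mulrCA mulrC; apply: ler_wpM2l => //.
  by rewrite mulr_ge0.
have h4 : k * mn g * (a c * mn f) <= a c * (mn (g *m u) * mn f).
  have -> : a c * (mn (g *m u) * mn f) = mn (g *m u) * (a c * mn f) by ring.
  by apply: ler_wpM2r => //; rewrite mulr_ge0.
have h5 : k / U * mn g * (2%:R^-1 * mn B) <= k * mn g * (a c * mn f).
  have -> : k * mn g * (a c * mn f) = k / U * mn g * (a c * mn f * U) by field; rewrite gt_eqF.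
  by apply: ler_wpM2l => //; rewrite mulr_ge0// divr_ge0// ltW.
have h6 : D * (mn g * (e * mn B)) <= k / (4%:R * U) * (mn g * mn B).
  have -> : D * (mn g * (e * mn B)) = e * D * (mn g * mn B) by ring.
  apply: ler_wpM2r; first by rewrite mulr_ge0.
  by rewrite ler_pdivlMr ?mulr_gt0//; lra.
have h7 : k / U * mn g * (2%:R^-1 * mn B) = 2%:R * (k / (4%:R * U) * (mn g * mn B)).
  by field; rewrite gt_eqF.
lra.
Qed.

End Nearness.

(** * Families in general position, qualitatively and quantitatively *)

Section GeneralPosition.
Variables (K : fieldType) (d : nat).

(** Says that [S] is contained in no finite union of hyperplanes of the dual space. *)
Definition ample (S : set 'rV[K]_d) : Prop := forall ws : seq 'cV[K]_d,
  (forall w, w \in ws -> w != 0) ->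
  exists2 s, S s & forall w, w \in ws -> s *m w != 0.

Lemma span_annihilated (X : seq 'rV[K]_d) (w : 'cV[K]_d) v :
  (forall x, x \in X -> x *m w = 0) -> v \in <<X>>%VS -> v *m w = 0.
Proof.
move=> h /(coord_span (X := in_tuple X)) ->; rewrite mulmx_suml big1// => i _.
by rewrite -scalemxAl h ?scaler0// mem_nth//; case: i.
Qed.

Lemma free_annihilated (X : seq 'rV[K]_d) (w : 'cV[K]_d) :
  w != 0 -> free X -> (forall x, x \in X -> x *m w = 0) -> (size X < d)%N.
Proof.
move=> w0 fX h; rewrite ltnNge; apply: contra w0 => dX.
have fullX : (<<X>> = fullv)%VS.
  apply/eqP; rewrite eqEdim subvf dimvf /= (eqP fX).
  by rewrite /dim /= mul1n.
apply/eqP/matrixP => i j; rewrite (ord1 j) mxE.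
have := span_annihilated h (v := delta_mx ord0 i); rewrite fullX memvf => /(_ isT).
by rewrite -rowE => /matrixP/(_ ord0 ord0); rewrite !mxE.
Qed.

(* Each new vector avoids, for every subfamily that is annihilated by some nonzero [w], one
   such [w]; an annihilated subfamily thus stays linearly independent. *)
Lemma general_position (S : set 'rV[K]_d) (L : seq 'cV[K]_d) N : ample S ->
  (forall w, w \in L -> w != 0) ->
  exists s : 'I_N -> 'rV[K]_d, [/\ forall i, S (s i),
    forall i w, w \in L -> s i *m w != 0 &
    forall w : 'cV[K]_d, w != 0 -> (#|[pred i | (s i *m w == 0)%R]| < d)%N].
Proof.
move=> Sample L0.
have : exists ss : seq 'rV[K]_d, [/\ size ss = N,
    forall s, s \in ss -> S s, forall s w, s \in ss -> w \in L -> s *m w != 0 &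
    forall m (w : 'cV[K]_d), w != 0 -> (forall s, s \in mask m ss -> s *m w = 0) -> free (mask m ss)].
  elim: N => [|n [ss [sz Sss Lss Iss]]].
    by exists [::]; split=> // m w _ _; rewrite mask0 nil_free.
  (* For each subfamily, coded by a mask, one nonzero vector annihilated by it is fixed, if there is
     any. *)
  have /choice[phi hphi] : forall m : bitseq, exists w : 'cV[K]_d,
      (exists2 w' : 'cV[K]_d, w' != 0 & forall s, s \in mask m ss -> s *m w' = 0) ->
      w != 0 /\ forall s, s \in mask m ss -> s *m w = 0.
    move=> m; have [[w w0 hw]|h] := pselect (exists2 w' : 'cV[K]_d, w' != 0 &
      forall s, s \in mask m ss -> s *m w' = 0); first by exists w.
    by exists 0.
  pose ms := [seq val m | m <- enum {: (size ss).-tuple bool}].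
  have [|s Ss hs] := Sample (L ++ [seq phi m | m <- ms & phi m != 0]).
    move=> w; rewrite mem_cat => /orP[/L0//|/mapP[m]].
    by rewrite mem_filter => /andP[h _] ->.
  exists (s :: ss); split.
  - by rewrite /= sz.
  - by move=> x; rewrite inE => /predU1P[->//|/Sss].
  - move=> x w; rewrite inE => /predU1P[->|xs] wL; last exact: Lss.
    by apply: hs; rewrite mem_cat wL.
  move=> [|b m] w w0; first by rewrite mask0s nil_free.
  case: b => [hw|]; last by rewrite mask_cons; exact: Iss.
  rewrite mask_cons /= free_cons; apply/andP; split; last first.
    by apply: Iss w0 _ => x xm; apply: hw; rewrite mask_cons inE xm orbT.
  have /subseqP[m' szm' mm'] := mask_subseq m ss.
  rewrite mm'.
  have [|p0 hp] := hphi m'.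
    by exists w => // x; rewrite -mm' => xm; apply: hw; rewrite mask_cons inE xm orbT.
  have : s *m phi m' != 0.
    apply: hs; rewrite mem_cat; apply/orP; right; apply: map_f.
    rewrite mem_filter p0; apply/mapP; exists (Tuple (introT eqP szm')) => //; exact: mem_enum.
  (* If [s] depended linearly on the subfamily it would kill the vector fixed for it, which it was
     chosen to avoid. *)
  by apply: contra => /(span_annihilated hp) ->.
case=> ss [sz Sss Lss Iss]; exists (fun i => nth 0 ss i); split.
- by move=> i; apply: Sss; rewrite mem_nth// sz.
- by move=> i w wL; apply: Lss => //; rewrite mem_nth// sz.
move=> w w0.
have -> : #|[pred i : 'I_N | (nth 0 ss i *m w == 0)%R]| = size [seq s <- ss | s *m w == 0].
  rewrite size_filter -sum1_count (big_nth 0) sz big_mkord sum1_card.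
  by apply: eq_card => i; rewrite inE.
have hm x : x \in [seq s <- ss | s *m w == 0] -> x *m w = 0.
  by rewrite mem_filter => /andP[/eqP].
apply: (free_annihilated w0) => //.
by move: hm; rewrite filter_mask; exact: Iss.
Qed.

End GeneralPosition.

Section Quantitative.
Variables (R : realType) (K : fieldType) (a : K -> R) (d N : nat).
Hypothesis lf : local_field a.
Let aP := local_field_nneg lf.
Notation mn := (mn a).

Lemma normalize p q (A : 'M[K]_(p, q)) : A != 0 -> exists2 c, c != 0 & mn (c *: A) = 1.
Proof.
move=> A0; have [i [j hij]] := mn_max aP A0; have := A0.
rewrite -(mn_gt0 aP) hij (av_gt0 aP) => Aij.
exists (A i j)^-1; first by rewrite invr_eq0.
by rewrite (mnZ aP) hij -(avM aP) mulVf// (av1 aP).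
Qed.

(** Compactness: otherwise unit vectors with at least [d] pairings below [1 / (n + 1)] accumulate at
    some nonzero [l]. A form that does not kill [l] has pairings bounded below along the
    subsequence, so at least [d] forms kill [l]. *)
Lemma general_position_bound (s : 'I_N -> 'rV[K]_d) :
  (forall w : 'cV[K]_d, w != 0 -> (#|[pred i | s i *m w == 0%R]| < d)%N) ->
  exists2 e : R, 0 < e & forall w : 'cV[K]_d, w != 0 ->
    (#|[pred i | (mn (s i *m w) < e * mn w)%R]| < d)%N.
Proof.
move=> gp; apply: contrapT => H.
have /choice[v hv] : forall n, exists v : 'cV[K]_d, mn v = 1 /\
    (d <= #|[pred i | (mn (s i *m v) < n.+1%:R^-1)%R]|)%N.
  move=> n; apply: contrapT => Hn; apply: H; exists n.+1%:R^-1; first by rewrite invr_gt0.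
  move=> w w0; rewrite ltnNge; apply/negP => dw; apply: Hn.
  have [c c0 cw] := normalize w0; exists (c *: w); split=> //.
  apply: leq_trans dw _; apply: subset_leq_card; apply/fintype.subsetP => i; rewrite !inE => hi.
  rewrite -scalemxAr (mnZ aP); move: cw; rewrite (mnZ aP) => cw.
  by have := hi; rewrite -(@ltr_pM2l _ (a c)) ?(av_gt0 aP)// mulrCA cw mulr1.
have [|phi [l [hphi hl]]] := bounded_subseq_mx lf (u := v) (r := 1).
  by move=> n; case: (hv n) => ->.
have l0 : l != 0.
  have [n hn] := hl 2%:R^-1 ltac:(by rewrite invr_gt0); have := hn n (leqnn n).
  apply: contraTneq => ->; rewrite subr0 /=; case: (hv (phi n)) => -> _.
  by rewrite -leNgt; lra.
have /choice[n hn] : forall i : 'I_N, exists n, forall m, (n <= m)%N -> s i *m l != 0 ->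
    (phi m).+1%:R^-1 <= mn (s i *m v (phi m)).
  move=> i; have [sl|sl] := eqVneq (s i *m l) 0; first by exists 0%N => m _ /eqP[].
  have := sl; rewrite -(mn_gt0 aP) => sl0.
  pose c := mn (s i *m l) / 2%:R.
  have c0 : 0 < c by rewrite divr_gt0.
  have [n1 h1] := inv_small c0.
  have D1 : 0 < (d%:R + 1) * (mn (s i) + 1) by rewrite mulr_gt0// ltr_wpDl// mn_ge0.
  have [n2 h2] := hl (c / ((d%:R + 1) * (mn (s i) + 1))) ltac:(by rewrite divr_gt0).
  exists (maxn n1 n2) => m; rewrite geq_max => /andP[m1 m2] _.
  have h3 := h2 m m2; rewrite /= ltr_pdivlMr// in h3.
  have h4 : (phi m).+1%:R^-1 <= c.
    apply: le_trans (ltW h1); rewrite lef_pV2 ?posrE// ler_nat ltnS.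
    by apply: leq_trans m1 _; exact: mono_ge.
  apply: le_trans h4 _; have := mn_subr aP (s i *m l) (s i *m v (phi m)).
  rewrite mnBC//; have := mnM aP (s i) (v (phi m) - l); rewrite mulmxBr.
  have e0 := mn_ge0 aP (v (phi m) - l); have e1 := mn_ge0 aP (s i).
  have : d%:R * (mn (s i) * mn (v (phi m) - l)) <= mn (v (phi m) - l) * ((d%:R + 1) * (mn (s i) + 1)).
    have : (0 : R) <= d%:R by []; nra.
  rewrite /c in h3 *; lra.
have := gp l l0; rewrite ltnNge; apply/negP; rewrite negbK.
pose m := (\max_i n i)%N.
have [_ hd] := hv (phi m); apply: leq_trans hd _; apply: subset_leq_card.
apply/fintype.subsetP => i; rewrite !inE; apply: contraTT => sl; rewrite -leNgt.
by apply: hn sl; exact: (leq_bigmax i).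
Qed.

End Quantitative.

Section NearSymmetries.
Variables (R : realType) (K : fieldType) (a : K -> R) (d : nat).
Hypothesis aP : nneg_absval a.
Notation mn := (mn a).
Notation near := (near a).

Lemma near_refl (dl : R) (A : 'M[K]_d) : 0 < dl -> A != 0 -> near dl A A.
Proof.
by move=> dl0 A0; apply: (near_intro aP (c := 1)); rewrite scale1r subrr (mn0 aP) !mulr0 mulr_gt0// (mn_gt0 aP).
Qed.

Lemma near_scale (dl : R) (c : K) (A h : 'M[K]_d) : c != 0 ->
  near (dl * mn (c *: A)) (c *: A) h = near (dl * mn A) A h.
Proof.
move=> c0; rewrite !nearE linearZ /= linearZ /= mx2C// mx2Z// (mx2C aP) (mnZ aP).
have -> : dl * (a c * mn A) * mn h = a c * (dl * mn A * mn h) by ring.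
by rewrite ltr_pM2l// (av_gt0 aP).
Qed.

Lemma mn_tr p q (A : 'M[K]_(p, q)) : mn A^T = mn A.
Proof.
apply/eqP; rewrite eq_le; apply/andP; split; apply: mn_le; rewrite ?mn_ge0// => i j.
  by rewrite mxE mn_ub.
by have := mn_ub a A^T j i; rewrite mxE.
Qed.

Lemma near_tr (dl : R) (A h : 'M[K]_d) : near dl A h -> near dl A^T h^T.
Proof.
rewrite !nearE mn_tr; apply: le_lt_trans; apply: mx2_le; first exact: mx2_ge0.
move=> i i' j j'; case/mxvec_indexP: i => i k; case/mxvec_indexP: i' => i' k'.
have := mx2_ub a (mxvec A)^T (mxvec h)^T (mxvec_index k i) (mxvec_index k' i') j j'.
by rewrite !mxE (ord1 j) (ord1 j') !mxvecE !mxE.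
Qed.

End NearSymmetries.

Section Accessible.
Variables (R : realType) (K : fieldType) (a : K -> R) (d : nat).
Hypothesis lf : local_field a.
Hypothesis d0 : (0 < d)%N.
Let aP := local_field_nneg lf.
Notation mn := (mn a).
Notation near := (near a).
Implicit Types A B h g : 'M[K]_d.

Variable mu : probability (SeqE a d) R.
Hypothesis mu_splice : forall k (F : SeqE a d -> \bar R), measurable_fun setT F ->
  (forall x, 0 <= F x)%E ->
  (\int[mu]_x F x = \int[mu]_x \int[mu]_y F (splice k x y))%E.

Lemma measurable_near (dX : measure_display) (X : measurableType dX) (dl : R) A (g : X -> 'M[K]_d) :
  mkmeas a g -> measurable_fun setT (fun x => near dl A (g x)).
Proof.
move=> mg; apply: measurable_fun_ltr; last first.
  by apply: measurable_funM => //; exact: measurable_mn.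
apply: (measurable_mx2 lf); first exact: mkmeas_cst.
move=> i j; case/mxvec_indexP: i => i i'.
rewrite (_ : (fun x => _) = fun x => g x i i'); first exact: mg.
by apply/funext => x; rewrite mxE (ord1 j) mxvecE.
Qed.

Lemma measurable_near_prodn n (dl : R) A : measurable [set x : SeqE a d | near dl A (prodn n x)].
Proof.
have := measurable_near dl A (mkmeas_prodn lf n (@measurable_id _ (SeqE a d) setT)).
by move=> /(_ measurableT [set true] I); rewrite setTI.
Qed.

Lemma splice_mul_le k (X Y Z : set (SeqE a d)) : measurable X -> measurable Y ->
  measurable Z -> (forall x y, X x -> Y y -> Z (splice k x y)) -> (mu X * mu Y <= mu Z)%E.
Proof.
move=> mX mY mZ XYZ.
have [eY hY] : exists y : R, mu Y = y%:E.
  by exists (fine (mu Y)); rewrite fineK// fin_num_measure.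
have y0 : 0 <= eY by rewrite -lee_fin -hY.
rewrite -(Ex_indic mu mZ) hY muleC -(Ex_indic mu mX) -ExZ//.
have mF : measurable_fun setT (\1_Z : SeqE a d -> R) by exact: measurable_indic.
have mG : measurable_fun setT (fun x : SeqE a d => eY * \1_X x : R).
  by apply: measurable_funM => //; exact: measurable_indic.
rewrite /Ex [X in (_ <= X)%E](mu_splice k); last 2 first.
- exact/measurable_EFinP.
- by move=> x; rewrite lee_fin.
have mFs : measurable_fun setT (fun z : SeqE a d * SeqE a d => (\1_Z (splice k z.1 z.2) : R)%:E).
  by apply/measurable_EFinP; exact: (measurableT_comp mF (@measurable_splice R K a d k)).
apply: ge0_le_integral => //.
- by move=> x _; rewrite lee_fin mulr_ge0.
- exact/measurable_EFinP.
- exact: (measurable_fun_fubini_tonelli_F (fun z : SeqE a d * SeqE a d => (\1_Z (splice k z.1 z.2) : R)%:E)).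
move=> x _; have [Xx|nXx] := boolP (x \in X); last first.
  rewrite indicE (negbTE nXx) mulr0; apply: integral_ge0 => y _; by rewrite lee_fin.
rewrite indicE Xx mulr1 -hY -(Ex_indic mu mY) /Ex; apply: ge0_le_integral => //.
- by apply/measurable_EFinP; exact: measurable_indic.
- exact: (measurableT_comp mFs (measurable_pair1 x)).
move=> y _; rewrite lee_fin !indicE; have [Yy|//] := boolP (y \in Y).
by rewrite (_ : _ \in Z)// inE; apply: XYZ; exact: set_mem.
Qed.

Definition hits (dl : R) A n := (0 < mu [set x | near dl A (prodn n x)])%E.

Lemma hits_exists dl A n : hits dl A n -> exists x : SeqE a d, near dl A (prodn n x).
Proof.
move=> h; apply: contrapT => hx; move: h.
rewrite /hits (_ : [set x | _] = set0) ?measure0 ?ltxx//.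
by apply/seteqP; split=> // x hn; case: hx; exists x.
Qed.

Lemma hitsM A B : A *m B != 0 -> forall dl : R, 0 < dl -> exists2 dl' : R, 0 < dl' &
  forall n m, hits dl' A n -> hits dl' B m -> hits dl (A *m B) (n + m).
Proof.
move=> AB0 dl dl0; have [dl' dl'0 H] := near_mul aP d0 AB0 dl0.
exists dl' => // n m hA hB.
apply: lt_le_trans (mule_gt0 hA hB) _.
apply: (splice_mul_le (k := n)); try exact: measurable_near_prodn.
by move=> x y /= hx hy; rewrite prodnD prodn_splice// shift_splice; exact: H.
Qed.

Lemma hits1 (dl : R) : 0 < dl -> hits dl 1%:M 0.
Proof.
move=> dl0; rewrite /hits (_ : [set x | _] = setT) ?probability_setT//.
apply/seteqP; split=> // x _ /=; rewrite prodn0; apply: near_refl => //.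
apply/eqP => /matrixP/(_ (Ordinal d0) (Ordinal d0)); rewrite !mxE eqxx => /eqP.
by rewrite oner_eq0.
Qed.

Lemma hits_le (dl dl' : R) A n : dl <= dl' -> hits dl A n -> hits dl' A n.
Proof.
move=> le_dl; move/lt_le_trans; apply; apply: le_measure; rewrite ?inE; try exact: measurable_near_prodn.
by move=> x /=; exact: near_le.
Qed.

(* Up to scalars, [A] is a limit of products of matrices of the support. *)
Definition accessible A := A != 0 /\ forall dl : R, 0 < dl -> exists n, hits dl A n.

Lemma accessibleM A B : accessible A -> accessible B -> A *m B != 0 -> accessible (A *m B).
Proof.
move=> [A0 hA] [B0 hB] AB0; split=> // dl dl0.
have [dl' dl'0 H] := hitsM AB0 dl0.
by have [n hn] := hA _ dl'0; have [m hm] := hB _ dl'0; exists (n + m)%N; exact: H.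
Qed.

Lemma accessible_limit A : A != 0 ->
  (forall e : R, 0 < e -> exists B b, accessible B /\ mn (b *: B - A) < e) -> accessible A.
Proof.
move=> A0 H; split=> // dl dl0; have [e e0 he] := near_limit aP A0 dl0.
have [B [b [[B0 hB] hb]]] := H e e0; have [dl' dl'0 h'] := he B b hb.
have [n hn] := hB _ dl'0; exists n; apply: lt_le_trans hn _.
apply: le_measure; rewrite ?inE; try exact: measurable_near_prodn.
by move=> x /=; exact: h'.
Qed.

Lemma accessible_support n g : g != 0 ->
  (forall e : R, 0 < e -> (0 < mu [set x | (mn (prodn n x - g) < e)%R])%E) -> accessible g.
Proof.
move=> g0 H; split=> // dl dl0; have [e e0 he] := near_ball aP g0 dl0.
exists n; apply: lt_le_trans (H e e0) _; apply: le_measure; rewrite ?inE.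
- have mB : mkmeas a (fun x : SeqE a d => prodn n x - g).
    by apply: (mkmeasB lf); [exact: mkmeas_prodn|exact: mkmeas_cst].
  have := measurable_fun_ltr (measurable_mn mB) (@measurable_cst _ _ _ _ setT e).
  by move=> /(_ measurableT [set true] I); rewrite setTI.
- exact: measurable_near_prodn.
- by move=> x /=; exact: he.
Qed.

Lemma accessible_pos n (A : set (SeqE a d)) : measurable A -> (0 < mu A)%E ->
  (forall x, A x -> prodn n x != 0) -> exists2 x, A x & accessible (prodn n x).
Proof.
move=> mA A0 An0.
have [x Ax hx] := support_point lf (mkmeas_prodn lf n (@measurable_id _ (SeqE a d) setT)) mA A0.
by exists x => //; apply: (accessible_support (n := n)); [exact: An0|exact: hx].
Qed.

Fixpoint chain (Q : nat -> 'M[K]_d) (r k : nat) : 'M[K]_d :=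
  if k is k'.+1 then Q r *m chain Q r.+1 k' else 1%:M.

(** The tolerance [dl'] is fixed before the word lengths. One choice of words can then serve all
    rotations of the product simultaneously. *)
Lemma hits_chain (Q : nat -> 'M[K]_d) r k : (forall k', (k' <= k)%N -> chain Q (r + (k - k')) k' != 0) ->
  forall dl : R, 0 < dl -> exists2 dl' : R, 0 < dl' & forall n : nat -> nat,
    (forall i, hits dl' (Q i) (n i)) -> hits dl (chain Q r k) (\sum_(i < k) n (r + i)).
Proof.
elim: k r => [|k IH] r nz dl dl0.
  by exists 1 => // n _; rewrite big_ord0; exact: hits1.
have [] := hitsM _ dl0 (A := Q r) (B := chain Q r.+1 k).
  by have := nz k.+1 (leqnn _); rewrite subnn addn0.
move=> d1 d1p H1; have [|d2 d2p H2] := IH r.+1 _ d1 d1p.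
  move=> k' k'k; have := nz k' (leqW k'k); rewrite subSn// addnS addSn; exact.
exists (Num.min d1 d2); first by rewrite lt_min d1p.
move=> n hn; rewrite big_ord_recl addn0; apply: H1.
  by apply: hits_le (hn r); rewrite ge_min lexx.
under eq_bigr do rewrite /= /bump /= add1n addnS -addSn.
by apply: H2 => i; apply: hits_le (hn i); rewrite ge_min lexx orbT.
Qed.

(** The inner pairings [f i *m u (i + 1)] are nonzero scalars and come out of the product. *)
Lemma chain_outer (u : nat -> 'cV[K]_d) (f : nat -> 'rV[K]_d) r k :
  (forall i j, f i *m u j != 0) ->
  exists2 c, c != 0 & chain (fun i => u i *m f i) r k.+1 = c *: (u r *m f (r + k)%N).
Proof.
move=> fu; elim: k r => [|k IH] r.
  by exists 1; rewrite ?oner_eq0//= mulmx1 scale1r addn0.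
have [c c0 hc] := IH r.+1; exists (c * (f r *m u r.+1) ord0 ord0).
  rewrite mulf_neq0//; apply: contra_neq (fu r r.+1) => h.
  by apply/matrixP => i j; rewrite (ord1 i) (ord1 j) h mxE.
have h F : u r *m f r *m (u r.+1 *m F) = (f r *m u r.+1) ord0 ord0 *: (u r *m F).
  by rewrite -mulmxA (mulmxA (f r)) [f r *m u _]mx11_scalar mul_scalar_mx -scalemxAr !mxE eqxx.
by rewrite -[chain _ _ _]/(_ *m chain _ r.+1 k.+1) hc -scalemxAr h scalerA addSnnS.
Qed.

End Accessible.

Lemma positive_lower_bound (R : realType) (I : finType) (f : I -> R) :
  (forall i, 0 < f i) -> exists2 m, 0 < m & forall i, m <= f i.
Proof.
move=> f0; exists (\big[Num.min/1]_i f i); first exact: lt_bigmin.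
by move=> i; exact: bigmin_le_cond.
Qed.

(** This is why the rotations of a cyclic product are words of one common length. *)
Lemma sum_period (m : nat -> nat) n r : (forall i, m (i + n.+1)%N = m i) ->
  (\sum_(i < n.+1) m (r + i) = \sum_(i < n.+1) m i)%N.
Proof.
move=> hm; elim: r => [|r <-]; first by apply: eq_bigr => i _; rewrite add0n.
rewrite big_ord_recr [RHS]big_ord_recl /= addSnnS hm addn0 [RHS]addnC.
by congr (_ + _)%N; apply: eq_bigr => i _; rewrite /bump /= add1n addSnnS.
Qed.

Section Schottky.
Variables (R : realType) (K : fieldType) (a : K -> R) (d : nat).
Hypothesis lf : local_field a.
Hypothesis d2 : (2 <= d)%N.
Let aP := local_field_nneg lf.
Let d0 : (0 < d)%N. Proof. exact: ltnW. Qed.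
Notation mn := (mn a).
Notation mx2 := (mx2 a).
Notation near := (near a).
Notation D := (d%:R : R).
Implicit Types A B g : 'M[K]_d.

Variable mu : probability (SeqE a d) R.
Hypothesis mu_splice : forall k (F : SeqE a d -> \bar R), measurable_fun setT F ->
  (forall x, 0 <= F x)%E ->
  (\int[mu]_x F x = \int[mu]_x \int[mu]_y F (splice k x y))%E.
Notation acc := (accessible mu).
Notation hits := (hits mu).

Lemma near_outer_right (e k U : R) (u : 'cV[K]_d) (f : 'rV[K]_d) B p (g : 'M[K]_(d, p)) :
  0 < e -> e <= 2%:R^-1 -> u *m f != 0 -> mn f <= U -> 0 < k -> e * (4%:R * U * D) <= k ->
  near (e * mn (u *m f)) (u *m f) B -> k * mn g <= mn (f *m g) ->
  k / (4%:R * U) * (mn B * mn g) <= mn (B *m g).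
Proof.
move=> e0 e1 A0 fU k0 ek /(near_tr aP) hB hg.
rewrite -(mn_tr aP (B *m g)) trmx_mul mulrC -(mn_tr aP g) -(mn_tr aP B) [mn B^T * _]mulrC mulrC.
apply: (near_outer_left aP d0 e0 e1 (u := f^T) (f := u^T)) => //.
- by rewrite -trmx_mul trmx_eq0.
- by rewrite mn_tr.
- by rewrite -trmx_mul mn_tr.
- by rewrite -trmx_mul !mn_tr.
Qed.

Section WeightMean.
Variables (N M : nat) (A : 'I_N -> 'M[K]_d) (dl p : 'I_N -> R) (t : R).
Hypothesis p0 : forall r, 0 < p r.
Hypothesis pE : forall r, (p r)%:E = mu [set x | near (dl r) (A r) (prodn M x)].
Hypothesis t0 : 0 <= t.

(** Dividing by the probability [p r] gives every direction the same mean [t], however rarely it is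
    hit. *)
Definition near_weight B : R := \sum_r t / p r * (near (dl r) (A r) B)%:R.

Lemma near_weight_ge0 B : 0 <= near_weight B.
Proof. by apply: sumr_ge0 => r _; rewrite mulr_ge0// divr_ge0// ltW. Qed.

Lemma measurable_near_weight (dX : measure_display) (X : measurableType dX) (f : X -> 'M[K]_d) :
  mkmeas a f -> measurable_fun setT (fun x => near_weight (f x)).
Proof.
move=> mf; apply: measurable_sum => r; apply: measurable_funM => //.
by apply: measurable_natr; exact: measurable_near.
Qed.

Hypothesis tw : forall B, near_weight B <= 2%:R^-1.

(** The integrand is [1 - T] plus [3 T] on the event where [b] fails. The mean of [T] is [N t], and
    on the failure event only directions in [Z] contribute, with total mean at most [k t]. *)
Lemma near_weight_mean (b : SeqE a d -> bool) (Z : pred 'I_N) (k : nat) :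
  measurable_fun setT b -> (#|Z| <= k)%N ->
  (forall x r, near (dl r) (A r) (prodn M x) -> ~~ Z r -> b x) ->
  (Ex mu (fun x => (if b x then 1 - near_weight (prodn M x) else 1 + 2%:R * near_weight (prodn M x))%R)
    <= (1 + 3%:R * (k%:R * t) - N%:R * t)%:E)%E.
Proof.
move=> mb Zk hZ.
have mS : mkmeas a (fun x : SeqE a d => prodn M x).
  exact: (mkmeas_prodn lf M (@measurable_id _ (SeqE a d) setT)).
have mW : measurable_fun setT (fun x : SeqE a d => near_weight (prodn M x)).
  exact: measurable_near_weight.
pose F r (x : SeqE a d) : R := t / p r * (near (dl r) (A r) (prodn M x))%:R.
have F0 r x : 0 <= F r x by rewrite mulr_ge0// divr_ge0// ltW.
have mN r : measurable_fun setT (fun x : SeqE a d => (near (dl r) (A r) (prodn M x))%:R : R).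
  by apply: measurable_natr; exact: measurable_near.
have mF r : measurable_fun setT (F r) by apply: measurable_funM.
have EF r : Ex mu (F r) = t%:E.
  rewrite ExZ//; last by rewrite divr_ge0// ltW.
  have -> : Ex mu (fun x : SeqE a d => (near (dl r) (A r) (prodn M x))%:R%R) = (p r)%:E.
    rewrite pE -Ex_indic; last exact: measurable_near_prodn.
    by congr (Ex mu _); apply/funext => x; rewrite indicE mem_setE.
  by rewrite -EFinM divfK// gt_eqF.
have TF x : near_weight (prodn M x) = \sum_r F r x by [].
set W := fun x => _.
have mWt : measurable_fun setT W.
  by apply: measurable_fun_ifT => //; [apply: measurable_funB|apply: measurable_funD => //; apply: measurable_funM].
have W0 x : 0 <= W x.
  by have := tw (prodn M x); have := near_weight_ge0 (prodn M x); rewrite /W; case: ifP => _; lra.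
have mSF : measurable_fun setT (fun x => \sum_r F r x) by exact: measurable_sum.
have h : (Ex mu W + (N%:R * t)%:E <= (1 + 3%:R * (k%:R * t))%:E)%E.
  have -> : (N%:R * t)%:E = Ex mu (fun x => \sum_r F r x).
    rewrite Ex_sum//; under eq_bigr do rewrite EF.
    by rewrite sumEFin sumr_const card_ord mulr_natl.
  rewrite -ExD//; last by move=> x; exact: sumr_ge0.
  apply: (@le_trans _ _ (Ex mu (fun x => (1 + 3%:R * \sum_r (Z r)%:R * F r x)%R))).
    apply: Ex_le.
    - by apply: measurable_funD => //; exact: mW.
    - apply: measurable_funD => //; apply: measurable_funM => //.
      by apply: measurable_sum => r; exact: measurable_funM.
    - by move=> x; rewrite addr_ge0// sumr_ge0.
    move=> x; have ZF0 : 0 <= \sum_r (Z r)%:R * F r x by apply: sumr_ge0 => r _; rewrite mulr_ge0.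
    rewrite /W TF; case: ifPn => bx; first lra.
    suff -> : \sum_r F r x = \sum_r (Z r)%:R * F r x by lra.
    apply: eq_bigr => r _; have [_|/= nZ] := boolP (Z r); first by rewrite mul1r.
    rewrite mul0r /F; case: (boolP (near _ _ _)) => [hn|]; last by rewrite mulr0.
    by rewrite (hZ x r hn nZ) in bx.
  rewrite ExD//; last 2 first.
  - by apply: measurable_funM => //; apply: measurable_sum => r; exact: measurable_funM.
  - by move=> x; rewrite mulr_ge0// sumr_ge0// => r _; rewrite mulr_ge0.
  rewrite Ex_cst ExZ//; last 2 first.
  - by apply: measurable_sum => r; exact: measurable_funM.
  - by move=> x; rewrite sumr_ge0// => r _; rewrite mulr_ge0.
  rewrite Ex_sum//; last 2 first.
  - by move=> r; exact: measurable_funM.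
  - by move=> r x; rewrite mulr_ge0.
  under eq_bigr do rewrite ExZ// EF -EFinM.
  rewrite sumEFin -mulr_suml -natr_sum -EFinM -EFinD lee_fin lerD2l ler_pM2l//.
  apply: ler_wpM2r => //; rewrite ler_nat; apply: leq_trans Zk.
  by rewrite -sum1_card [X in (_ <= X)%N]big_mkcond; apply: leq_sum => r _; rewrite unfold_in; case: (Z r).
by rewrite EFinB leeBrDr.
Qed.

End WeightMean.

(** Together with [moves_forms], the form in which strong irreducibility is used: a single
    accessible matrix takes the place of an event of positive probability. *)
Definition moves_vectors : Prop := forall (fs : seq 'rV[K]_d) (v : 'cV[K]_d),
  (forall f, f \in fs -> f != 0) -> v != 0 ->
  exists2 A, acc A & forall f, f \in fs -> f *m A *m v != 0.

Definition moves_forms : Prop := forall (f : 'rV[K]_d) (vs : seq 'cV[K]_d),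
  f != 0 -> (forall v, v \in vs -> v != 0) ->
  exists2 B, acc B & forall v, v \in vs -> f *m B *m v != 0.

Lemma outer_neq0 (u : 'cV[K]_d) (f : 'rV[K]_d) : (u *m f != 0) = (u != 0) && (f != 0).
Proof. by rewrite -(mn_eq0 aP (u *m f)) mn_outer// mulf_eq0 !(mn_eq0 aP) negb_or. Qed.

(** The vectors are images [A u] and the forms are [f B] with [A], [B] accessible, so that the new
    rank-one matrices are products [A (u f) B] and accessible too. The vectors are chosen first, and
    the forms are then chosen not to kill any of them. The vector [w1] only serves to keep the
    [us i] nonzero. *)
Lemma frame_exists N (u : 'cV[K]_d) (f : 'rV[K]_d) :
  moves_vectors -> moves_forms -> u *m f != 0 -> acc (u *m f) ->
  exists (us : 'I_N -> 'cV[K]_d) (fs : 'I_N -> 'rV[K]_d),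
  [/\ forall i, acc (us i *m fs i), forall i j, fs i *m us j != 0,
      forall w : 'cV[K]_d, w != 0 -> (#|[pred i | ((us i)^T *m w == 0)%R]| < d)%N &
      forall w : 'cV[K]_d, w != 0 -> (#|[pred i | (fs i *m w == 0)%R]| < d)%N].
Proof.
move=> HA HB uf0 accuf; have := uf0; rewrite outer_neq0 => /andP[u0 f0].
have Su : ample [set s | exists2 A, acc A & s = (A *m u)^T].
  move=> ws ws0; have [|A accA hA] := HA [seq w^T | w <- ws] u _ u0.
    by move=> _ /mapP[w ww ->]; rewrite trmx_eq0 ws0.
  exists (A *m u)^T; first by exists A.
  move=> w ww; have := hA w^T (map_f _ ww); rewrite -mulmxA.
  by rewrite -{1}[A *m u]trmxK -trmx_mul trmx_eq0.
pose w1 : 'cV[K]_d := delta_mx (Ordinal d0) ord0.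
have w10 : w1 != 0.
  by apply/eqP => /matrixP/(_ (Ordinal d0) ord0); rewrite !mxE !eqxx => /eqP; rewrite oner_eq0.
have [us [hus us1 gpu]] : exists s : 'I_N -> 'rV[K]_d, [/\ forall i, exists2 A, acc A & s i = (A *m u)^T,
    forall i, s i *m w1 != 0 &
    forall w : 'cV[K]_d, w != 0 -> (#|[pred i | (s i *m w == 0)%R]| < d)%N].
  have [|us [hus us1 gpu]] := general_position (L := [:: w1]) N Su.
    by move=> w; rewrite inE => /eqP ->.
  by exists us; split=> // i; apply: us1; rewrite inE.
have us0 i : us i != 0 by apply: contra_neq (us1 i) => ->; rewrite mul0mx.
have Sf : ample [set s | exists2 B, acc B & s = f *m B].
  move=> ws ws0; have [B accB hB] := HB f ws f0 ws0.
  by exists (f *m B) => //; exists B.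
have [|fs [hfs fsu gpf]] := general_position (L := [seq (us i)^T | i : 'I_N]) N Sf.
  by move=> w /fintype.imageP[i _ ->]; rewrite trmx_eq0.
exists (fun i => (us i)^T), fs; split=> //.
- move=> i; have [A accA Eu] := hus i; have [B accB Ef] := hfs i.
  have uf : (us i)^T *m fs i != 0.
    rewrite outer_neq0 trmx_eq0 us0 /=.
    have := fsu i (us i)^T; have -> : (us i)^T \in [seq (us i)^T | i : 'I_N] by apply/fintype.imageP; exists i.
    by move=> /(_ isT); apply: contra_neq => ->; rewrite mul0mx.
  move: uf; rewrite Eu trmxK Ef mulmxA -(mulmxA A) => uf.
  have uf' : A *m (u *m f) != 0 by apply: contra_neq uf => ->; rewrite mul0mx.
  by apply: accessibleM => //; exact: accessibleM.
- by move=> i j; apply: fsu; apply/fintype.imageP; exists j.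
- move=> w w0; rewrite (@eq_card _ _ [pred i | us i *m w == 0]) ?gpu// => i.
  by rewrite !inE trmxK.
Qed.

(* All cyclic rotations of a product of [N = 7 d] accessible rank-one matrices [u_i f_i] are
   words of the same length [M], and the [r]-th one is proportional to [u_r f_(r-1)]. In general
   position at most [2 d] of these directions can be badly aligned with given matrices, so the
   weights have mean at most [1 + 3 (2 d) t - 7 d t = 1 - d t]. *)
Lemma schottky_exists (u0 : 'cV[K]_d) (f0 : 'rV[K]_d) :
  moves_vectors -> moves_forms -> u0 *m f0 != 0 -> acc (u0 *m f0) ->
  exists2 e : R, 0 < e & forall tau : R, 0 < tau ->
    exists M T theta, schottky mu M T e theta tau.
Proof.
move=> HA HB uf0 accuf.
have [n' hN] : exists n', (7 * d = n'.+1)%N by exists (7 * d).-1; rewrite prednK// muln_gt0.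
set N := n'.+1 in hN.
have [u [f [accR fu gpu gpf]]] := frame_exists N HA HB uf0 accuf.
have [e1 e1p he1] := general_position_bound lf gpu.
have [e2 e2p he2] := general_position_bound lf gpf.
pose k := Num.min e1 e2.
have k0 : 0 < k by rewrite lt_min e1p.
pose U := 1 + \sum_i mn (u i) + \sum_i mn (f i).
have su0 : 0 <= \sum_i mn (u i) by apply: sumr_ge0 => i _; exact: mn_ge0.
have sf0 : 0 <= \sum_i mn (f i) by apply: sumr_ge0 => i _; exact: mn_ge0.
have uU i : mn (u i) <= U.
  rewrite /U (bigD1 i)//=; have : 0 <= \sum_(j | j != i) mn (u j) by apply: sumr_ge0 => j _; exact: mn_ge0.
  lra.
have fU i : mn (f i) <= U.
  rewrite /U [X in _ <= _ + X](bigD1 i)//=.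
  have : 0 <= \sum_(j | j != i) mn (f j) by apply: sumr_ge0 => j _; exact: mn_ge0.
  lra.
have U0 : 0 < U by rewrite /U; lra.
have D1 : 1 <= D by rewrite ler1n.
have D0 : 0 < D by lra.
exists (k / (4%:R * U)); first by rewrite divr_gt0// mulr_gt0.
move=> tau tau0; set e := k / (4%:R * U).
(* The first term keeps blocks away from the identity, the second gives the alignment with constant
   [e], the third the gap [tau]. *)
pose e0 := Num.min 20%:R^-1 (Num.min (k / (4%:R * U * D)) (tau / 10%:R)).
have e0p : 0 < e0.
  rewrite !lt_min invr_gt0 ltr0n /=; apply/andP; split; apply: divr_gt0 => //.
  by do 2?[apply: mulr_gt0 => //].
have e01 : e0 <= 20%:R^-1 by rewrite ge_min lexx.
have e02 : e0 * (4%:R * U * D) <= k.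
  by rewrite -ler_pdivlMr ?mulr_gt0// ge_min orbC ge_min lexx.
have e03 : 10%:R * e0 <= tau.
  by rewrite mulrC -ler_pdivlMr// ge_min orbC ge_min lexx orbT.
pose u' i := u (inZp i); pose f' i := f (inZp i).
pose Q i := u' i *m f' i.
pose prd (r : 'I_N) : 'I_N := ord_pred r.
pose uf r := u r *m f (prd r).
have Q0 i j : u i *m f j != 0.
  rewrite outer_neq0; apply/andP; split.
    by apply: contra_neq (fu i i) => ->; rewrite mulmx0.
  by apply: contra_neq (fu j j) => ->; rewrite mul0mx.
have chain_neq0 r m : chain Q r m != 0.
  case: m => [|m].
    apply/eqP => /matrixP/(_ (Ordinal d0) (Ordinal d0)); rewrite !mxE eqxx => /eqP.
    by rewrite oner_eq0.
  have [|c c0 ->] := chain_outer (u := u') (f := f') r m; first by move=> i j; exact: fu.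
  by rewrite scaler_eq0 negb_or c0 Q0.
have rotE (r : 'I_N) : exists2 c, c != 0 & chain Q r N = c *: uf r.
  have [|c c0 hc] := chain_outer (u := u') (f := f') r n'; first by move=> i j; exact: fu.
  exists c => //; rewrite -[chain Q r N]/(chain (fun i => u' i *m f' i) r n'.+1) hc /u' /f' /uf.
  congr (_ *: (u _ *m f _)); apply: val_inj => /=; first by rewrite modn_small.
  by rewrite addnS.
pose dl (r : 'I_N) := e0 * mn (chain Q r N).
have dl0 r : 0 < dl r by rewrite mulr_gt0// (mn_gt0 aP).
have nearE' r B : near (dl r) (chain Q r N) B = near (e0 * mn (uf r)) (uf r) B.
  by have [c c0 E] := rotE r; rewrite /dl E near_scale.
have /choice[dl' hdl'] : forall r : 'I_N, exists x : R, 0 < x /\ forall n : nat -> nat,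
    (forall i, hits x (Q i) (n i)) -> hits (dl r) (chain Q r N) (\sum_(i < N) n (r + i)).
  move=> r; have [|x x0 hx] := hits_chain lf d0 mu_splice (Q := Q) (r := r) (k := N) _ (dl0 r).
    by move=> *; exact: chain_neq0.
  by exists x.
have [dlm dlm0 hdlm] := positive_lower_bound (fun r => proj1 (hdl' r)).
have /choice[n0 hn0] : forall i : 'I_N, exists n, hits dlm (u i *m f i) n.
  by move=> i; have [_ h] := accR i; exact: h.
pose n i := n0 (inZp i).
pose M := (\sum_(i < N) n i)%N.
have hM r : hits (dl r) (chain Q r N) M.
  rewrite /M -(@sum_period n n' r); first by apply: (proj2 (hdl' r)) => i; apply: hits_le (hn0 _).
  by move=> i; congr n0; apply: val_inj; rewrite /= modnDr.
pose p r := fine (mu [set x | near (dl r) (chain Q r N) (prodn M x)]).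
have pE r : (p r)%:E = mu [set x | near (dl r) (chain Q r N) (prodn M x)].
  by rewrite fineK// fin_num_measure//; exact: measurable_near_prodn.
have p0 r : 0 < p r by rewrite -lte_fin pE; exact: hM.
have p1 r : p r <= 1 by rewrite -lee_fin pE; apply: probability_le1; exact: measurable_near_prodn.
have [pm pm0 hpm] := positive_lower_bound p0.
have N0 : (0 : R) < N%:R by rewrite ltr0n.
(* Makes each of the [N] terms of [T] at most [1 / (2 N)], hence [T <= 1/2]. *)
pose t := pm / (2%:R * N%:R).
have t0 : 0 < t by rewrite divr_gt0// mulr_gt0.
have tN : 2%:R * (N%:R * t) <= 1.
  have -> : 2%:R * (N%:R * t) = pm by rewrite /t; field; rewrite gt_eqF.
  by apply: le_trans (hpm ord0) (p1 _).
have NE : N%:R = 7%:R * D :> R by rewrite -hN natrM.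
pose T := near_weight (fun r => chain Q r N) dl p t.
have tp0 r : 0 <= t / p r by rewrite divr_ge0 ?ltW.
have T0 B : 0 <= T B by apply: near_weight_ge0 => //; exact: ltW.
have T1 B : T B <= 2%:R^-1.
  apply: (@le_trans _ _ (\sum_(r < N) (2%:R * N%:R)^-1)).
    apply: ler_sum => r _; apply: (@le_trans _ _ (t / p r)).
      by rewrite ler_piMr//; case: (near _ _ _).
    rewrite ler_pdivrMr// /t [X in X <= _]mulrC ler_pM2l ?hpm//.
    by rewrite invr_gt0 mulr_gt0.
  by rewrite sumr_const card_ord -[X in X <= _]mulr_natl invfM mulrCA divff ?mulr1// gt_eqF.
have T2 B : 0 < T B -> exists r, near (e0 * mn (uf r)) (uf r) B.
  move=> TB; apply: contrapT => h; move: TB; rewrite /T /near_weight big1 ?ltxx// => r _.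
  rewrite nearE'; case: (boolP (near _ _ _)) => [hr|]; last by rewrite mulr0.
  by case: h; exists r.
have gap B r : near (e0 * mn (uf r)) (uf r) B -> mx2 B B <= 10%:R * e0 * mn B ^+ 2.
  have e011 : e0 <= 1 by lra.
  by apply: (near_outer_gap aP) => //; exact: Q0.
have e0h : e0 <= 2%:R^-1 by lra.
have thetaE : 1 + 3%:R * ((2 * d)%:R * t) - N%:R * t = 1 - D * t.
  by rewrite NE natrM; ring.
have Dt0 : 0 < D * t by rewrite mulr_gt0.
have Dt1 : D * t < 1 by move: tN; rewrite NE; lra.
have mS : mkmeas a (fun x : SeqE a d => prodn M x).
  exact: (mkmeas_prodn lf M (@measurable_id _ (SeqE a d) setT)).
have mal (A C : SeqE a d -> 'M[K]_d) : mkmeas a A -> mkmeas a C ->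
    measurable_fun setT (fun x => e * (mn (A x) * mn (C x)) <= mn (A x *m C x)).
  by move=> mA mC; exact: measurable_align.
have row_bound (g : 'M[K]_d) : (#|[pred r | (mn (g *m u r) < k * mn g)%R]| <= d)%N.
  have [->|g0] := eqVneq g 0.
    rewrite eq_card0// => r; rewrite !inE mul0mx !(mn0 aP) mulr0 ltxx//.
  (* One row of [g] carrying the largest entry is enough: its pairings with the [u r] bound the
     norms of the [g *m u r] from below. *)
  have [i [j gij]] := mn_max aP g0.
  have rowE : mn (row i g)^T = mn g.
    apply/eqP; rewrite (mn_tr aP) eq_le; apply/andP; split.
      by apply: mn_le; rewrite ?mn_ge0// => i' j'; rewrite mxE mn_ub.
    by rewrite gij; have := mn_ub a (row i g) ord0 j; rewrite mxE.
  have := he1 (row i g)^T; rewrite -(mn_gt0 aP) rowE (mn_gt0 aP) => /(_ g0)/ltnW.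
  apply: leq_trans; apply: subset_leq_card; apply/fintype.subsetP => r; rewrite !inE => h.
  rewrite -trmx_mul (mn_tr aP); apply: le_lt_trans (_ : mn (g *m u r) < _).
    by rewrite -row_mul; apply: mn_le; rewrite ?mn_ge0// => i' j'; rewrite mxE mn_ub.
  by apply: lt_le_trans h _; rewrite ler_wpM2r ?mn_ge0// ge_min lexx.
have col_bound (h : 'M[K]_d) : (#|[pred r | (mn (f (prd r) *m h) < k * mn h)%R]| <= d)%N.
  have [->|h0] := eqVneq h 0.
    rewrite eq_card0// => r; rewrite !inE mulmx0 !(mn0 aP) mulr0 ltxx//.
  have [j hj] := mn_col_max aP h d0.
  have := he2 (col j h); rewrite -(mn_gt0 aP) hj (mn_gt0 aP) => /(_ h0)/ltnW.
  apply: leq_trans; rewrite -(fintype.card_image (can_inj (@ord_predK N))); apply: subset_leq_card.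
  apply/fintype.subsetP => _ /fintype.imageP[r + ->]; rewrite !inE => hr.
  rewrite colE mulmxA -colE; apply: le_lt_trans (mn_col aP _ _) _.
  by apply: lt_le_trans hr _; rewrite ler_wpM2r ?mn_ge0// ge_min lexx orbT.
exists M, T, (1 - D * t); split.
(* The identity is the only product of length 0, and a 2x2 minor equal to 1 keeps it away from rank
   one. *)
- rewrite lt0n; apply/eqP => M0.
  have := hM ord0; rewrite M0 => /hits_exists[x]; rewrite nearE' prodn0 => /gap h.
  have h1 : 1 <= mx2 (1%:M : 'M[K]_d) 1%:M.
    have := mx2_ub a (1%:M : 'M[K]_d) (1%:M : 'M[K]_d) (Ordinal d0) (Ordinal d2) (Ordinal d0) (Ordinal d2).
    by rewrite !mxE /= mulr1 mulr0 subr0 (av1 aP).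
  have h2 : mn (1%:M : 'M[K]_d) <= 1.
    by apply: mn_le => // i j; rewrite mxE; case: eqP => _; rewrite ?(av1 aP) ?(av0 aP).
  have h3 : mn (1%:M : 'M[K]_d) ^+ 2 <= 1 by rewrite exprn_ile1 ?mn_ge0.
  have h4 : 10%:R * e0 * mn (1%:M : 'M[K]_d) ^+ 2 <= 10%:R * e0 by rewrite ler_piMr// mulr_ge0// ltW.
  by have := le_trans h1 (le_trans h h4); rewrite leNgt => /negP[]; lra.
- by rewrite divr_gt0// mulr_gt0.
- by apply/andP; split; lra.
- split=> B; first by rewrite T0 T1.
  move=> /T2[r /gap]; move/le_trans; apply.
  by apply: ler_wpM2r => //; rewrite exprn_ge0// mn_ge0.
split.
- by move=> dX X g mg; apply: measurable_near_weight.
- move=> g; rewrite -thetaE; apply: (@near_weight_mean _ M (fun r => chain Q r N) dl p t _ _ _ _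
    (fun x => e * (mn g * mn (prodn M x)) <= mn (g *m prodn M x)) [pred r | mn (g *m u r) < k * mn g]) => //.
  + by rewrite ltW.
  + by apply: mal => //; exact: mkmeas_cst.
  + by apply: leq_trans (row_bound g) _; rewrite mul2n -addnn leq_addr.
  move=> x r; rewrite nearE' inE -leNgt => hn hr.
  by apply: (near_outer_left aP d0 (U := U) (k := k) _ _ _ _ _ _ hn hr) => //; exact: Q0.
- move=> h1 h2; rewrite -thetaE; apply: (@near_weight_mean _ M (fun r => chain Q r N) dl p t _ _ _ _
    (fun x => (e * (mn (prodn M x) * mn h1) <= mn (prodn M x *m h1)) && 
       (e * (mn (prodn M x) * mn h2) <= mn (prodn M x *m h2)))
    [pred r | (mn (f (prd r) *m h1) < k * mn h1) || (mn (f (prd r) *m h2) < k * mn h2)]) => //.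
  + by rewrite ltW.
  + by apply: measurable_and; apply: mal => //; exact: mkmeas_cst.
  + apply: leq_trans (_ : _ <= #|[pred r | (mn (f (prd r) *m h1) < k * mn h1)%R]| +
      #|[pred r | (mn (f (prd r) *m h2) < k * mn h2)%R]|)%N _.
      rewrite -cardUI; apply: leq_trans (leq_addr _ _); apply: subset_leq_card.
      by apply/fintype.subsetP => r; rewrite !inE.
    by rewrite mul2n -addnn leq_add.
  move=> x r; rewrite nearE' inE negb_or -!leNgt => hn /andP[hr1 hr2].
  apply/andP; split; [move: hr1|move: hr2] => hr.
    by apply: (near_outer_right (U := U) (k := k) _ _ _ _ _ _ hn hr) => //; exact: Q0.
  by apply: (near_outer_right (U := U) (k := k) _ _ _ _ _ _ hn hr) => //; exact: Q0.
Qed.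

End Schottky.

(** * Norms, spectral radii and proximality *)

Section NormComparison.
Variables (R : realType) (K : fieldType) (a : K -> R) (d : nat).
Hypothesis aP : nneg_absval a.
Notation mn := (mn a).
Notation mx2 := (mx2 a).
Notation vnorm := (vnorm a).
Notation w2norm := (w2norm a).
Notation opnorm := (opnorm a).
Notation opnorm2 := (opnorm2 a).
Notation D := (d%:R : R).

Lemma sqrt_ge (x S : R) : 0 <= x -> x ^+ 2 <= S -> x <= Num.sqrt S.
Proof. by move=> x0 h; rewrite -(ger0_norm x0) -sqrtr_sqr ler_wsqrtr. Qed.

Lemma sqrt_le (x S : R) : 0 <= x -> S <= x ^+ 2 -> Num.sqrt S <= x.
Proof. by move=> x0 h; rewrite -[leRHS](ger0_norm x0) -sqrtr_sqr ler_wsqrtr. Qed.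

Lemma vnorm_lb (x : 'cV[K]_d) : mn x <= vnorm x.
Proof.
rewrite /Defs.vnorm; case: ifPn => _.
  apply: mn_le => [|i j]; first by elim/big_ind: _ => // [u v h _|i _]; [rewrite le_max h|exact: av_ge0].
  by rewrite (ord1 j); exact: (le_bigmax _ (fun i => a (x i ord0)) i).
apply: mn_le => [|i j]; first exact: sqrtr_ge0.
rewrite (ord1 j); apply: sqrt_ge; first exact: av_ge0.
by rewrite (bigD1 i)//= lerDl sumr_ge0// => k _; rewrite exprn_ge0// av_ge0.
Qed.

Lemma vnorm_ub (x : 'cV[K]_d) : vnorm x <= D * mn x.
Proof.
rewrite /Defs.vnorm; case: ifPn => _.
  apply: bigmax_le => [|i _]; first by rewrite mulr_ge0 ?(mn_ge0 aP).
  have d1 : 1 <= D by rewrite ler1n; case: i => i /(leq_ltn_trans (leq0n i)).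
  by apply: le_trans (mn_ub a x i ord0) _; rewrite ler_peMl ?(mn_ge0 aP).
have M0 := mn_ge0 aP x; apply: sqrt_le; first by rewrite mulr_ge0.
apply: (@le_trans _ _ (\sum_(i < d) mn x ^+ 2)).
  by apply: ler_sum => i _; rewrite lerXn2r ?nnegrE ?(av_ge0 aP)// mn_ub.
rewrite sumr_const card_ord -[leLHS]mulr_natl exprMn; apply: ler_wpM2r; first exact: exprn_ge0.
by rewrite -natrX ler_nat; case: (d) => // n; rewrite leq_pmull.
Qed.

Lemma vnorm_ge0 (x : 'cV[K]_d) : 0 <= vnorm x.
Proof. by apply: le_trans (vnorm_lb x); exact: mn_ge0. Qed.

Lemma vnorm_gt0 (x : 'cV[K]_d) : x != 0 -> 0 < vnorm x.
Proof. by rewrite -(mn_gt0 aP) => /lt_le_trans; apply; exact: vnorm_lb. Qed.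

Lemma w2norm_ge0 (w : 'M[K]_d) : 0 <= w2norm w.
Proof.
rewrite /Defs.w2norm; case: ifPn => _; last exact: sqrtr_ge0.
elim/big_ind: _ => // [u v h _|i _]; first by rewrite le_max h.
by elim/big_ind: _ => // [u v h _|j _]; [rewrite le_max h|exact: av_ge0].
Qed.

Lemma w2norm_lb (w : 'M[K]_d) (i j : 'I_d) : (i < j)%N -> a (w i j) <= w2norm w.
Proof.
move=> ij; rewrite /Defs.w2norm; case: ifPn => _.
  apply: le_trans (_ : \big[Num.max/0]_(j < d | (i < j)%N) a (w i j) <= _).
    exact: (le_bigmax_cond _ (fun j => a (w i j)) ij).
  exact: (le_bigmax _ (fun i : 'I_d => \big[Num.max/0]_(j < d | (i < j)%N) a (w i j)) i).
apply: sqrt_ge; first exact: av_ge0.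
have s0 (Q : pred 'I_d) k : 0 <= \sum_(l | Q l) a (w k l) ^+ 2.
  by apply: sumr_ge0 => l _; rewrite exprn_ge0// av_ge0.
rewrite (bigD1 i)//= (bigD1 j)//= -addrA lerDl; apply: addr_ge0; first exact: s0.
by apply: sumr_ge0 => k _; exact: s0.
Qed.

Lemma w2norm_ub (w : 'M[K]_d) (M : R) : 0 <= M -> (forall i j, a (w i j) <= M) -> w2norm w <= D * M.
Proof.
move=> M0 h; rewrite /Defs.w2norm; case: ifPn => _.
  have h' (i : 'I_d) : M <= D * M.
    by rewrite ler_peMl// ler1n; case: i => i /(leq_ltn_trans (leq0n i)).
  apply: bigmax_le => [|i _]; first by rewrite mulr_ge0.
  apply: bigmax_le => [|j _]; first by rewrite mulr_ge0.
  exact: le_trans (h i j) (h' i).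
apply: sqrt_le; first by rewrite mulr_ge0.
apply: (@le_trans _ _ (\sum_(i < d) \sum_(j < d) M ^+ 2)).
  apply: ler_sum => i _; rewrite big_mkcond; apply: ler_sum => j _; case: ifP => _.
    by rewrite lerXn2r ?nnegrE ?(av_ge0 aP).
  exact: exprn_ge0.
by rewrite !sumr_const card_ord -!mulrnA -[leLHS]mulr_natl natrM exprMn expr2.
Qed.

Lemma wedge_lb (x y : 'cV[K]_d) : mx2 x y <= w2norm (wedge x y).
Proof.
apply: mx2_le => [|i i' j j']; first exact: w2norm_ge0.
rewrite (ord1 j) (ord1 j'); have [ii'|ii'|/val_inj ->] := ltngtP i i'.
- by have := w2norm_lb (wedge x y) ii'; rewrite mxE.
- by have := w2norm_lb (wedge x y) ii'; rewrite mxE avBC.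
- by rewrite subrr (av0 aP) w2norm_ge0.
Qed.

Lemma wedge_ub (x y : 'cV[K]_d) : w2norm (wedge x y) <= D * mx2 x y.
Proof.
apply: w2norm_ub => [|i j]; first exact: mx2_ge0.
by rewrite mxE mx2_ub.
Qed.

Hypothesis d2 : (2 <= d)%N.
Let d0 : (0 < d)%N. Proof. exact: ltnW. Qed.
Let D0 : 0 < D. Proof. by rewrite ltr0n. Qed.
Let i0 : 'I_d := Ordinal d0.

Let opset (h : 'M[K]_d) := [set vnorm (h *m x) / vnorm x | x in [set x : 'cV[K]_d | x != 0]].

Let opset_ub h : ubound (opset h) (D ^+ 2 * mn h).
Proof.
move=> _ [x /= x0 <-]; rewrite ler_pdivrMr ?vnorm_gt0//.
apply: le_trans (vnorm_ub _) _; rewrite expr2 -!mulrA ler_pM2l//.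
apply: le_trans (mnM aP _ _) _; rewrite ler_pM2l//; apply: ler_wpM2l; first exact: mn_ge0.
exact: vnorm_lb.
Qed.

Lemma delta_neq0 (i : 'I_d) : (delta_mx i ord0 : 'cV[K]_d) != 0.
Proof. by apply/eqP => /matrixP/(_ i ord0); rewrite !mxE !eqxx => /eqP; rewrite oner_eq0. Qed.

Let opset0 h : opset h !=set0.
Proof.
exists (vnorm (h *m delta_mx i0 ord0) / vnorm (delta_mx i0 ord0)).
by exists (delta_mx i0 ord0) => //=; exact: delta_neq0.
Qed.

Lemma opnorm_ub (h : 'M[K]_d) : opnorm h <= D ^+ 2 * mn h.
Proof. by apply: ge_sup; [exact: opset0|exact: opset_ub]. Qed.

Lemma vnorm_opnorm (h : 'M[K]_d) (x : 'cV[K]_d) : vnorm (h *m x) <= opnorm h * vnorm x.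
Proof.
have [->|x0] := eqVneq x 0.
  have -> : vnorm (0 : 'cV[K]_d) = 0.
    apply/eqP; rewrite eq_le vnorm_ge0 andbT; apply: le_trans (vnorm_ub _) _.
    by rewrite (mn0 aP) mulr0.
  by apply: le_trans (vnorm_ub _) _; rewrite mulmx0 (mn0 aP) !mulr0.
rewrite -ler_pdivrMr ?vnorm_gt0//; apply: ub_le_sup; last by exists x.
by exists (D ^+ 2 * mn h); exact: opset_ub.
Qed.

Lemma opnorm_ge0 (h : 'M[K]_d) : 0 <= opnorm h.
Proof.
have := vnorm_opnorm h (delta_mx i0 ord0); rewrite -ler_pdivrMr; last exact/vnorm_gt0/delta_neq0.
by apply: le_trans; rewrite divr_ge0// vnorm_ge0.
Qed.

Lemma opnorm_lb (h : 'M[K]_d) : mn h <= D * opnorm h.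
Proof.
apply: mn_le => [|i j]; first by rewrite mulr_ge0// ?opnorm_ge0// ltW.
have h1 : a (h i j) <= vnorm (h *m delta_mx j ord0).
  by apply: le_trans (vnorm_lb _); rewrite -colE; apply: le_trans (mn_ub a _ i ord0); rewrite mxE.
apply: le_trans h1 _; apply: le_trans (vnorm_opnorm _ _) _; rewrite mulrC.
apply: ler_wpM2r; first exact: opnorm_ge0.
apply: le_trans (vnorm_ub _) _; rewrite -[leRHS]mulr1; apply: ler_wpM2l; first exact: ltW.
apply: mn_le => // k l; rewrite mxE; case: (_ && _); rewrite ?(av1 aP) ?(av0 aP)//.
Qed.

Let op2set (h : 'M[K]_d) := [set w2norm (wedge2 h w) / w2norm w
      | w in [set w : 'M[K]_d | w2norm w != 0]].

Lemma w2norm_wedge2 (h w : 'M[K]_d) : w2norm (wedge2 h w) <= D ^+ 3 * mx2 h h * w2norm w.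
Proof.
have M0 : 0 <= mx2 h h := mx2_ge0 aP h h; have W0 := w2norm_ge0 w.
have -> : D ^+ 3 * mx2 h h * w2norm w = D * (D * (D * (w2norm w * mx2 h h))) by ring.
have p0 : 0 <= D * (w2norm w * mx2 h h) by rewrite !mulr_ge0.
apply: w2norm_ub => [|k l]; first by rewrite mulr_ge0.
rewrite mxE; apply: av_sum_le => // i.
apply: le_trans (av_sum aP _ _ _) _; rewrite big_mkcond /=.
apply: (@le_trans _ _ (\sum_(j < d) w2norm w * mx2 h h)).
  apply: ler_sum => j _; case: ifP => ij; last by rewrite mulr_ge0.
  rewrite (avM aP); apply: ler_pM; rewrite ?(av_ge0 aP)//; first exact: w2norm_lb.
  by have := mx2_ub a h h k l i j.
by rewrite sumr_const card_ord -[leLHS]mulr_natl.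
Qed.

Let op2set_ub h : ubound (op2set h) (D ^+ 3 * mx2 h h).
Proof.
move=> _ [w /= w0 <-]; rewrite ler_pdivrMr; last by rewrite lt_def w0 w2norm_ge0.
exact: w2norm_wedge2.
Qed.

Lemma delta_w2norm (i j : 'I_d) : (i < j)%N -> 1 <= w2norm (delta_mx i j : 'M[K]_d) <= D.
Proof.
move=> ij; apply/andP; split.
  by have := w2norm_lb (delta_mx i j : 'M[K]_d) ij; rewrite mxE !eqxx (av1 aP).
rewrite -[leRHS]mulr1; apply: w2norm_ub => // k l.
by rewrite mxE; case: (_ && _); rewrite ?(av1 aP) ?(av0 aP).
Qed.

Let delta_w2 (i j : 'I_d) : (i < j)%N -> w2norm (delta_mx i j : 'M[K]_d) != 0.
Proof. by move/delta_w2norm => /andP[h _]; rewrite gt_eqF// (lt_le_trans _ h). Qed.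

Lemma opnorm2_ub (h : 'M[K]_d) : opnorm2 h <= D ^+ 3 * mx2 h h.
Proof.
apply: ge_sup; last exact: op2set_ub.
have w0 := delta_w2 (isT : (Ordinal d0 < Ordinal d2)%N).
by eexists; eexists; first exact: w0.
Qed.

(** Tested on the basis bivectors, whose images have the minors of two columns of [h] as
    coordinates. The factor [D] bounds the norm of a basis bivector in both cases of [w2norm]. *)
Lemma opnorm2_lb (h : 'M[K]_d) : mx2 h h <= D * opnorm2 h.
Proof.
have key (i j : 'I_d) : (i < j)%N -> forall k l,
    a (h k i * h l j - h l i * h k j) <= D * opnorm2 h.
  move=> ij.
  have h2 : w2norm (wedge2 h (delta_mx i j)) <= D * opnorm2 h.
    have h3 : w2norm (wedge2 h (delta_mx i j)) / w2norm (delta_mx i j) <= opnorm2 h.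
      apply: ub_le_sup; first by exists (D ^+ 3 * mx2 h h); exact: op2set_ub.
      by exists (delta_mx i j) => //=; exact: delta_w2.
    have /andP[g1 g2] := delta_w2norm ij; have g0 : 0 < w2norm (delta_mx i j) by exact: lt_le_trans g1.
    rewrite ler_pdivrMr// in h3; apply: le_trans h3 _; rewrite mulrC; apply: ler_wpM2r => //.
    rewrite /Defs.opnorm2; apply: le_trans (ub_le_sup
      (x := w2norm (wedge2 h (delta_mx i j)) / w2norm (delta_mx i j)) _ _).
    - by rewrite divr_ge0// w2norm_ge0.
    - by exists (D ^+ 3 * mx2 h h); exact: op2set_ub.
    - by exists (delta_mx i j) => //=; exact: delta_w2.
  have wE k l : wedge2 h (delta_mx i j) k l = h k i * h l j - h l i * h k j.
    rewrite mxE (bigD1 i)//= (bigD1 j)//= !mxE !eqxx mul1r !big1 ?addr0//.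
      by move=> i' i'i; rewrite big1// => j' _; rewrite mxE (negbTE i'i) mul0r.
    by move=> j' /andP[_ /negbTE j'j]; rewrite mxE j'j andbF mul0r.
  move=> k l; rewrite -wE; have [kl|kl|/val_inj ->] := ltngtP k l.
  - exact: le_trans (w2norm_lb _ kl) h2.
  - by apply: le_trans h2; apply: le_trans (w2norm_lb _ kl); rewrite !wE avBC.
  - by rewrite wE subrr (av0 aP); apply: le_trans h2; exact: w2norm_ge0.
apply: mx2_le => [|k l i j].
  have := key _ _ (isT : (Ordinal d0 < Ordinal d2)%N) i0 i0; apply: le_trans; exact: av_ge0.
have [ij|ij|/val_inj ->] := ltngtP i j.
- exact: key.
- by have := key _ _ ij l k; rewrite mulrC [X in _ - X]mulrC.
- rewrite mulrC subrr (av0 aP); have := key _ _ (isT : (Ordinal d0 < Ordinal d2)%N) i0 i0.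
  by apply: le_trans; exact: av_ge0.
Qed.

End NormComparison.

(** * Spectral radii as limits of roots of submultiplicative sequences *)

Lemma root1_cvg (R : realType) (B : R) : 0 < B -> (fun n => B `^ n.+1%:R^-1) @ \oo --> (1 : R).
Proof.
move=> B0; rewrite (_ : (fun n => _) = (fun n => expR (harmonic n * ln B))); last first.
  by apply/funext => n; rewrite /powR gt_eqF.
rewrite -expR0 -(mul0r (ln B)); apply: continuous_cvg; first exact: continuous_expR.
by apply: cvgMl; exact: cvg_harmonic.
Qed.

Section Submultiplicative.
Variables (R : realType) (b : nat -> R).
Hypothesis b0 : forall n, 0 <= b n.
Hypothesis bM : forall m n, b (m + n) <= b m * b n.

Let rootK n (x : R) : 0 <= x -> (x `^ n.+1%:R^-1) ^+ n.+1 = x.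
Proof.
by move=> x0; rewrite -powR_mulrn ?powR_ge0// -powRrM mulVf ?powRr1// pnatr_eq0.
Qed.

(** Fekete's lemma in multiplicative form: [L] is the infimum of the roots. If [b m.+1 <= y ^+ m.+1]
    for one [m], splitting off pieces of that length gives the bound for all [n], the remainders
    being collected in [B]. *)
Lemma submult_rate : exists L : R, [/\ 0 <= L, forall n, L ^+ n.+1 <= b n.+1 &
  forall y, L < y -> exists2 B, 0 < B & forall n, b n <= B * y ^+ n].
Proof.
pose E := [set b n.+1 `^ n.+1%:R^-1 | n in [set: nat]].
have E0 : E !=set0 by exists (b 1 `^ 1%:R^-1), 0%N.
have lbE : lbound E 0 by move=> _ [n _ <-]; exact: powR_ge0.
have L0 : 0 <= inf E by exact: lb_le_inf.
exists (inf E); split=> // [n|y Ly].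
  rewrite -[leRHS](rootK n)//; apply: lerXn2r; rewrite ?nnegrE ?powR_ge0//.
  by apply: ge_inf; [exists 0|exists n].
have y0 : 0 < y by exact: le_lt_trans Ly.
have [_ [m _ <-] hm] := inf_lt E0 Ly.
have bm : b m.+1 <= y ^+ m.+1.
  by rewrite -[leLHS](rootK m)//; apply: lerXn2r; rewrite ?nnegrE ?powR_ge0// ltW.
pose B := 1 + \sum_(r < m.+1) b r / y ^+ r.
have t0 (r : nat) : 0 <= b r / y ^+ r by rewrite divr_ge0// exprn_ge0// ltW.
have B0 : 0 < B by rewrite ltr_pwDl// sumr_ge0.
exists B => // n; elim/ltn_ind: n => n IH; have [nm|mn] := ltnP n m.+1.
  rewrite -ler_pdivrMr ?exprn_gt0// /B (bigD1 (Ordinal nm))//= addrCA lerDl addr_ge0//.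
  by apply: sumr_ge0.
rewrite -(subnKC mn); apply: le_trans (bM _ _) _; rewrite exprD mulrCA.
apply: ler_pM => //; apply: IH; rewrite ltn_subrL ltn0Sn /=.
exact: leq_trans mn.
Qed.

(** Comparison constants disappear in the roots. This transfers the limits from the rescaled
    max-norms, submultiplicative and visibly measurable, to the operator norms defining [rho1] and
    [rho12]. *)
Lemma submult_root (L c C : R) (b' : nat -> R) : 0 < c -> 0 < C ->
  (forall n, c * b n <= b' n <= C * b n) -> 0 <= L -> (forall n, L ^+ n.+1 <= b n.+1) ->
  (forall y, L < y -> exists2 B, 0 < B & forall n, b n <= B * y ^+ n) ->
  (fun n => b' n.+1 `^ n.+1%:R^-1) @ \oo --> L.
Proof.
move=> c0 C0 bb' L0 lowL upL.
have rootX n (x : R) : 0 <= x -> (x ^+ n.+1) `^ n.+1%:R^-1 = x.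
  by move=> x0; rewrite -powR_mulrn// -powRrM divff ?powRr1// pnatr_eq0.
have b'0 n : 0 <= b' n.
  by case/andP: (bb' n) => + _; apply: le_trans; rewrite mulr_ge0// ltW.
apply/cvgrPdist_lt => e e0.
have [B B0 hB] := upL (L + e / 2%:R) ltac:(by rewrite ltrDl divr_gt0).
have h1 : (fun n => (C * B) `^ n.+1%:R^-1 * (L + e / 2%:R)) @ \oo --> L + e / 2%:R.
  by rewrite -[X in _ --> X]mul1r; apply: cvgMl; apply: root1_cvg; rewrite mulr_gt0.
have h2 : (fun n => c `^ n.+1%:R^-1 * L) @ \oo --> L.
  by rewrite -[X in _ --> X]mul1r; apply: cvgMl; exact: root1_cvg.
have g1 := cvgr_lt _ h1 (L + e) ltac:(rewrite ltrD2l; lra).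
have g2 := cvgr_gt _ h2 (L - e) ltac:(by rewrite gtrBl).
near=> n.
have k1 : (C * B) `^ n.+1%:R^-1 * (L + e / 2%:R) < L + e by near: n; exact: g1.
have k2 : L - e < c `^ n.+1%:R^-1 * L by near: n; exact: g2.
have y0 : 0 <= L + e / 2%:R by lra.
have CB0 : 0 <= C * B by rewrite ltW// mulr_gt0.
have c0' : 0 <= c by exact: ltW.
have /andP[m1 m2] := bb' n.+1.
have u1 : b' n.+1 `^ n.+1%:R^-1 <= (C * B) `^ n.+1%:R^-1 * (L + e / 2%:R).
  rewrite -[X in _ <= _ * X](rootX n _ y0) -powRM ?exprn_ge0//.
  apply: ge0_ler_powR; rewrite ?nnegrE ?invr_ge0//; first by rewrite mulr_ge0 ?exprn_ge0.
  by apply: le_trans m2 _; rewrite -mulrA ler_pM2l.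
have u2 : c `^ n.+1%:R^-1 * L <= b' n.+1 `^ n.+1%:R^-1.
  rewrite -[X in _ * X <= _](rootX n _ L0) -powRM ?exprn_ge0//.
  apply: ge0_ler_powR; rewrite ?nnegrE ?invr_ge0//; first by rewrite mulr_ge0 ?exprn_ge0.
  by apply: le_trans m1; rewrite ler_pM2l.
by rewrite ltr_norml; apply/andP; split; lra.
Unshelve. all: by end_near. Qed.

End Submultiplicative.

Section Spectral.
Variables (R : realType) (K : fieldType) (a : K -> R) (d : nat).
Hypothesis lf : local_field a.
Hypothesis d2 : (2 <= d)%N.
Let aP := local_field_nneg lf.
Let d0 : (0 < d)%N. Proof. exact: ltnW. Qed.
Notation mn := (mn a).
Notation mx2 := (mx2 a).
Notation D := (d%:R : R).
Implicit Types g : 'M[K]_d.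
Let D0 : 0 < D. Proof. by rewrite ltr0n. Qed.

Lemma mxpowD g m n : mxpow g (m + n) = mxpow g m *m mxpow g n.
Proof.
elim: m => [|m IH]; first by rewrite add0n mul1mx.
by rewrite -[LHS]/(g *m mxpow g (m + n)) IH mulmxA.
Qed.

Let bounded_root (b b' : nat -> R) c C : (forall n, 0 <= b n) ->
  (forall m n, b (m + n)%N <= b m * b n) -> 0 < c -> 0 < C -> (forall n, c * b n <= b' n <= C * b n) ->
  exists L : R, [/\ 0 <= L, forall n, L ^+ n.+1 <= b n.+1,
    forall y, L < y -> exists2 B, 0 < B & forall n, b n <= B * y ^+ n,
    (fun n => b' n.+1 `^ n.+1%:R^-1) @ \oo --> L & (fun n => b n.+1 `^ n.+1%:R^-1) @ \oo --> L].
Proof.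
move=> b0 bM c0 C0 bb'; have [L [L0 low up]] := submult_rate b0 bM.
exists L; split=> //; first exact: (submult_root b0 c0 C0).
by apply: (submult_root b0 (c := 1) (C := 1)) => // n; rewrite mul1r lexx.
Qed.

Lemma rho1_lim g : exists L : R, [/\ rho1 a g = L, 0 <= L,
  forall n, L ^+ n.+1 <= D * mn (mxpow g n.+1) &
  (fun n => (D * mn (mxpow g n.+1)) `^ n.+1%:R^-1) @ \oo --> L].
Proof.
have [|||||L [L0 low up cv cv']] := @bounded_root (fun n => D * mn (mxpow g n))
    (fun n => opnorm a (mxpow g n)) (D ^+ 2)^-1 D.
- by move=> n; rewrite mulr_ge0 ?mn_ge0.
- move=> m n; rewrite mxpowD -mulrA ler_pM2l// mulrCA; apply: le_trans (mnM aP _ _) _.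
  by rewrite mulrCA.
- by rewrite invr_gt0 exprn_gt0.
- by [].
- move=> n; apply/andP; split; last by rewrite mulrA -expr2; exact: opnorm_ub.
  by rewrite ler_pdivrMl ?exprn_gt0// expr2 -mulrA ler_pM2l//; exact: opnorm_lb.
by exists L; split=> //; apply: cvg_lim.
Qed.

Lemma rho12_lim g : exists L : R, [/\ rho12 a g = L, 0 <= L,
  forall y, L < y -> exists2 B, 0 < B & forall n, D ^+ 2 * mx2 (mxpow g n) (mxpow g n) <= B * y ^+ n &
  (fun n => (D ^+ 2 * mx2 (mxpow g n.+1) (mxpow g n.+1)) `^ n.+1%:R^-1) @ \oo --> L].
Proof.
have [|||||L [L0 low up cv cv']] := @bounded_root (fun n => D ^+ 2 * mx2 (mxpow g n) (mxpow g n))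
    (fun n => opnorm2 a (mxpow g n)) (D ^+ 3)^-1 D.
- by move=> n; rewrite mulr_ge0 ?mx2_ge0// exprn_ge0.
- move=> m n; rewrite mxpowD -mulrA ler_pM2l ?exprn_gt0//; apply: le_trans (mx2_mul aP _ _) _.
  by rewrite mulrA -expr2 mulrCA.
- by rewrite invr_gt0 exprn_gt0.
- by [].
- move=> n; apply/andP; split; last by rewrite mulrA -exprS; exact: opnorm2_ub.
  rewrite ler_pdivrMl ?exprn_gt0//.
  have -> : D ^+ 3 * opnorm2 a (mxpow g n) = D ^+ 2 * (D * opnorm2 a (mxpow g n)) by ring.
  by rewrite ler_pM2l ?exprn_gt0//; exact: opnorm2_lb.
by exists L; split=> //; apply: cvg_lim.
Qed.

(** The default value of [rho2] when [rho1] is 0 makes both sides false in that case. *)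
Lemma rho2_lt_rho1 g : (rho2 a g < rho1 a g) = (rho12 a g < rho1 a g ^+ 2).
Proof.
have [L1 [L1E L1p _ _]] := rho1_lim g; have [L12 [L12E L12p _ _]] := rho12_lim g.
rewrite /rho2 L1E L12E; have [->|L10] := eqVneq L1 0.
  by rewrite ltxx expr2 mulr0 ltNge L12p.
by rewrite ltr_pdivrMr ?expr2// lt_def L10.
Qed.

Section MeasurableRadii.
Context (dX : measure_display) (X : measurableType dX).
Variable G : X -> 'M[K]_d.
Hypothesis mG : mkmeas a G.

Lemma mkmeas_mxpow n : mkmeas a (fun x => mxpow (G x) n).
Proof. by elim: n => [|n IH]; [exact: mkmeas_cst|exact: mkmeasM]. Qed.

Lemma measurable_rho1 : measurable_fun setT (fun x => rho1 a (G x)).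
Proof.
apply: (measurable_fun_cvg (h := fun n x => (D * mn (mxpow (G x) n.+1)) `^ n.+1%:R^-1)).
  move=> n; apply: (measurableT_comp (measurable_powR _)) => //.
  by apply: measurable_funM => //; apply: measurable_mn => //; exact: mkmeas_mxpow.
by move=> x _; have [L [-> _ _]] := rho1_lim (G x).
Qed.

Lemma measurable_rho12 : measurable_fun setT (fun x => rho12 a (G x)).
Proof.
apply: (measurable_fun_cvg (h := fun n x => (D ^+ 2 * mx2 (mxpow (G x) n.+1) (mxpow (G x) n.+1)) `^ n.+1%:R^-1)).
  move=> n; apply: (measurableT_comp (measurable_powR _)) => //.
  by apply: measurable_funM => //; apply: (measurable_mx2 lf) => //; exact: mkmeas_mxpow.
by move=> x _; have [L [-> _ _]] := rho12_lim (G x).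
Qed.

Lemma measurable_gap : measurable [set x | rho2 a (G x) < rho1 a (G x)].
Proof.
rewrite (_ : [set x | _] = [set x | rho12 a (G x) < rho1 a (G x) ^+ 2]); last first.
  by apply/seteqP; split=> x /=; rewrite rho2_lt_rho1.
have := measurable_fun_ltr measurable_rho12 (measurable_funX 2 measurable_rho1).
by move=> /(_ measurableT [set true] I); rewrite setTI.
Qed.

End MeasurableRadii.

Lemma mx2_eq0_outer (A : 'M[K]_d) : A != 0 -> mx2 A A = 0 ->
  exists (u : 'cV[K]_d) (f : 'rV[K]_d), A = u *m f.
Proof.
move=> A0 h; have [i0 [j0 hij]] := mn_max aP A0.
have Aij0 : A i0 j0 != 0 by rewrite -(av_gt0 aP) -hij (mn_gt0 aP).
exists (col j0 A), ((A i0 j0)^-1 *: row i0 A); apply/matrixP => i j.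
rewrite !mxE big_ord1 !mxE mulrCA; apply: (mulfI Aij0); rewrite mulVKf//.
apply/eqP; rewrite -subr_eq0 -(av_eq0 aP) eq_le (av_ge0 aP) andbT -h.
exact: (mx2_ub a A A i0 i j0 j).
Qed.

(** The minors of the powers grow at most like [y ^+ n] for some [y] below the square of [rho1],
    whereas [D] times the norm is at least [rho1 ^+ n]. The normalised powers thus have minors
    tending to 0, and a limit point, which is nonzero, has rank one. *)
Lemma rank_one_limit g : rho2 a g < rho1 a g ->
  (forall n, mxpow g n.+1 != 0) /\
  exists (u : 'cV[K]_d) (f : 'rV[K]_d), u *m f != 0 /\
    forall e : R, 0 < e -> exists n b, mn (b *: mxpow g n.+1 - u *m f) < e.
Proof.
rewrite rho2_lt_rho1.
have [L1 [-> L10 low _]] := rho1_lim g; have [L12 [-> L120 up _]] := rho12_lim g => L12lt.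
have L1p : 0 < L1.
  by rewrite lt_def L10 andbT; apply: contraTneq L12lt => ->; rewrite expr2 mulr0 -leNgt.
pose y := (L12 + L1 ^+ 2) / 2%:R.
have yL : y < L1 ^+ 2 by rewrite /y; lra.
have y0 : 0 <= y by rewrite /y; have := exprn_ge0 2 L10; lra.
have [B B0 hB] := up y ltac:(rewrite /y; lra).
have nz n : mxpow g n.+1 != 0.
  rewrite -(mn_gt0 aP); have := low n; rewrite -[_ <= _]ler_pdivrMl//; apply: lt_le_trans.
  by rewrite mulr_gt0 ?invr_gt0 ?exprn_gt0.
split=> //.
have small (e : R) : 0 < e -> exists N, forall n, (N <= n)%N ->
    mx2 (mxpow g n.+1) (mxpow g n.+1) <= e * mn (mxpow g n.+1) ^+ 2.
  move=> e0; pose q := y / L1 ^+ 2.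
  have q0 : 0 <= q by rewrite divr_ge0// exprn_ge0.
  have q1 : q < 1 by rewrite ltr_pdivrMr ?exprn_gt0// mul1r.
  have q1' : `|q| < 1 by rewrite ger0_norm.
  have := cvgr_lt _ (cvg_geometric B q1') e e0.
  move=> [N _ hN]; exists N => n Nn; have := hN n Nn; rewrite /geometric /= => hn.
  have h1 := hB n.+1; have h2 := low n.
  have h3 : L1 ^+ n.+1 * L1 ^+ n.+1 <= (D * mn (mxpow g n.+1)) * (D * mn (mxpow g n.+1)).
    by apply: ler_pM => //; exact: exprn_ge0.
  have h4 : B * y ^+ n.+1 <= e * (L1 ^+ n.+1 * L1 ^+ n.+1).
    have -> : L1 ^+ n.+1 * L1 ^+ n.+1 = (L1 ^+ 2) ^+ n.+1 by rewrite -exprMn -expr2.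
    rewrite -ler_pdivrMr ?exprn_gt0// -mulrA -expr_div_n -/q exprSr mulrA.
    apply: le_trans (ltW hn); rewrite ler_piMr// ?(ltW q1)// mulr_ge0 ?exprn_ge0//; exact: ltW.
  rewrite -(@ler_pM2l _ (D ^+ 2)) ?exprn_gt0//.
  apply: le_trans h1 _; apply: le_trans h4 _.
  have -> : D ^+ 2 * (e * mn (mxpow g n.+1) ^+ 2) = e * ((D * mn (mxpow g n.+1)) * (D * mn (mxpow g n.+1))) by ring.
  by rewrite ler_pM2l.
have /choice[c hc] : forall n, exists c, mn (c *: mxpow g n.+1) = 1.
  by move=> n; have [c _ hc] := normalize lf (nz n); exists c.
pose v n := c n *: mxpow g n.+1.
have [|phi [A [hphi hA]]] := bounded_subseq_mx lf (u := v) (r := 1).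
  by move=> n; rewrite /v hc.
have A0 : A != 0.
  have [n hn] := hA 2%:R^-1 ltac:(by rewrite invr_gt0); have := hn n (leqnn n).
  by apply: contraTneq => ->; rewrite subr0 /= /v hc -leNgt; lra.
have mxA : mx2 A A = 0.
  apply/eqP; rewrite eq_le mx2_ge0// andbT; apply/ler_addgt0Pl => e e0; rewrite addr0.
  have [N1 h1] := small (e / 2%:R) ltac:(by rewrite divr_gt0).
  pose m := mn A + 1; have m0 : 0 < m by rewrite ltr_wpDl// mn_ge0.
  have [N2 h2] := hA (e / (8%:R * m)) ltac:(by rewrite divr_gt0// mulr_gt0).
  pose n := maxn N1 N2; set V := v (phi n).
  have k2 : mn (V - A) < e / (8%:R * m) by apply: h2; exact: leq_maxr.
  have V1 : mn V = 1 by rewrite /V /v hc.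
  have k1 : mx2 V V <= e / 2%:R.
    have := h1 (phi n) (leq_trans (leq_maxl _ _) (mono_ge hphi n)).
    rewrite /V /v mx2Z// (mx2C aP) mx2Z// => h.
    have := ler_wpM2l (mulr_ge0 (av_ge0 aP (c (phi n))) (av_ge0 aP (c (phi n)))) h.
    have := hc (phi n); rewrite (mnZ aP) => E; rewrite mulrA.
    have -> : a (c (phi n)) * a (c (phi n)) * (e / 2%:R * mn (mxpow g (phi n).+1) ^+ 2)
      = e / 2%:R * (a (c (phi n)) * mn (mxpow g (phi n).+1)) ^+ 2 by ring.
    by rewrite E expr1n mulr1.
  have AE : A = V + (A - V) by rewrite addrC subrK.
  have k3 : mx2 A A <= mx2 V V + mx2 V (A - V) + mx2 A (A - V).
    rewrite {2}AE; apply: le_trans (mx2D aP _ _ _) _; rewrite lerD2r (mx2C aP A).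
    by rewrite {1}AE; exact: mx2D.
  have k4 := mx2_mn aP V (A - V); have k5 := mx2_mn aP A (A - V).
  rewrite V1 mul1r in k4; rewrite (mnBC aP A V) in k4 k5.
  rewrite ltr_pdivlMr ?mulr_gt0// in k2.
  have := mn_ge0 aP (V - A); have := mn_ge0 aP A; rewrite /m in k2 => p1 p2.
  nra.
have [u [f AE]] := mx2_eq0_outer A0 mxA.
exists u, f; rewrite -AE; split=> // e e0; have [n hn] := hA e e0.
by exists (phi n), (c (phi n)); exact: hn.
Qed.

Variable mu : probability (SeqE a d) R.
Hypothesis mu_splice : forall k (F : SeqE a d -> \bar R), measurable_fun setT F ->
  (forall x, 0 <= F x)%E ->
  (\int[mu]_x F x = \int[mu]_x \int[mu]_y F (splice k x y))%E.

Lemma accessible_rank_one n : (0 < mu [set x | (rho2 a (prodn n x) < rho1 a (prodn n x))%R])%E ->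
  exists (u : 'cV[K]_d) (f : 'rV[K]_d), u *m f != 0 /\ accessible mu (u *m f).
Proof.
have mS := mkmeas_prodn lf n (@measurable_id _ (SeqE a d) setT).
move=> h; have [|x /= hx accx] := accessible_pos lf (n := n) (measurable_gap mS) h.
  by move=> x /rank_one_limit[/(_ 0%N) + _]; rewrite /= mulmx1.
have [nz [u [f [uf0 lim]]]] := rank_one_limit hx.
exists u, f; split=> //; apply: (accessible_limit lf) => // e e0.
have [m [b hb]] := lim e e0; exists (mxpow (prodn n x) m.+1), b; split=> //.
elim: m {hb} => [|m IH]; first by rewrite /= mulmx1.
by apply: (accessibleM lf d0 mu_splice accx IH); exact: (nz m.+1).
Qed.

End Spectral.

(** * The limit line *)

Section Limits.
Variables (R : realType) (K : fieldType) (a : K -> R) (d : nat).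
Hypothesis lf : local_field a.
Let aP := local_field_nneg lf.
Notation mn := (mn a).
Notation mx2 := (mx2 a).
Notation D := (d%:R : R).

Lemma mx2_col p q q' (A : 'M[K]_(p, q)) (B : 'M[K]_(p, q')) j : mx2 (col j A) B <= mx2 A B.
Proof.
apply: mx2_le => [|i i' j1 j2]; first exact: mx2_ge0.
by rewrite !mxE; exact: mx2_ub.
Qed.

(** The triangle inequality for angles through the line of [u], up to constants, obtained by
    decomposing [y] along [u]. *)
Lemma mx2_triangle p (x y u : 'cV[K]_p) : u != 0 ->
  mx2 x y * mn u <= 2%:R * mn x * mx2 u y + 3%:R * mn y * mx2 u x.
Proof.
move=> u0; have [c hc] := line_proj aP y u0; set E := y - c *: u in hc.
have := u0; rewrite -(mn_gt0 aP) => up.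
have yE : y = E + c *: u by rewrite subrK.
have h1 : mx2 x y <= 2%:R * (mn x * mn E) + a c * mx2 x u.
  rewrite {1}yE; apply: le_trans (mx2D aP _ _ _) _; rewrite mx2Z// lerD2r.
  exact: mx2_mn.
have h2 : a c * mn u <= mn y + mn E.
  have := mn_subr aP (c *: u) y; rewrite (mnZ aP) (mnBC aP) -/E; lra.
have h3 : mn E <= 2%:R * mn y.
  rewrite -(ler_pM2r up); apply: le_trans hc _; apply: le_trans (mx2_mn aP _ _) _.
  by rewrite [mn u * _]mulrC mulrA.
have x0 := mn_ge0 aP x; have xu0 := mx2_ge0 aP x u.
apply: le_trans (ler_wpM2r (ltW up) h1) _.
have -> : (2%:R * (mn x * mn E) + a c * mx2 x u) * mn u =
  2%:R * mn x * (mn E * mn u) + (a c * mn u) * mx2 x u by ring.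
apply: lerD; first by apply: ler_wpM2l => //; rewrite mulr_ge0.
rewrite (mx2C aP u x); apply: ler_wpM2r => //; lra.
Qed.

Lemma mx2Ml p q r r' (H : 'M[K]_(p, q)) (A : 'M[K]_(q, r)) (B : 'M[K]_(q, r')) :
  mx2 (H *m A) (H *m B) <= q%:R * (q%:R * (mn H ^+ 2 * mx2 A B)).
Proof.
have p0 : 0 <= mn H ^+ 2 * mx2 A B by rewrite mulr_ge0 ?exprn_ge0 ?mn_ge0// mx2_ge0.
apply: mx2_le => [|i i' j j']; first by apply: mulr_ge0 => //; exact: mulr_ge0.
have -> : (H *m A) i j * (H *m B) i' j' - (H *m A) i' j * (H *m B) i j' =
    \sum_k \sum_l (H i k * H i' l) * (A k j * B l j' - A l j * B k j').
  rewrite !mxE !mulr_suml.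
  under eq_bigr do rewrite mulr_sumr; under [X in _ - X]eq_bigr do rewrite mulr_sumr.
  rewrite [X in _ - X]exchange_big -sumrB; apply: eq_bigr => k _.
  by rewrite -sumrB; apply: eq_bigr => l _; ring.
apply: av_sum_le => // k; apply: av_sum_le => // l; rewrite !(avM aP) expr2.
by apply: ler_pM; rewrite ?mulr_ge0 ?av_ge0//; [apply: ler_pM; rewrite ?av_ge0//; exact: mn_ub|exact: mx2_ub].
Qed.

Lemma mx2_eq0_line p (x y : 'cV[K]_p) : y != 0 -> mx2 x y = 0 -> exists c, x = c *: y.
Proof.
move=> y0 h; have [c hc] := line_proj aP x y0; exists c.
rewrite (mx2C aP) h in hc; apply/eqP; rewrite -subr_eq0 -(mn_eq0 aP) eq_le mn_ge0// andbT.
by move: hc; rewrite pmulr_lle0// (mn_gt0 aP).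
Qed.

Section Direction.
Variables (S : nat -> 'M[K]_d) (r : nat -> R).
Hypothesis d0 : (0 < d)%N.
Hypothesis S0 : forall k, S k != 0.
Hypothesis r0 : forall k, 0 <= r k.
Hypothesis Sr : forall k, mx2 (S k) (S k.+1) <= (r k - r k.+1) * (mn (S k) * mn (S k.+1)).
Hypothesis r4 : r 0%N <= 4%:R^-1.
Hypothesis r_lim : forall e : R, 0 < e -> exists N, forall k, (N <= k)%N -> r k < e.

Let Sp k : 0 < mn (S k). Proof. by rewrite (mn_gt0 aP). Qed.

Let r_dec k : r k.+1 <= r k.
Proof.
rewrite -subr_ge0; have := le_trans (mx2_ge0 aP (S k) (S k.+1)) (Sr k).
by rewrite pmulr_lge0// mulr_gt0.
Qed.

(** Each [w k.+1] is the projection of [w k] on the line of a largest column of [S k.+1]. The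
    displacement is the angle between consecutive images, which telescopes through [r]. *)
Lemma direction_sequence : exists w : nat -> 'cV[K]_d, w 0%N != 0 /\ forall k,
  mn (w k - w k.+1) <= (r k - r k.+1) * mn (w k) /\
  mx2 (S k) (w k.+1) <= (r k - r k.+1) * (mn (S k) * mn (w k.+1)).
Proof.
have /choice[j hj] : forall k, exists j, mn (col j (S k)) = mn (S k).
  by move=> k; exact: mn_col_max.
have /choice[F hF] : forall z : nat * 'cV[K]_d, exists c : K,
    mn (z.2 - c *: col (j z.1) (S z.1)) * mn (S z.1) <= mx2 (col (j z.1) (S z.1)) z.2.
  move=> [k v]; have [|c hc] := @line_proj _ _ _ aP _ (col (j k) (S k)) v.
    by rewrite -(mn_gt0 aP) hj.
  by exists c; rewrite /= -[X in _ * X <= _]hj.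
pose fix w k := if k is k'.+1 then F (k'.+1, w k') *: col (j k'.+1) (S k'.+1) else col (j 0%N) (S 0%N).
have wE k : exists c, w k = c *: col (j k) (S k).
  by case: k => [|k]; [exists 1; rewrite scale1r|exists (F (k.+1, w k))].
have mxw k m : mx2 (S m) (w k) * mn (S k) <= mx2 (S m) (S k) * mn (w k).
  have [c ->] := wE k; rewrite mx2Z// (mnZ aP) hj [X in _ <= X]mulrCA -[X in X <= _]mulrA.
  apply: ler_wpM2l; first exact: av_ge0.
  by apply: ler_wpM2r; [exact: mn_ge0|rewrite (mx2C aP) (mx2C aP (S m)); exact: mx2_col].
exists w; split; first by rewrite -(mn_gt0 aP) /= hj.
move=> k; split.
  have h1 := hF (k.+1, w k); rewrite /= in h1.
  rewrite -(ler_pM2r (Sp k.+1)); apply: le_trans h1 _.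
  apply: le_trans (mx2_col _ _ _) _; rewrite -(ler_pM2r (Sp k)).
  apply: le_trans (mxw k k.+1) _; rewrite (mx2C aP).
  apply: le_trans (ler_wpM2r (mn_ge0 aP _) (Sr k)) _.
  by rewrite le_eqVlt; apply/orP; left; apply/eqP; ring.
rewrite -(ler_pM2r (Sp k.+1)); apply: le_trans (mxw k.+1 k) _.
apply: le_trans (ler_wpM2r (mn_ge0 aP _) (Sr k)) _.
by rewrite le_eqVlt; apply/orP; left; apply/eqP; ring.
Qed.

(* Suitable multiples [w k] of a largest column of [S k] form a Cauchy sequence. *)
Lemma direction_exists : exists2 l : 'cV[K]_d, l != 0 &
  forall k, mx2 (S k) l <= 8%:R * r k * (mn (S k) * mn l).
Proof.
have [w [w0 hw]] := direction_sequence.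
have := w0; rewrite -(mn_gt0 aP) => wp; set m := mn (w 0%N) in wp.
have step i n : mn (w i) <= 2%:R * m -> (forall k, (i <= k)%N -> (k < i + n)%N -> mn (w k) <= 2%:R * m) ->
    mn (w i - w (i + n)%N) <= 2%:R * (r i - r (i + n)%N) * m.
  move=> hi; elim: n => [|n IH] h.
    by rewrite addn0 !subrr (mn0 aP) mulr0 mul0r.
  rewrite addnS; have -> : w i - w (i + n).+1 = (w i - w (i + n)%N) + (w (i + n)%N - w (i + n).+1).
    by rewrite addrA subrK.
  apply: le_trans (mnD aP _ _) _; have [h1 _] := hw (i + n)%N.
  have h2 : mn (w (i + n)%N) <= 2%:R * m by apply: h; rewrite ?leq_addr// addnS.
  have h3 : mn (w i - w (i + n)%N) <= 2%:R * (r i - r (i + n)%N) * m.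
    by apply: IH => k k1 k2; apply: h k1 _; rewrite addnS ltnW.
  have h4 : (r (i + n)%N - r (i + n).+1) * mn (w (i + n)%N) <= (r (i + n)%N - r (i + n).+1) * (2%:R * m).
    by apply: ler_wpM2l => //; rewrite subr_ge0.
  lra.
(* As [r 0 <= 1/4], the total displacement is at most half of [m]: the sequence stays bounded, and
   below the limit is seen to be nonzero. *)
have bound k : mn (w k) <= 2%:R * m.
  elim/ltn_ind: k => -[_|k IH]; first by rewrite -/m; lra.
  have := @step 0%N k.+1 _ (fun i _ => IH i); rewrite add0n => /(_ ltac:(rewrite -/m; lra)) h.
  have := mn_subr aP (w k.+1) (w 0%N); rewrite (mnBC aP) -/m => h1.
  have h2 : 2%:R * (r 0%N - r k.+1) * m <= 2%:R^-1 * m.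
    by apply: ler_wpM2r; [exact: ltW|have := r4; have := r0 k.+1; lra].
  lra.
have cauchy i n : mn (w i - w (i + n)%N) <= 2%:R * r i * m.
  apply: le_trans (step i n (bound i) (fun k _ _ => bound k)) _.
  by apply: ler_wpM2r; [exact: ltW|have := r0 (i + n)%N; lra].
have [e e0|l hl] := cauchy_cvg lf (u := w) bound.
  have me0 : 0 < e / (2%:R * m) by rewrite divr_gt0// mulr_gt0.
  have [N hN] := r_lim me0.
  have key i j : (N <= i)%N -> (i <= j)%N -> mn (w i - w j) < e.
    move=> Ni ij; rewrite -(subnKC ij); apply: le_lt_trans (cauchy _ _) _.
    by have := hN i Ni; rewrite ltr_pdivlMr ?mulr_gt0//; lra.
  exists N => i j Ni Nj; have [ij|/ltnW ji] := leqP i j; first exact: key.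
  by rewrite mnBC//; exact: key.
have lim k : mn (w k - l) <= 2%:R * r k * m.
  apply/ler_addgt0Pl => e e0; have [N hN] := hl e e0.
  have -> : w k - l = (w k - w (k + N)%N) + (w (k + N)%N - l) by rewrite addrA subrK.
  apply: le_trans (mnD aP _ _) _; rewrite addrC; apply: lerD; last exact: cauchy.
  by apply: ltW; apply: hN; rewrite leq_addl.
have lm : m <= 2%:R * mn l.
  have := lim 0%N; have := mn_subr aP (w 0%N) l; rewrite -/m => h1 h2.
  have : 2%:R * r 0%N * m <= 2%:R^-1 * m by apply: ler_wpM2r; [exact: ltW|have := r4; lra].
  lra.
exists l; first by rewrite -(mn_gt0 aP); lra.
move=> k; have [_ h1] := hw k.
have lE : l = w k.+1 + (l - w k.+1) by rewrite addrC subrK.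
rewrite {1}lE; apply: le_trans (mx2D aP _ _ _) _.
have h2 := mx2_mn aP (S k) (l - w k.+1); rewrite (mnBC aP l) in h2.
have h3 : (r k - r k.+1) * (mn (S k) * mn (w k.+1)) <= (r k - r k.+1) * (mn (S k) * (2%:R * m)).
  by apply: ler_wpM2l; [rewrite subr_ge0|apply: ler_wpM2l; [exact: ltW|]].
have h4 : mn (S k) * mn (w k.+1 - l) <= mn (S k) * (2%:R * r k.+1 * m).
  by apply: ler_wpM2l; [exact: ltW|].
have h5 : 4%:R * r k * (mn (S k) * m) <= 4%:R * r k * (mn (S k) * (2%:R * mn l)).
  by apply: ler_wpM2l; [rewrite mulr_ge0|apply: ler_wpM2l; [exact: ltW|]].
have h6 : 0 <= r k * (mn (S k) * m) by rewrite !mulr_ge0// ltW.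
have h7 : 0 <= (r k - r k.+1) * (mn (S k) * m).
  by rewrite mulr_ge0 ?subr_ge0// mulr_ge0// ltW.
lra.
Qed.

End Direction.
End Limits.

(** * The limit line and its characterisation *)

Section Linf.
Variables (R : realType) (K : fieldType) (a : K -> R) (d : nat).
Hypothesis lf : local_field a.
Hypothesis d2 : (2 <= d)%N.
Let aP := local_field_nneg lf.
Let d0 : (0 < d)%N. Proof. exact: ltnW. Qed.
Notation mn := (mn a).
Notation mx2 := (mx2 a).
Notation D := (d%:R : R).
Let D0 : 0 < D. Proof. by rewrite ltr0n. Qed.
Implicit Types (g : nat -> 'M[K]_d) (h : 'M[K]_d) (x y u l : 'cV[K]_d).

Lemma pdist_ub x y e : x != 0 -> y != 0 -> mx2 x y <= e * (mn x * mn y) -> 0 <= e ->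
  pdist a x y <= D * e.
Proof.
move=> x0 y0 h e0; rewrite /pdist ler_pdivrMr; last by rewrite mulr_gt0// vnorm_gt0.
apply: le_trans (wedge_ub aP _ _) _; rewrite -mulrA ler_pM2l//; apply: le_trans h _.
by apply: ler_wpM2l => //; apply: ler_pM; rewrite ?mn_ge0//; exact: vnorm_lb.
Qed.

Lemma pdist_lb x y e : x != 0 -> y != 0 -> 0 <= e -> pdist a x y <= e ->
  mx2 x y <= e * D ^+ 2 * (mn x * mn y).
Proof.
move=> x0 y0 e0; rewrite /pdist ler_pdivrMr; last by rewrite mulr_gt0// vnorm_gt0.
move=> h; apply: le_trans (wedge_lb aP _ _) _; apply: le_trans h _.
have -> : e * D ^+ 2 * (mn x * mn y) = e * ((D * mn x) * (D * mn y)) by ring.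
by apply: ler_wpM2l => //; apply: ler_pM; rewrite ?vnorm_ge0//; exact: vnorm_ub.
Qed.

(** A vector of [U^eps] keeps a proportion [eps] of the largest possible norm, so passing from the
    angle of the whole image to that of the vector costs a factor [1 / eps], up to the constants
    between norms. *)
Lemma inU_mx2 (eps e : R) h u l : 0 < eps -> 0 <= e -> inU a eps h u ->
  mx2 h l <= e * (mn h * mn l) -> mx2 u l <= D ^+ 3 * e / eps * (mn u * mn l).
Proof.
move=> eps0 e0 [x [hx ->]] hl.
have one : mn (1%:M : 'M[K]_1) <= 1.
  by apply: mn_le => // i j; rewrite mxE; case: (_ == _); rewrite ?(av1 aP) ?(av0 aP).
have h1 : mx2 (h *m x) l <= D * (mx2 h l * mn x).
  rewrite -[l]mulmx1; apply: le_trans (mx2Mr aP _ _ _ _) _; rewrite mul1r mulmx1 ler_pM2l//.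
  by apply: ler_wpM2l; [exact: mx2_ge0|rewrite -[leRHS]mulr1; apply: ler_wpM2l => //; exact: mn_ge0].
have p1 := mn_ge0 aP x; have p2 := mn_ge0 aP l; have p3 := mn_ge0 aP h.
have o0 := opnorm_ge0 aP d2 h.
apply: le_trans h1 _.
have h2 : mn h * mn x <= D * (D * mn (h *m x) / eps).
  apply: (@le_trans _ _ (D * opnorm a h * vnorm a x)).
    by apply: ler_pM => //; [exact: opnorm_lb|exact: vnorm_lb].
  rewrite -mulrA ler_pM2l// ler_pdivlMr// mulrC mulrA; apply: le_trans hx _; exact: vnorm_ub.
have h3 : mx2 h l * mn x <= e * (mn l * (D * (D * mn (h *m x) / eps))).
  apply: (@le_trans _ _ (e * (mn h * mn l) * mn x)); first exact: ler_wpM2r.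
  have -> : e * (mn h * mn l) * mn x = e * (mn l * (mn h * mn x)) by ring.
  by apply: ler_wpM2l => //; exact: ler_wpM2l.
apply: le_trans (ler_wpM2l (ltW D0) h3) _.
by rewrite le_eqVlt; apply/orP; left; apply/eqP; ring.
Qed.

Let eps0 : R := (D ^+ 3)^-1.

Let eps01 : 0 < eps0 < 1.
Proof.
by rewrite invr_gt0 exprn_gt0//= invf_lt1 ?exprn_gt0// exprn_egt1// ltr1n.
Qed.

(** The value of [eps0] absorbs the constants between max-norms and operator norms, so that [U^eps0]
    always contains a nonzero vector. *)
Lemma inU_column h : h != 0 -> exists u, [/\ u != 0, inU a eps0 h u & mn u = mn h].
Proof.
move=> h0; have [j hj] := mn_col_max aP h d0.
exists (col j h); split=> //; first by rewrite -(mn_gt0 aP) hj (mn_gt0 aP).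
exists (delta_mx j ord0); rewrite -colE; split=> //.
have h1 : vnorm a (delta_mx j ord0 : 'cV[K]_d) <= D.
  apply: le_trans (vnorm_ub aP _) _; rewrite -[leRHS]mulr1 ler_pM2l//.
  by apply: mn_le => // k l; rewrite mxE; case: (_ && _); rewrite ?(av1 aP) ?(av0 aP).
have o0 := opnorm_ge0 aP d2 h; have h2 := opnorm_ub aP d2 h.
apply: le_trans (vnorm_lb aP _); rewrite hj -mulrA ler_pdivrMl ?exprn_gt0//.
apply: (@le_trans _ _ (D ^+ 2 * mn h * D)); last by rewrite le_eqVlt; apply/orP; left; apply/eqP; ring.
by apply: ler_pM => //; exact: vnorm_ge0.
Qed.

(** [linf] is some choice among the vectors satisfying [is_linf], so estimates obtained for one of
    them have to be carried to it. At large times both vectors are close to a common element of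
    [U^eps0]. *)
Lemma is_linf_line g l l' : (forall n, gbar g n != 0) -> is_linf a g l -> is_linf a g l' ->
  exists c, l' = c *: l.
Proof.
move=> g0 [l0 hl] [l'0 hl']; apply: (mx2_eq0_line lf) => //.
apply/eqP; rewrite eq_le mx2_ge0// andbT.
have p := l0; rewrite -(mn_gt0 aP) in p; have p' := l'0; rewrite -(mn_gt0 aP) in p'.
apply/ler_addgt0Pl => e e0; rewrite addr0.
pose dl := e / (5%:R * D ^+ 2 * (mn l' * mn l)).
have q0 : 0 < 5%:R * D ^+ 2 * (mn l' * mn l).
  by apply: mulr_gt0; apply: mulr_gt0 => //; exact: exprn_gt0.
have dl0 : 0 < dl by rewrite divr_gt0.
have [N hN] := hl eps0 eps01 dl dl0; have [N' hN'] := hl' eps0 eps01 dl dl0.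
have [u [u0 Uu _]] := inU_column (g0 (maxn N N')).
have h1 := pdist_lb l0 u0 (ltW dl0) (hN _ (leq_maxl _ _) u Uu u0).
have h2 := pdist_lb l'0 u0 (ltW dl0) (hN' _ (leq_maxr _ _) u Uu u0).
have := mx2_triangle lf l' l u0; rewrite (mx2C aP u l) (mx2C aP u l') => h3.
have up := u0; rewrite -(mn_gt0 aP) in up.
rewrite -(ler_pM2r up); apply: le_trans h3 _.
have h4 : 2%:R * mn l' * mx2 l u <= 2%:R * mn l' * (dl * D ^+ 2 * (mn l * mn u)).
  by apply: ler_wpM2l => //; rewrite mulr_ge0// ltW.
have h5 : 3%:R * mn l * mx2 l' u <= 3%:R * mn l * (dl * D ^+ 2 * (mn l' * mn u)).
  by apply: ler_wpM2l => //; rewrite mulr_ge0// ltW.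
apply: le_trans (lerD h4 h5) _; rewrite -[e](divfK (lt0r_neq0 q0)) -/dl.
by rewrite le_eqVlt; apply/orP; left; apply/eqP; ring.
Qed.

Lemma is_linf_intro g l (e : nat -> R) n : l != 0 -> (forall k, 0 <= e k) ->
  (forall k, mx2 (gbar g (n + k)) l <= e k * (mn (gbar g (n + k)) * mn l)) ->
  (forall t : R, 0 < t -> exists N, forall k, (N <= k)%N -> e k < t) -> is_linf a g l.
Proof.
move=> l0 e0 he lim; split=> // eps /andP[ep _] dl dl0.
have t0 : 0 < dl * eps / D ^+ 4 by rewrite divr_gt0 ?mulr_gt0 ?exprn_gt0.
have [N hN] := lim _ t0; exists (n + N)%N => k nk u Uu u0.
have nk' : (n <= k)%N by exact: leq_trans (leq_addr _ _) nk.
have := he (k - n)%N; rewrite subnKC// => h1.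
have h2 := inU_mx2 ep (e0 _) Uu h1.
have Nk : (N <= k - n)%N by rewrite leq_subRL.
have h3 := hN _ Nk; rewrite ltr_pdivlMr ?exprn_gt0// in h3.
apply: le_trans (pdist_ub l0 u0 (e := D ^+ 3 * e (k - n)%N / eps) _ _) _.
- by rewrite (mx2C aP) [mn l * _]mulrC.
- by rewrite divr_ge0 ?(ltW ep)// mulr_ge0// exprn_ge0.
have -> : D * (D ^+ 3 * e (k - n)%N / eps) = e (k - n)%N * D ^+ 4 / eps by ring.
by rewrite ler_pdivrMr// ltW.
Qed.

Lemma linf_bound g (r : nat -> R) n : (forall k, gbar g k != 0) -> (forall k, 0 <= r k) ->
  (forall k, mx2 (gbar g (n + k)) (gbar g (n + k).+1) <=
     (r k - r k.+1) * (mn (gbar g (n + k)) * mn (gbar g (n + k).+1))) ->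
  r 0%N <= 4%:R^-1 -> (forall e : R, 0 < e -> exists N, forall k, (N <= k)%N -> r k < e) ->
  is_linf a g (linf a g) /\ forall k,
    mx2 (gbar g (n + k)) (linf a g) <= 8%:R * r k * (mn (gbar g (n + k)) * mn (linf a g)).
Proof.
move=> g0 r0 hr r4 lim.
have [|l l0 hl] := direction_exists lf (S := fun k => gbar g (n + k)) d0 (fun k => g0 _) r0 _ r4 lim.
  by move=> k; rewrite addnS; exact: hr.
have lim8 (t : R) : 0 < t -> exists N, forall k, (N <= k)%N -> 8%:R * r k < t.
  move=> t0; have t80 : 0 < t / 8%:R by rewrite divr_gt0.
  by have [N hN] := lim _ t80; exists N => k /hN; rewrite ltr_pdivlMr// mulrC.
have Il : is_linf a g l.
  by apply: (is_linf_intro l0 _ hl lim8) => k; rewrite mulr_ge0.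
have IL : is_linf a g (linf a g) by apply: xgetPex; exists l.
split=> // k; have [c ->] := is_linf_line g0 Il IL.
rewrite mx2Z// (mnZ aP).
have -> : 8%:R * r k * (mn (gbar g (n + k)) * (a c * mn l)) =
  a c * (8%:R * r k * (mn (gbar g (n + k)) * mn l)) by ring.
by apply: ler_wpM2l => //; exact: av_ge0.
Qed.

(** At the times supplied by the last hypothesis, take the column [s] of [S n] that is sent to a
    largest column of [U n]. It is nearly parallel to [l'] and carries a fixed proportion of the
    norm, and its image is nearly parallel to [l]. Hence [H] does not kill [l'], and in the limit
    [H *m l'] lies on the line of [l]. *)
Lemma linf_step (S U : nat -> 'M[K]_d) (H : 'M[K]_d) (e : nat -> R) (c : R) l' l :
  (forall n, U n = H *m S n) -> (forall n, S n != 0) -> l' != 0 -> l != 0 ->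
  (forall n, mx2 (S n) l' <= e n * (mn (S n) * mn l')) ->
  (forall n, mx2 (U n) l <= e n * (mn (U n) * mn l)) -> (forall n, 0 <= e n) ->
  (forall t : R, 0 < t -> exists N, forall k, (N <= k)%N -> e k < t) ->
  0 < c -> (forall N, exists2 n, (N <= n)%N & c * mn (S n) <= mn (U n)) ->
  peq a (H *m l') l.
Proof.
move=> UE S0 l'0 l0 hS hU e0 lim c0 freq.
have Sp n : 0 < mn (S n) by rewrite (mn_gt0 aP).
have lp : 0 < mn l by rewrite (mn_gt0 aP).
have l'p : 0 < mn l' by rewrite (mn_gt0 aP).
have hp : 0 < mn H.
  rewrite (mn_gt0 aP); have [n _ hn] := freq 0%N; apply: contraTneq hn => H0.
  by rewrite UE H0 mul0mx (mn0 aP) -ltNge mulr_gt0.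
have key (t : R) : 0 < t -> exists n (s : 'cV[K]_d), [/\ e n < t, mn (H *m s) = mn (U n),
    c * mn (S n) <= mn (U n), mn s <= mn (S n) & mx2 s l' <= e n * (mn (S n) * mn l') /\
    mx2 (H *m s) l <= e n * (mn (U n) * mn l)].
  move=> t0; have [N hN] := lim t t0; have [n Nn hn] := freq N.
  have [j hj] := mn_col_max aP (U n) d0.
  have sE : H *m col j (S n) = col j (U n) by rewrite UE !colE mulmxA.
  exists n, (col j (S n)); split; rewrite ?sE//; [exact: hN|exact: mn_col|split].
    by apply: le_trans (hS n); exact: mx2_col.
  by apply: le_trans (hU n); exact: mx2_col.
pose k1 := D * mn H / c; have k10 : 0 < k1 by rewrite divr_gt0// mulr_gt0.
have Hl'0 : H *m l' != 0.
  pose t := c / (2%:R * (c + D * mn H) * k1).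
  have den0 : 0 < 2%:R * (c + D * mn H) * k1.
    by apply: mulr_gt0 => //; apply: mulr_gt0 => //; apply: addr_gt0 => //; exact: mulr_gt0.
  have t0 : 0 < t by rewrite divr_gt0.
  have [n [s [en hs cS sS [h1 _]]]] := key t t0.
  have sk : mn (S n) <= k1 * mn s.
    have := mnM aP H s; rewrite hs => h2; rewrite /k1 mulrAC ler_pdivlMr// mulrC.
    by apply: le_trans cS _; rewrite -mulrA.
  have sp : 0 < mn s by rewrite -(pmulr_rgt0 _ k10); exact: lt_le_trans sk.
  have s0 : s != 0 by rewrite -(mn_gt0 aP).
  have [b hb] := line_proj aP l' s0; set E := l' - b *: s in hb.
  have hE : mn E <= t * k1 * mn l'.
    rewrite -(ler_pM2r sp); apply: le_trans hb _; apply: le_trans h1 _.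
    have -> : t * k1 * mn l' * mn s = t * (k1 * mn s * mn l') by ring.
    by apply: ler_pM; rewrite ?mulr_ge0 ?mn_ge0 ?(ltW en)//; apply: ler_wpM2r => //; exact: ltW.
  have h3 := mn_subr aP l' E; rewrite (_ : l' - E = b *: s) ?(mnZ aP) in h3; last by rewrite opprB addrC subrK.
  have HE : H *m l' = b *: (H *m s) + H *m E by rewrite /E mulmxBr -scalemxAr addrC subrK.
  have h4 := mn_subr aP (b *: (H *m s)) (- (H *m E)); rewrite opprK -HE (mnZ aP) (mnN aP) hs in h4.
  have h5 := mnM aP H E.
  have h6 : c * (a b * mn s) <= a b * mn (U n).
    rewrite mulrCA; apply: ler_wpM2l; first exact: av_ge0.
    by apply: le_trans cS; rewrite ler_pM2l.
  have h7 : c * (mn l' - mn E) <= c * (a b * mn s) by rewrite ler_pM2l.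
  have h8 : (c + D * mn H) * mn E <= (c + D * mn H) * (t * k1 * mn l').
    by apply: ler_wpM2l => //; rewrite addr_ge0 ?mulr_ge0 ?ltW.
  have h9 : (c + D * mn H) * (t * k1 * mn l') = c / 2%:R * mn l'.
    by rewrite /t; field; rewrite !gt_eqF// addr_gt0// mulr_gt0.
  have h10 : 0 < c * mn l' by rewrite mulr_gt0.
  rewrite -(mn_gt0 aP); apply: (@lt_le_trans _ _ (c / 2%:R * mn l')); first by rewrite mulr_gt0// divr_gt0.
  rewrite h9 in h8; rewrite mulrDl in h8; lra.
split=> //; split=> //.
suff h : mx2 (H *m l') l = 0.
  apply/eqP; rewrite eq_le; apply/andP; split; last first.
    by rewrite /pdist divr_ge0// ?w2norm_ge0// mulr_ge0// vnorm_ge0.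
  by have := @pdist_ub (H *m l') l 0 Hl'0 l0; rewrite h mul0r mulr0; apply.
apply/eqP; rewrite eq_le mx2_ge0// andbT; apply/ler_addgt0Pl => z z0; rewrite addr0.
pose B := 2%:R * mn (H *m l') * mn l + 3%:R * mn l * (D ^+ 2 * mn H ^+ 2 / c * mn l') + 1.
have B0 : 0 < B.
  rewrite ltr_wpDl// addr_ge0// ?mulr_ge0 ?mn_ge0 ?exprn_ge0 ?invr_ge0//; exact: ltW.
have t0 : 0 < z / B by rewrite divr_gt0.
have [n [s [en hs cS sS [h1 h2]]]] := key _ t0.
have Up : 0 < mn (U n) by apply: lt_le_trans cS; rewrite mulr_gt0.
have Hs0 : H *m s != 0 by rewrite -(mn_gt0 aP) hs.
have h3 := mx2_triangle lf (H *m l') l Hs0; rewrite hs in h3.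
have h4 : mx2 (H *m s) (H *m l') <= e n * (D ^+ 2 * mn H ^+ 2 / c * mn l') * mn (U n).
  apply: le_trans (mx2Ml lf _ _ _) _.
  apply: (@le_trans _ _ (D * (D * (mn H ^+ 2 * (e n * (mn (U n) / c * mn l')))))).
    rewrite !ler_pM2l ?exprn_gt0//; apply: le_trans h1 _; apply: ler_wpM2l => //.
    by apply: ler_wpM2r; [exact: ltW|rewrite ler_pdivlMr// mulrC].
  by rewrite le_eqVlt; apply/orP; left; apply/eqP; ring.
rewrite -(ler_pM2r Up); apply: le_trans h3 _.
apply: (@le_trans _ _ (e n * B * mn (U n))).
  have h5 : 2%:R * mn (H *m l') * mx2 (H *m s) l <= 2%:R * mn (H *m l') * (e n * (mn (U n) * mn l)).
    by apply: ler_wpM2l => //; rewrite mulr_ge0// mn_ge0.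
  have h6 : 3%:R * mn l * mx2 (H *m s) (H *m l') <= 3%:R * mn l * (e n * (D ^+ 2 * mn H ^+ 2 / c * mn l') * mn (U n)).
    by apply: ler_wpM2l => //; rewrite mulr_ge0// ltW.
  apply: le_trans (lerD h5 h6) _.
  have : 0 <= e n * mn (U n) by rewrite mulr_ge0// ltW.
  rewrite /B; set X := D ^+ 2 * mn H ^+ 2 / c; lra.
by apply: ler_wpM2r; [exact: ltW|rewrite -ler_pdivlMr// ltW].
Qed.

End Linf.

Lemma geometric_small (R : realType) (rho A : R) : 0 < rho < 1 -> forall e : R, 0 < e ->
  exists N, forall k, (N <= k)%N -> A * rho ^+ k < e.
Proof.
move=> /andP[h0 h1] e e0; have q1 : `|rho| < 1 by rewrite ger0_norm// ltW.
have [N _ hN] := cvgr_lt _ (cvg_geometric A q1) e e0.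
by exists N => k Nk; have := hN k Nk.
Qed.

Section Omega.
Variables (R : realType) (K : fieldType) (a : K -> R) (d : nat).
Hypothesis lf : local_field a.
Hypothesis d2 : (2 <= d)%N.
Let aP := local_field_nneg lf.
Let d0 : (0 < d)%N. Proof. exact: ltnW. Qed.
Notation mn := (mn a).
Notation mx2 := (mx2 a).
Notation D := (d%:R : R).
Implicit Types (x : SeqE a d) (g : nat -> 'M[K]_d).

Lemma linf_geo g (rho : R) N : 0 < rho < 1 -> (forall k, gbar g k != 0) ->
  (forall k, (N <= k)%N -> mx2 (gbar g k) (gbar g k.+1) <= rho ^+ k * (mn (gbar g k) * mn (gbar g k.+1))) ->
  rho ^+ N <= (1 - rho) / 4%:R ->
  is_linf a g (linf a g) /\ forall k, (N <= k)%N ->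
    mx2 (gbar g k) (linf a g) <= 8%:R / (1 - rho) * rho ^+ k * (mn (gbar g k) * mn (linf a g)).
Proof.
move=> rho01 g0 hq hN; have /andP[p0 p1] := rho01; have q0 : 0 < 1 - rho by rewrite subr_gt0.
pose r k := rho ^+ (N + k) / (1 - rho).
have r0 k : 0 <= r k by rewrite divr_ge0 ?exprn_ge0// ltW.
have rE k : r k - r k.+1 = rho ^+ (N + k).
  by rewrite /r addnS exprS; field; rewrite gt_eqF.
have [|||IL hL] := @linf_bound R K a d lf d2 g r N g0 r0.
- by move=> k; rewrite rE; apply: hq; rewrite leq_addr.
- by rewrite /r addn0 ler_pdivrMr//; move: hN; rewrite mulrC.
- move=> e e0; have [n hn] := geometric_small (1 - rho)^-1 rho01 e0.
  by exists n => k nk; rewrite /r mulrC; apply: hn; apply: leq_trans nk _; rewrite leq_addl.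
split=> // k Nk; have := hL (k - N)%N; rewrite /r subnKC//.
by have -> : 8%:R / (1 - rho) * rho ^+ k = 8%:R * (rho ^+ k / (1 - rho)) by ring.
Qed.

Definition contracting (rho : R) x := exists N, forall k, (N <= k)%N ->
  gapratio a (prodn k x) (prodn k.+1 x) <= rho ^+ k.

(** [prodn n.+1 x] is the first letter times [prodn n (shift 1 x)]. That this letter keeps a fixed
    proportion of the norm infinitely often is the hypothesis of [linf_step]. *)
Definition transverse x := exists2 c : R, 0 < c &
  forall N, exists2 n, (N <= n)%N & c * mn (prodn n (Defs.shift 1 x)) <= mn (prodn n.+1 x).

Lemma gapratioP p q q' (A : 'M[K]_(p, q)) (B : 'M[K]_(p, q')) (e : R) : A != 0 -> B != 0 ->
  (gapratio a A B <= e) = (mx2 A B <= e * (mn A * mn B)).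
Proof. by move=> A0 B0; rewrite /gapratio ler_pdivrMr// mulr_gt0// (mn_gt0 aP). Qed.

Lemma prodn_shift_neq0 k x : (forall n, prodn n x != 0) -> forall n, prodn n (Defs.shift k x) != 0.
Proof. by move=> h n; apply: contra_neq (h (k + n)%N) => E; rewrite prodnD E mulmx0. Qed.

Lemma Omega_intro (rho : R) x : 0 < rho < 1 -> (forall n, prodn n x != 0) ->
  (forall k, contracting rho (Defs.shift k x)) -> (forall k, transverse (Defs.shift k x)) ->
  Omega a (fun n => x n : 'M[K]_d).
Proof.
move=> rho01 x0 hq ht k; have /andP[p0 p1] := rho01; have q0 : 0 < 1 - rho by rewrite subr_gt0.
have key m : exists N, is_linf a (Defs.shift m x : nat -> 'M[K]_d) (linf a (Defs.shift m x : nat -> 'M[K]_d)) /\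
    forall n, (N <= n)%N -> mx2 (prodn n (Defs.shift m x)) (linf a (Defs.shift m x : nat -> 'M[K]_d)) <=
      8%:R / (1 - rho) * rho ^+ n * (mn (prodn n (Defs.shift m x)) * mn (linf a (Defs.shift m x : nat -> 'M[K]_d))).
  have [N1 h1] := hq m; have [|N2 h2] := geometric_small 1 rho01 (e := (1 - rho) / 4%:R).
    by rewrite divr_gt0.
  exists (maxn N1 N2); apply: linf_geo => //.
  - exact: (prodn_shift_neq0 m x0).
  - move=> n; rewrite geq_max => /andP[n1 _]; rewrite -gapratioP; first exact: h1.
      exact: (prodn_shift_neq0 m x0 n).
    exact: (prodn_shift_neq0 m x0 n.+1).
  - by have := h2 _ (leq_maxr N1 N2); rewrite mul1r => /ltW.
have [N1 [I1 b1]] := key k; have [N2 [I2 b2]] := key k.+1.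
have sE : Defs.shift 1 (Defs.shift k x) = Defs.shift k.+1 x by rewrite shiftD addn1.
split; first by split; [exact: (prodn_shift_neq0 k x0)|exists (linf a (Defs.shift k x : nat -> 'M[K]_d))].
have [c c0 hc] := ht k; rewrite sE in hc.
pose m := maxn N1 N2.
apply: (@linf_step R K a d lf d2 (fun n => prodn (m + n) (Defs.shift k.+1 x))
    (fun n => prodn (m + n).+1 (Defs.shift k x)) _ (fun n => 8%:R / (1 - rho) * rho ^+ (m + n)) c) => //.
- by move=> n; rewrite prodnS prodn1 sE /Defs.shift add0n.
- by move=> n; exact: (prodn_shift_neq0 k.+1 x0).
- by case: I2.
- by case: I1.
- by move=> n; apply: b2; apply: leq_trans (leq_maxr N1 N2) _; rewrite leq_addr.
- move=> n; apply: le_trans (b1 _ _) _.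
    by apply: leqW; apply: leq_trans (leq_maxl N1 N2) _; rewrite leq_addr.
  apply: ler_wpM2r; first by rewrite mulr_ge0 ?mn_ge0.
  apply: ler_wpM2l; first by rewrite divr_ge0// ltW.
  by rewrite exprS ler_piMl ?exprn_ge0// ltW.
- by move=> n; rewrite mulr_ge0 ?exprn_ge0 ?divr_ge0 ?(ltW q0) ?(ltW p0).
- move=> t t0; have [N hN] := geometric_small (8%:R / (1 - rho)) rho01 t0.
  by exists N => n Nn; apply: hN; apply: leq_trans Nn _; rewrite leq_addl.
- move=> N; have [n] := hc (m + N)%N; move=> mNn hn; exists (n - m)%N.
    by rewrite leq_subRL// (leq_trans _ mNn)// leq_addr.
  by rewrite subnKC// (leq_trans _ mNn)// leq_addr.
Qed.

End Omega.

(** * Almost sure convergence and deviations *)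

Lemma geometric_sum_le (R : realType) (rho : R) m : 0 <= rho -> rho < 1 ->
  \sum_(0 <= k < m) rho ^+ k <= (1 - rho)^-1.
Proof.
move=> r0 r1; have q0 : 0 < 1 - rho by rewrite subr_gt0.
suff h : (\sum_(0 <= k < m) rho ^+ k) * (1 - rho) = 1 - rho ^+ m.
  by rewrite -[leRHS]mul1r ler_pdivlMr// h gerBl exprn_ge0.
elim: m => [|m IH]; first by rewrite big_geq// mul0r expr0 subrr.
by rewrite big_nat_recr//= mulrDl IH exprS; ring.
Qed.

Section Tails.
Context (dX : measure_display) (X : measurableType dX) (R : realType) (mu : probability X R).

Lemma tail_measure (A : nat -> set X) (C beta : R) : 0 <= C -> 0 < beta ->
  (forall n, measurable (A n)) -> (forall n, mu (A n) <= (C * expR (- (beta * n%:R)))%:E)%E ->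
  forall n, (mu (\bigcup_(k in [set k | (n <= k)%N]) A k) <=
    (C / (1 - expR (- beta)) * expR (- (beta * n%:R)))%:E)%E.
Proof.
move=> C0 b0 mA hA n; set rho := expR (- beta).
have r0 : 0 <= rho by exact: expR_ge0.
have r1 : rho < 1 by rewrite expR_lt1 oppr_lt0.
have eE k : expR (- (beta * k%:R)) = rho ^+ k by rewrite -mulNr expRM_natr.
apply: (@le_trans _ _ (\sum_(0 <= k <oo) mu (A (n + k)%N))%E).
  apply: measure_sigma_subadditive => //; first exact: bigcup_measurable.
  by move=> x [k /= nk Ax]; exists (k - n)%N => //; rewrite subnKC.
apply: (@le_trans _ _ (\sum_(0 <= k <oo) (C * rho ^+ n * rho ^+ k)%:E)%E).
  apply: lee_nneseries => [k _ _|k _]; first exact: measure_ge0.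
  by apply: le_trans (hA _) _; rewrite eE exprD mulrA.
apply: lime_le.
  by apply: is_cvg_nneseries => k _ _; rewrite lee_fin !mulr_ge0// exprn_ge0.
apply: nearW => m; rewrite sumEFin lee_fin -mulr_sumr eE mulrAC.
by apply: ler_wpM2r; [exact: exprn_ge0|apply: ler_wpM2l => //; exact: geometric_sum_le].
Qed.

Lemma null_limsup (A : nat -> set X) (C beta : R) : 0 <= C -> 0 < beta ->
  (forall n, measurable (A n)) -> (forall n, mu (A n) <= (C * expR (- (beta * n%:R)))%:E)%E ->
  mu (lim_sup_set A) = 0.
Proof.
move=> C0 b0 mA hA; apply/eqP; rewrite eq_le measure_ge0 andbT.
have h := tail_measure C0 b0 mA hA.
have r1 : expR (- beta) < 1 by rewrite expR_lt1 oppr_lt0.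
have rr : 0 < expR (- beta) < 1 by rewrite expR_gt0.
apply/lee_addgt0Pr => e e0; rewrite add0e.
have [N hN] := geometric_small (C / (1 - expR (- beta))) rr e0.
apply: le_trans (lim_sup_set_ub mu N mA) _; apply: le_trans (h N) _.
by rewrite lee_fin -mulNr expRM_natr ltW// hN.
Qed.

Lemma bigcup_null (A : nat -> set X) : (forall n, measurable (A n)) ->
  (forall n, mu (A n) = 0) -> mu (\bigcup_n A n) = 0.
Proof.
move=> mA A0; apply/eqP; rewrite eq_le measure_ge0 andbT.
have h := measure_sigma_subadditive mu mA (bigcupT_measurable _ mA) (@subset_refl _ _).
apply: le_trans h _.
by rewrite eseries0// => n _ _; exact: A0.
Qed.

Lemma setU_null (A B : set X) : measurable A -> measurable B -> mu A = 0 -> mu B = 0 ->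
  mu (A `|` B) = 0.
Proof.
move=> mA mB A0 B0; apply/eqP; rewrite eq_le measure_ge0 andbT.
by apply: (@le_trans _ _ (mu A + mu B)%E); [exact: measureU2|rewrite A0 B0 adde0].
Qed.

End Tails.

Section Random.
Variables (R : realType) (K : fieldType) (a : K -> R) (d : nat).
Hypothesis lf : local_field a.
Hypothesis d2 : (2 <= d)%N.
Let aP := local_field_nneg lf.
Let d0 : (0 < d)%N. Proof. exact: ltnW. Qed.
Notation mn := (mn a).
Notation mx2 := (mx2 a).
Notation D := (d%:R : R).
Variable mu : probability (SeqE a d) R.
Hypothesis mu_splice : forall k (F : SeqE a d -> \bar R), measurable_fun setT F ->
  (forall x, 0 <= F x)%E ->
  (\int[mu]_x F x = \int[mu]_x \int[mu]_y F (splice k x y))%E.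
Variables (M : nat) (T : 'M[K]_d -> R) (e theta tau : R).
Hypothesis sch : schottky mu M T e theta tau.
Hypotheses (tau0 : 0 <= tau).
Hypothesis tau1 : 2%:R * D ^+ 3 * (e + D) * tau <= e ^+ 3.
Hypothesis tau2 : 16%:R * D ^+ 6 * tau <= e ^+ 6.

Let mp0 n : mkmeas a (fun x : SeqE a d => prodn n x) :=
  mkmeas_prodn lf n (@measurable_id _ (SeqE a d) setT).
Let ps : forall k, measurable_fun setT (fun x : SeqE a d => Defs.shift k x : SeqE a d) :=
  fun k => @measurable_shift R K a d k.

Lemma measurable_ge (f : SeqE a d -> R) c : measurable_fun setT f -> measurable [set x | c <= f x].
Proof.
move=> mf; have := measurable_fun_ler (@measurable_cst _ _ (SeqE a d) _ setT c) mf.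
by move=> /(_ measurableT [set true] I); rewrite setTI.
Qed.

Lemma markov_powR (f : SeqE a d -> R) s c C : 0 < s -> 0 < c -> (forall x, 0 <= f x) ->
  measurable_fun setT f -> (Ex mu (fun x => (f x `^ s)%R) <= C%:E)%E ->
  (mu [set x | (c <= f x)%R] <= (C / c `^ s)%:E)%E.
Proof.
move=> s0 c0 f0 mf hC; have mA := measurable_ge c mf.
have cs : 0 < c `^ s by exact: powR_gt0.
have h : ((c `^ s)%:E * mu [set x | (c <= f x)%R] <= C%:E)%E.
  have mI : measurable_fun setT (\1_[set x | c <= f x] : SeqE a d -> R) by exact: measurable_indic.
  rewrite -(Ex_indic mu mA) -ExZ//; last exact: ltW.
  apply: le_trans hC; apply: Ex_le.
  - exact: measurable_funM.
  - exact: measurable_powRs.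
  - by move=> x; apply: mulr_ge0 => //; exact: ltW.
  move=> x; rewrite indicE; case: (boolP (x \in _)) => /= hx; last by rewrite mulr0 powR_ge0.
  by rewrite mulr1; apply: le_powR; [exact: ltW|exact: ltW|move: hx; rewrite inE].
have fin : mu [set x | (c <= f x)%R] \is a fin_num by rewrite fin_num_measure.
move: h; rewrite -(fineK fin) -EFinM !lee_fin => h.
by rewrite ler_pdivlMr// mulrC.
Qed.

(** Markov's inequality with half of the decay rate [t] given up. The positive rate obtained
    supports [Omega_ae] and every [alpha] below it. *)
Lemma gap_at_exists : exists2 al : R, 0 < al & gap_at mu al.
Proof.
have [s [C [t [s0 C0 t0 hg]]]] := gapmom_decay lf mu_splice sch d0 tau0 tau1 tau2.
exists (t / (2%:R * s)); first by rewrite divr_gt0// mulr_gt0.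
move=> eta eta0; have tr : 0 < expR (- (t / 2%:R)) < 1.
  by rewrite expR_gt0 expR_lt1 oppr_lt0 divr_gt0.
have [N hN] := geometric_small C tr eta0; exists N => n Nn.
set c := expR (- (t / (2%:R * s) * n%:R)).
have h := @markov_powR (fun x => sg a (prodn n x)) s c (gapmom mu s n) s0 (expR_gt0 _)
  (fun x => sg_ge0 aP _) (measurable_gapratio lf (mp0 n) (mp0 n)) ltac:(by rewrite gapmomE// ltW).
apply: (@le_trans _ _ (mu [set x | (c <= sg a (prodn n x))%R])).
  apply: le_measure; rewrite ?inE.
  - have mf : measurable_fun setT (fun x : SeqE a d => c < sg a (prodn n x)).
      by apply: measurable_fun_ltr => //; exact: measurable_gapratio.
    by have := mf measurableT [set true] I; rewrite setTI.
  - by apply: measurable_ge; exact: measurable_gapratio.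
  - by move=> x /= /ltW.
apply: le_trans h _; rewrite lee_fin; apply: le_trans (ltW (hN n Nn)).
rewrite ler_pdivrMr ?powR_gt0 ?expR_gt0//; apply: le_trans (hg n) _; rewrite -mulrA ler_pM2l//.
rewrite /c -expRM -expRM_natr -expRD le_eqVlt; apply/orP; left; apply/eqP; congr expR.
by field; rewrite gt_eqF.
Qed.

(** The moments decay at the rate of the midpoint [am]; Markov's inequality at the slower rate [al]
    leaves the exponent [s * (am - al)]. *)
Lemma ratio_tail (al' al : R) : 0 < al < al' -> gap_at mu al' -> exists C beta : R,
  [/\ 0 < C, 0 < beta & forall (H : SeqE a d -> 'M[K]_d) n, mkmeas a H ->
    (mu [set x | (expR (- (al * n%:R)) <= gapratio a (prodn n x) (prodn n x *m H (Defs.shift n x)))%R]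
      <= (C * expR (- (beta * n%:R)))%:E)%E].
Proof.
move=> /andP[al0 al1] gap; pose am := (al + al') / 2%:R.
have am01 : 0 < am < al' by apply/andP; rewrite /am; split; lra.
have amp : 0 < am by case/andP: am01.
have [s [C [s0 C0 hM hg]]] := gapmom_decay_rate lf mu_splice sch d0 tau1 am01 gap.
have [C' C'0 hr] := ratio_decay lf mu_splice sch d0 tau1 s0 amp C0 hM hg.
exists C', (s * (am - al)); split=> // [|H n mH].
  by rewrite mulr_gt0// subr_gt0 /am; lra.
have mHn : mkmeas a (fun x : SeqE a d => H (Defs.shift n x)).
  by move=> i j; apply: (kmeas_comp (mH i j)); exact: ps.
have mG : measurable_fun setT (fun x : SeqE a d => gapratio a (prodn n x) (prodn n x *m H (Defs.shift n x))).
  by apply: measurable_gapratio => //; exact: mkmeasM.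
have := @markov_powR _ s (expR (- (al * n%:R))) _ s0 (expR_gt0 _) (fun x => gapratio_ge0 aP _ _) mG (hr H n mH).
move/le_trans; apply; rewrite lee_fin -expRM -expRN.
rewrite le_eqVlt; apply/orP; left; apply/eqP.
by rewrite -[LHS]mulrA -expRD; congr (_ * expR _); ring.
Qed.

(** Borel-Cantelli for [ratio_tail], with [H] the next letter, so that [S_n *m H] is the next
    product. *)
Lemma contracting_ae (al' : R) : 0 < al' -> gap_at mu al' -> exists2 rho : R, 0 < rho < 1 &
  exists A, [/\ measurable A, mu A = 0 & forall x, ~ A x -> contracting rho x].
Proof.
move=> al0 gap; have h2 : 0 < al' / 2%:R < al' by apply/andP; split; lra.
have [C [beta [C0 b0 hC]]] := ratio_tail h2 gap.
exists (expR (- (al' / 2%:R))).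
  by rewrite expR_gt0 expR_lt1 oppr_lt0 divr_gt0.
pose A n := [set x : SeqE a d | expR (- (al' / 2%:R * n%:R)) <=
  gapratio a (prodn n x) (prodn n x *m prodn 1 (Defs.shift n x))].
have mA n : measurable (A n).
  apply: measurable_ge; apply: measurable_gapratio => //; apply: mkmeasM => //.
  by apply: mkmeas_prodn => //; exact: ps.
exists (lim_sup_set A); split.
- by apply: bigcapT_measurable => n; exact: bigcup_measurable.
- by apply: (null_limsup (ltW C0) b0 mA) => n; apply: hC.
move=> x; rewrite /lim_sup_set => nA.
have [N hN] : exists N, forall k, (N <= k)%N -> ~ A k x.
  apply: contrapT => h; apply: nA => N _; apply: contrapT => h'; apply: h; exists N => k Nk Ak.
  by apply: h'; exists k.
exists N => k Nk; have := hN k Nk; rewrite /A /= -prodnD addn1 => /negP; rewrite -ltNge => /ltW.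
by rewrite -mulNr expRM_natr.
Qed.

Let e0 : 0 < e. Proof. by case: sch. Qed.
Let theta0 : 0 < theta. Proof. by case: sch => _ _ /andP[]. Qed.
Let theta1 : theta < 1. Proof. by case: sch => _ _ /andP[]. Qed.
Let Ttau : forall B, 0 < T B -> mx2 B B <= tau * mn B ^+ 2.
Proof. by case: sch => _ _ _ []. Qed.

(* If the ratio of norms in [transverse] tends to 0 then, for each [j], the first [j] blocks
   are eventually all bad, and this has probability at most [theta ^+ j]. *)
Lemma transverse_ae : exists A, [/\ measurable A, mu A = 0 &
  forall x, ~ A x -> (forall n, prodn n x != 0) -> transverse x].
Proof.
pose b j n (x : SeqE a d) := bad M T e j (prodn 1 x) (prodn (n - j * M) (Defs.shift (1 + j * M) x))
  (prodn (n - j * M) (Defs.shift (1 + j * M) x)) (Defs.shift 1 x).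
pose E j N := \bigcap_(n in [set n | (N + j * M <= n)%N]) [set x : SeqE a d | b j n x].
have mb j n : measurable [set x : SeqE a d | b j n x].
  have mf : measurable_fun setT (b j n).
    by apply: (measurable_bad lf sch) => //; apply: mkmeas_prodn => //; exact: ps.
  by have := mf measurableT [set true] I; rewrite setTI.
have mE j N : measurable (E j N) by exact: bigcap_measurableType.
have muE j N : (mu (E j N) <= (theta ^+ j)%:E)%E.
  apply: le_trans (_ : mu [set x : SeqE a d | b j (N + j * M)%N x] <= _)%E.
    by apply: le_measure; rewrite ?inE// => x; apply => /=.
  have := Ex_bad_at lf mu_splice sch 1 j (mp0 N) (mp0 N).
  rewrite -(Ex_indic mu (mb _ _)); apply: le_trans; rewrite le_eqVlt; apply/orP; left; apply/eqP.
  by congr (Ex mu _); apply/funext => x; rewrite indicE mem_setE /b addnK.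
have muF j : (mu (\bigcup_N E j N) <= (theta ^+ j)%:E)%E.
  have cv : mu (E j N) @[N --> \oo] --> mu (\bigcup_N E j N).
    apply: nondecreasing_cvg_mu => //; first exact: bigcupT_measurable.
    move=> N N' NN'; apply/subsetPset => x h n /= hn; apply: h => /=.
    by apply: leq_trans hn; rewrite leq_add2r.
  rewrite -(cvg_lim _ cv)//; apply: lime_le; first by apply/cvg_ex; eexists; exact: cv.
  by apply: nearW => N; exact: muE.
have mF j : measurable (\bigcup_N E j N) by exact: bigcupT_measurable.
exists (\bigcap_j \bigcup_N E j N); split.
- exact: bigcapT_measurable.
- apply/eqP; rewrite eq_le measure_ge0 andbT; apply/lee_addgt0Pr => z z0; rewrite add0e.
  have [j hj] := geometric_small 1 (introT andP (conj theta0 theta1)) z0.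
  apply: le_trans (_ : mu (\bigcup_N E j N) <= _)%E.
    apply: le_measure; rewrite ?inE//; first exact: bigcapT_measurable.
    by move=> x; apply.
  by apply: le_trans (muF j) _; rewrite lee_fin ltW//; have := hj j (leqnn j); rewrite mul1r.
move=> x nA x0.
have [j hj] : exists j, forall N, exists2 n, (N + j * M <= n)%N & ~~ b j n x.
  apply: contrapT => h; apply: nA => j _; apply: contrapT => h'; apply: h; exists j => N.
  apply: contrapT => h''; apply: h'; exists N => // n /= hn; apply: contrapT => /negP nb.
  by apply: h''; exists n.
have y0 := prodn_shift_neq0 1 x0.
(* The good block has only [j] possible positions, so the smallest of these constants is positive
   and does not depend on [n]. *)
pose f (k : 'I_j) := calign d e * mn (prodn (1 + k * M) x) / (D * mn (prodn (k * M) (Defs.shift 1 x))).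
have Dp : 0 < D by rewrite ltr0n.
have f0 k : 0 < f k.
  by rewrite divr_gt0// mulr_gt0 ?calign_gt0// (mn_gt0 aP).
have [c c0 hc] := positive_lower_bound f0.
exists c => // N; have [n hn nb] := hj N; exists n.
  by apply: leq_trans hn; rewrite leq_addr.
have jn : (j * M <= n)%N by apply: leq_trans hn; rewrite leq_addl.
set h := prodn (n - j * M) (Defs.shift (1 + j * M) x).
have [bb|[k kj [G _]]] := last_good M T e j (prodn 1 x) h h (Defs.shift 1 x).
  by rewrite /b bb in nb.
have := good_align aP d0 e0 Ttau tau1 G; rewrite -prodnD.
set t := prodn M _ *m _; set y := Defs.shift 1 x.
have SE : prodn n y = prodn (k * M) y *m t.
  rewrite -(subnKC jn) -[(j * M)%N]add0n (prodn_cut M 0 _ y kj) !add0n /t -/y.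
  congr (_ *m (_ *m (_ *m _))); by rewrite /h /y shiftD.
have UE : prodn n.+1 x = prodn (1 + k * M) x *m t by rewrite prodnS -/y SE mulmxA -prodnD.
rewrite -UE; apply: le_trans; rewrite SE.
have h1 := hc (Ordinal kj); rewrite /f /= ler_pdivlMr in h1; last by rewrite mulr_gt0// (mn_gt0 aP).
apply: (@le_trans _ _ (c * (D * (mn (prodn (k * M) y) * mn t)))).
  by rewrite ler_pM2l//; exact: mnM.
have -> : c * (D * (mn (prodn (k * M) y) * mn t)) = c * (D * mn (prodn (k * M) y)) * mn t by ring.
by rewrite [X in _ <= X]mulrA; apply: ler_wpM2r => //; exact: mn_ge0.
Qed.

Hypothesis prox : forall n, mu [set x | prodn n x != 0%R] = 1%E.

Lemma nonzero_ae : exists A, [/\ measurable A, mu A = 0 &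
  forall x, ~ A x -> forall n, prodn n x != 0].
Proof.
pose A n := ~` [set x : SeqE a d | prodn n x != 0].
have mA n : measurable (A n) by apply: measurableC; exact: (measurable_neq0 lf (mp0 n)).
exists (\bigcup_n A n); split; first exact: bigcupT_measurable.
  apply: bigcup_null => // n; have := probability_setC mu (measurable_neq0 lf (mp0 n)).
  by rewrite prox subee.
by move=> x nA n; apply: contrapT => h; apply: nA; exists n.
Qed.

Lemma shift_null (A : set (SeqE a d)) k : measurable A -> mu A = 0 ->
  measurable [set x : SeqE a d | A (Defs.shift k x)] /\ mu [set x : SeqE a d | A (Defs.shift k x)] = 0.
Proof.
move=> mA A0; have mS : measurable [set x : SeqE a d | A (Defs.shift k x)].
  by have mps := ps k; have := mps measurableT A mA; rewrite setTI.
split=> //; have mI : measurable_fun setT (\1_A : SeqE a d -> R) by exact: measurable_indic.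
rewrite -(Ex_indic mu mS); have := Ex_shift mu_splice k mI (fun x => ltac:(by [])).
by rewrite Ex_indic// A0 => <-; congr (Ex mu _); apply/funext => x; rewrite !indicE.
Qed.

(** The conditions concern all shifts of the sequence; since the law is shift invariant, the
    exceptional sets pull back to null sets. *)
Lemma Omega_ae : exists A, [/\ measurable A, mu A = 0 &
  forall x, ~ A x -> Omega a (fun n => x n : 'M[K]_d)].
Proof.
have [al al0 gap] := gap_at_exists.
have [rho rho01 [A1 [mA1 A10 h1]]] := contracting_ae al0 gap.
have [A2 [mA2 A20 h2]] := transverse_ae; have [A3 [mA3 A30 h3]] := nonzero_ae.
pose B := A1 `|` (A2 `|` A3).
have mB : measurable B by do 2?[apply: measurableU => //].
have B0 : mu B = 0.
  by apply: setU_null => //; [exact: measurableU|exact: setU_null].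
exists (\bigcup_k [set x : SeqE a d | B (Defs.shift k x)]); split.
- by apply: bigcupT_measurable => k; case: (shift_null k mB B0).
- by apply: bigcup_null => k; case: (shift_null k mB B0).
move=> x nB; have nB' k : ~ B (Defs.shift k x) by move=> h; apply: nB; exists k.
have x0 : forall n, prodn n x != 0.
  by apply: h3 => h; apply: (nB' 0%N); rewrite shift0; right; right.
apply: (Omega_intro lf d2 rho01 x0) => k.
  by apply: h1 => h; apply: (nB' k); left.
apply: h2; last exact: (prodn_shift_neq0 k x0).
by move=> h; apply: (nB' k); right; left.
Qed.

End Random.

(** * The two deviation estimates *)

Section Deviation.
Variables (R : realType) (K : fieldType) (a : K -> R) (d : nat).
Hypothesis lf : local_field a.
Hypothesis d2 : (2 <= d)%N.
Let aP := local_field_nneg lf.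
Let d0 : (0 < d)%N. Proof. exact: ltnW. Qed.
Notation mn := (mn a).
Notation mx2 := (mx2 a).
Notation D := (d%:R : R).
Variable mu : probability (SeqE a d) R.
Hypothesis mu_splice : forall k (F : SeqE a d -> \bar R), measurable_fun setT F ->
  (forall x, 0 <= F x)%E ->
  (\int[mu]_x F x = \int[mu]_x \int[mu]_y F (splice k x y))%E.
Variables (M : nat) (T : 'M[K]_d -> R) (e theta tau : R).
Hypothesis sch : schottky mu M T e theta tau.
Hypotheses (tau0 : 0 <= tau).
Hypothesis tau1 : 2%:R * D ^+ 3 * (e + D) * tau <= e ^+ 3.
Hypothesis tau2 : 16%:R * D ^+ 6 * tau <= e ^+ 6.
Hypothesis prox : forall n, mu [set x | prodn n x != 0%R] = 1%E.

Let mp0 n : mkmeas a (fun x : SeqE a d => prodn n x) :=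
  mkmeas_prodn lf n (@measurable_id _ (SeqE a d) setT).
Let ps : forall k, measurable_fun setT (fun x : SeqE a d => Defs.shift k x : SeqE a d) :=
  fun k => @measurable_shift R K a d k.
Let Dp : 0 < D. Proof. by rewrite ltr0n. Qed.

Lemma image_dist (S : 'M[K]_d) (v l : 'cV[K]_d) (c r : R) : S != 0 -> S *m v != 0 -> l != 0 ->
  0 <= c -> 0 <= r -> mx2 S l <= c * r * (mn S * mn l) ->
  mx2 S (S *m v) <= r * (mn S * mn (S *m v)) ->
  pdist a (S *m v) l <= D * ((2%:R * c + 3%:R) * r).
Proof.
move=> S0 Sv0 l0 c0 r0 h1 h2.
have [j hj] := mn_col_max aP S d0.
have Sp : 0 < mn S by rewrite (mn_gt0 aP).
have u0 : col j S != 0 by rewrite -(mn_gt0 aP) hj.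
have k1 : mx2 (col j S) l <= c * r * (mn S * mn l) by apply: le_trans h1; exact: mx2_col.
have k2 : mx2 (col j S) (S *m v) <= r * (mn S * mn (S *m v)) by apply: le_trans h2; exact: mx2_col.
apply: (pdist_ub lf) => //; last by rewrite mulr_ge0// addr_ge0// mulr_ge0.
have := mx2_triangle lf (S *m v) l u0; rewrite hj => h.
rewrite -(ler_pM2r Sp); apply: le_trans h _.
have := ler_wpM2l (mulr_ge0 (ler0n R 2) (mn_ge0 aP (S *m v))) k1.
have := ler_wpM2l (mulr_ge0 (ler0n R 3) (mn_ge0 aP l)) k2.
move=> m2 m1; apply: le_trans (lerD m1 m2) _.
by rewrite le_eqVlt; apply/orP; left; apply/eqP; ring.
Qed.

(** Off [Bn n], all consecutive ratios from time [n] on are small, and the limit line is within a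
    multiple of [rho ^+ n] of the image of [S_n]. As [alpha < al], the constants are absorbed from
    [n0] on; before [n0] the bound is made at least 1 through [C3]. For a vector [v] the ratio of
    [S_n] and [S_n v] is handled by the same tail estimate, and conditioning costs the factor
    [1 / (1 - theta)]. *)
Lemma deviation (alpha al' : R) : 0 < al' -> alpha < al' -> gap_at mu al' ->
  exists C beta : R, 0 < C /\ 0 < beta /\
    (forall n : nat,
      prob_le mu
        [set x | exists u : 'cV[K]_d, u != 0 /\ inU a 1 (prodn n x) u /\
           expR (- alpha * n%:R) <= pdist a u (linf a (fun k => x k : 'M[K]_d))]
        (C * expR (- beta * n%:R))%:E) /\
    (forall (v : 'cV[K]_d) (n : nat),
      prob_le mu
        [set x | prodn n x *m v != 0 /\
           expR (- alpha * n%:R) <= pdist a (prodn n x *m v) (linf a (fun k => x k : 'M[K]_d))]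
        ((C * expR (- beta * n%:R))%:E * mu [set x | (prodn n x *m v != 0)%R])%E).
Proof.
move=> al0 al1 gap.
have [al [alp ala al2]] : exists al, [/\ 0 < al, alpha < al & al < al'].
  exists ((Num.max alpha 0 + al') / 2%:R).
  have : Num.max alpha 0 < al' by rewrite gt_max al1.
  have : 0 <= Num.max alpha 0 by rewrite le_max lexx orbT.
  have : alpha <= Num.max alpha 0 by rewrite le_max lexx.
  by move=> *; split; lra.
have al02 : 0 < al < al' by rewrite alp.
have [C1 [beta [C10 b0 hC1]]] := ratio_tail lf d2 mu_splice sch tau1 al02 gap.
set rho := expR (- al).
have eE n : expR (- (al * n%:R)) = rho ^+ n by rewrite -mulNr expRM_natr.
have rho01 : 0 < rho < 1 by rewrite expR_gt0 expR_lt1 oppr_lt0.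
have /andP[rho0 rho1] := rho01; have q0 : 0 < 1 - rho by rewrite subr_gt0.
have [A3 [mA3 A30 hA3]] := nonzero_ae lf prox.
pose A n := [set x : SeqE a d | expR (- (al * n%:R)) <=
  gapratio a (prodn n x) (prodn n x *m prodn 1 (Defs.shift n x))].
have mA n : measurable (A n).
  apply: measurable_ge; apply: measurable_gapratio => //; apply: mkmeasM => //.
  by apply: mkmeas_prodn => //; exact: ps.
have hA n : (mu (A n) <= (C1 * expR (- (beta * n%:R)))%:E)%E by exact: hC1.
have tail := tail_measure (ltW C10) b0 mA hA.
pose c := 8%:R / (1 - rho); have c0 : 0 <= c by rewrite divr_ge0// ltW.
pose Kc := D ^+ 4 * c + D * (2%:R * c + 3%:R).
have Kc1 : D ^+ 4 * c <= Kc by rewrite lerDl mulr_ge0// addr_ge0// mulr_ge0.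
have Kc2 : D * (2%:R * c + 3%:R) <= Kc by rewrite lerDr mulr_ge0// exprn_ge0.
have [n1 hn1] := geometric_small 1 rho01 (e := (1 - rho) / 4%:R) ltac:(by rewrite divr_gt0).
have rr : 0 < expR (alpha - al) < 1 by rewrite expR_gt0 expR_lt1 subr_lt0.
have [n2 hn2] := geometric_small Kc rr ltr01.
pose n0 := maxn n1 n2.
have far n (y : R) : (n0 <= n)%N -> y <= Kc * rho ^+ n -> ~ (expR (- alpha * n%:R) <= y).
  rewrite geq_max => /andP[_ nn2] h1 h2; have := le_trans h2 h1; apply/negP; rewrite -ltNge.
  have := hn2 n nn2; rewrite -expRM_natr mulrBl expRD mulrA -eE -mulNr => h3.
  rewrite (mulNr alpha) expRN -[ltRHS]mul1r ltr_pdivlMr ?expR_gt0//.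
  by rewrite mulrAC.
pose Bn n := A3 `|` \bigcup_(k in [set k | (n <= k)%N]) A k.
have mB n : measurable (Bn n) by apply: measurableU => //; exact: bigcup_measurable.
pose C2 := C1 / (1 - expR (- beta)).
have bq : 0 < 1 - expR (- beta) by rewrite subr_gt0 expR_lt1 oppr_lt0.
have C20 : 0 < C2 by rewrite divr_gt0.
have muB n : (mu (Bn n) <= (C2 * expR (- (beta * n%:R)))%:E)%E.
  apply: (@le_trans _ _ (mu A3 + mu (\bigcup_(k in [set k | (n <= k)%N]) A k))%E).
    by apply: measureU2 => //; exact: bigcup_measurable.
  by rewrite A30 add0e; exact: tail.
have good n x : (n0 <= n)%N -> ~ Bn n x ->
    [/\ prodn n x != 0, linf a (fun k => x k : 'M[K]_d) != 0 &
     mx2 (prodn n x) (linf a (fun k => x k : 'M[K]_d)) <=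
       c * rho ^+ n * (mn (prodn n x) * mn (linf a (fun k => x k : 'M[K]_d)))].
  rewrite geq_max => /andP[nn1 _] nB.
  have x0 : forall k, prodn k x != 0 by apply: hA3 => h; apply: nB; left.
  have [|||IL hL] := @linf_geo R K a d lf d2 (fun k => x k : 'M[K]_d) rho n rho01.
  - exact: x0.
  - move=> k nk; rewrite -[X in is_true X](gapratioP lf _ (x0 k) (x0 k.+1)).
    have : ~ A k x by move=> h; apply: nB; right; exists k.
    by rewrite /A /= -prodnD addn1 eE => /negP; rewrite -ltNge => /ltW.
  - by have := hn1 n nn1; rewrite mul1r => /ltW.
  by split; [exact: x0|case: IL|exact: hL].
have theta1 : 0 < 1 - theta by case: sch => _ _ /andP[_ h] _ _; rewrite subr_gt0.
pose C3 := expR (beta * n0%:R); have C30 : 0 < C3 by exact: expR_gt0.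
have C3n n : (n < n0)%N -> 1 <= C3 * expR (- (beta * n%:R)).
  move=> nn; rewrite -expRD -mulrBr -[leLHS]expR0 ler_expR mulr_ge0 ?(ltW b0)//.
  by rewrite subr_ge0 ler_nat ltnW.
pose C := (C2 + C1 + C3) / (1 - theta).
have Cp : 0 < C by rewrite divr_gt0// !addr_gt0.
have theta01 : 1 - theta <= 1 by case: sch => _ _ /andP[h _] _ _; rewrite lerBlDr lerDl ltW.
have CC : C2 + C1 + C3 <= C.
  by rewrite ler_pdivlMr// ler_piMr// ltW// !addr_gt0.
exists C, beta; split=> //; split=> //; split=> [n|v n].
  have [nn|nn] := leqP n0 n; last first.
    exists setT; split=> //; split=> //; rewrite mulNr.
    apply: le_trans (probability_le1 _ _) _ => //; rewrite lee_fin; apply: le_trans (C3n n nn) _.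
    apply: ler_wpM2r; first exact: expR_ge0.
    by apply: le_trans CC; rewrite lerDr addr_ge0// ltW.
  exists (Bn n); split=> //; split; last first.
    apply: le_trans (muB n) _; rewrite lee_fin mulNr; apply: ler_wpM2r; first exact: expR_ge0.
    by apply: le_trans CC; rewrite -addrA lerDl addr_ge0// ltW.
  move=> x /= [u [u0 [Uu hu]]]; apply: contrapT => /(good n x nn)[S0 L0 hL].
  have h1 := @inU_mx2 R K a d lf d2 1 (c * rho ^+ n) (prodn n x) u _ ltr01 (mulr_ge0 c0 (exprn_ge0 n (ltW rho0))) Uu hL.
  rewrite divr1 in h1; apply: far nn _ hu.
  have p0 : 0 <= D ^+ 3 * (c * rho ^+ n).
    by apply: mulr_ge0; [exact: exprn_ge0|apply: mulr_ge0 => //; rewrite exprn_ge0// ltW].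
  have h2 := pdist_ub lf d2 u0 L0 h1 p0; apply: le_trans h2 _.
  apply: (@le_trans _ _ (D ^+ 4 * c * rho ^+ n)); first by rewrite le_eqVlt; apply/orP; left; apply/eqP; ring.
  by apply: ler_wpM2r => //; rewrite exprn_ge0// ltW.
have [->|v0] := eqVneq v 0.
  exists set0; split=> //; split.
    by move=> x /= []; rewrite mulmx0 eqxx.
  by rewrite measure0 mule_ge0// lee_fin mulr_ge0 ?expR_ge0// ltW.
(* The vector is completed by zero columns, because the ratio estimates concern square matrices. *)
pose h : 'M[K]_d := v *m delta_mx ord0 (Ordinal d0).
have dmx : (delta_mx ord0 (Ordinal d0) : 'rV[K]_d) != 0.
  by apply/eqP => /matrixP/(_ ord0 (Ordinal d0)); rewrite !mxE !eqxx => /eqP; rewrite oner_eq0.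
have h0 : h != 0 by rewrite (outer_neq0 lf) v0.
have setE : [set x | prodn n x *m v != 0] = [set x : SeqE a d | prodn n x *m h != 0].
  by apply/seteqP; split=> x /=; rewrite mulmxA (outer_neq0 lf) dmx andbT.
have lowp : ((1 - theta)%:E <= mu [set x | (prodn n x *m v != 0)%R])%E.
  by rewrite setE; apply: (prodn_neq0_prob lf mu_splice sch d0 tau1 n prox).
have final (B : set (SeqE a d)) : measurable B ->
    [set x | prodn n x *m v != 0 /\
           expR (- alpha * n%:R) <= pdist a (prodn n x *m v) (linf a (fun k => x k : 'M[K]_d))] `<=` B ->
    (mu B <= ((C2 + C1 + C3) * expR (- (beta * n%:R)))%:E)%E ->
    prob_le mu [set x | prodn n x *m v != 0 /\
           expR (- alpha * n%:R) <= pdist a (prodn n x *m v) (linf a (fun k => x k : 'M[K]_d))]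
        ((C * expR (- beta * n%:R))%:E * mu [set x | (prodn n x *m v != 0)%R])%E.
  move=> mB' sB hB; exists B; split=> //; split=> //; apply: le_trans hB _.
  apply: (@le_trans _ _ ((C * expR (- beta * n%:R))%:E * (1 - theta)%:E)%E).
    by rewrite -EFinM lee_fin /C mulNr mulrAC divfK// gt_eqF.
  by apply: lee_wpmul2l => //; rewrite lee_fin mulr_ge0 ?expR_ge0// ltW.
have [nn|nn] := leqP n0 n; last first.
  apply: (final setT) => //; apply: le_trans (probability_le1 _ _) _ => //.
  rewrite lee_fin; apply: le_trans (C3n n nn) _; apply: ler_wpM2r; first exact: expR_ge0.
  by rewrite lerDr addr_ge0// ltW.
pose A' := [set x : SeqE a d | expR (- (al * n%:R)) <= gapratio a (prodn n x) (prodn n x *m h)].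
have mh : mkmeas a (fun _ : SeqE a d => h) by exact: mkmeas_cst.
have mA' : measurable A' by apply: measurable_ge; apply: measurable_gapratio => //; exact: mkmeasM.
apply: (final (Bn n `|` A')); first exact: measurableU.
  move=> x /= [Sv0 hv]; apply: contrapT => nB.
  have [S0 L0 hL] := good n x nn (fun z => nB (or_introl z)).
  have : ~ A' x by move=> z; apply: nB; right.
  rewrite /A' /= eE => /negP; rewrite -ltNge => /ltW.
  have Sh : prodn n x *m h = (prodn n x *m v) *m delta_mx ord0 (Ordinal d0) by rewrite mulmxA.
  have Sh0 : prodn n x *m h != 0 by rewrite Sh (outer_neq0 lf) Sv0.
  have hmn : mn (prodn n x *m h) <= mn (prodn n x *m v).
    rewrite Sh (mn_outer aP) ler_piMr ?mn_ge0//; apply: mn_le => // i j; rewrite mxE.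
    by case: (_ && _); rewrite ?(av1 aP) ?(av0 aP).
  have hcol : col (Ordinal d0) (prodn n x *m h) = prodn n x *m v.
    rewrite Sh colE -mulmxA mul_delta_mx (_ : delta_mx ord0 ord0 = 1%:M) ?mulmx1//.
    by apply/matrixP => i j; rewrite (ord1 i) (ord1 j) !mxE.
  rewrite gapratioP// => hq.
  apply: (far n _ nn _ hv); apply: le_trans (image_dist S0 Sv0 L0 c0 (exprn_ge0 n (ltW rho0)) hL _) _.
    rewrite -{1}hcol (mx2C aP); apply: le_trans (mx2_col lf _ _ _) _; rewrite (mx2C aP).
    apply: le_trans hq _; apply: ler_wpM2l; first by rewrite exprn_ge0// ltW.
    by apply: ler_wpM2l => //; exact: mn_ge0.
  by rewrite mulrA; apply: ler_wpM2r => //; rewrite exprn_ge0// ltW.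
apply: (@le_trans _ _ (mu (Bn n) + mu A')%E); first by apply: measureU2 => //; exact: mB.
apply: (@le_trans _ _ ((C2 * expR (- (beta * n%:R)))%:E + (C1 * expR (- (beta * n%:R)))%:E)%E).
  by apply: leeD; [exact: muB|exact: (hC1 _ n mh)].
rewrite -EFinD lee_fin -mulrDl; apply: ler_wpM2r; first exact: expR_ge0.
by rewrite lerDl ltW.
Qed.

End Deviation.

(** * From the given probability space to the law of the sequence *)

Section Transfer.
Variables (R : realType) (K : fieldType) (a : K -> R) (d : nat).
Context (dT : measure_display) (T : measurableType dT).
Variables (P : probability T R) (nu : probability (EndE a d) R) (gamma : nat -> T -> EndE a d).
Hypothesis lf : local_field a.
Hypothesis d2 : (2 <= d)%N.
Hypothesis law : iid_law P nu gamma.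
Let aP := local_field_nneg lf.
Let d0 : (0 < d)%N. Proof. exact: ltnW. Qed.
Notation mn := (mn a).
Notation mx2 := (mx2 a).
Notation D := (d%:R : R).
Let Dp : 0 < D. Proof. by rewrite ltr0n. Qed.

Definition sample (t : T) : SeqE a d := fun n => gamma n t.

Lemma measurable_sample : measurable_fun setT sample.
Proof. by apply: measurable_to_seq => i; case: law => h _ _; exact: h. Qed.

(** Resampling needs a second copy of the letters, which [T] need not provide; hence the passage to
    the law of the whole sequence, from which the results are pulled back. *)
Lemma sample_law : exists mu : probability (SeqE a d) R, forall A, mu A = P (sample @^-1` A).
Proof.
pose X : {mfun T >-> SeqE a d} := HB.pack sample (isMeasurableFun.Build _ _ _ _ sample measurable_sample).
by exists (distribution P X).
Qed.

Variable mu : probability (SeqE a d) R.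
Hypothesis muE : forall A, mu A = P (sample @^-1` A).

Lemma law_box n (B : nat -> set (EndE a d)) : (forall i, measurable (B i)) ->
  (forall i, (n <= i)%N -> B i = setT) -> mu (box B) = (\prod_(i < n) nu (B i))%E.
Proof.
move=> mB BT; case: law => _ h1 h2; rewrite muE.
rewrite (_ : sample @^-1` _ = \bigcap_(i in [set k | (k < n)%N]) (gamma i @^-1` B i)).
  by rewrite h2//; apply: eq_bigr => i _; exact: h1.
apply/seteqP; split=> t /= h i; first by move=> _; exact: h.
by have [ni|ni] := leqP n i; [rewrite BT|exact: h].
Qed.

Lemma law_splice k (F : SeqE a d -> \bar R) : measurable_fun setT F -> (forall x, 0 <= F x)%E ->
  (\int[mu]_x F x = \int[mu]_x \int[mu]_y F (splice k x y))%E.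
Proof. by apply: (integral_splice (nu := nu)) => n B; exact: law_box. Qed.

Lemma prob_le_sample (A : set (SeqE a d)) b : prob_le mu A b -> prob_le P (sample @^-1` A) b.
Proof.
move=> [B [mB [AB hB]]]; exists (sample @^-1` B); split.
  by have := measurable_sample measurableT mB; rewrite setTI.
by split; [move=> t; exact: AB|rewrite -muE].
Qed.

Lemma ae_sample (A : set (SeqE a d)) (Q : T -> Prop) : measurable A -> mu A = 0 ->
  (forall t, ~ A (sample t) -> Q t) -> {ae P, forall t, Q t}.
Proof.
move=> mA A0 h; exists (sample @^-1` A); split.
- by have := measurable_sample measurableT mA; rewrite setTI.
- by rewrite -A0 muE.
- by move=> t /= nQ; apply: contrapT => nA; apply: nQ; exact: h.
Qed.

Lemma convE n (A : set 'M[K]_d) : Defs.conv P gamma n A = mu [set x | A (prodn n x)].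
Proof. by rewrite muE. Qed.

Let mp0 n : mkmeas a (fun x : SeqE a d => prodn n x) :=
  mkmeas_prodn lf n (@measurable_id _ (SeqE a d) setT).

Lemma sample_neq0 : (forall n, Defs.conv P gamma n [set 0] = 0%E) ->
  forall n, mu [set x | prodn n x != 0%R] = 1%E.
Proof.
move=> h n; have mS := measurable_neq0 lf (mp0 n).
have := probability_setC mu mS.
have -> : mu (~` [set x | prodn n x != 0]) = 0%E.
  rewrite muE -[RHS](h n); congr (P _); apply/seteqP; split=> t /=.
    by move=> nz; apply/eqP; apply: contrapT => /negP.
  by move=> E; apply/negP; rewrite negbK; apply/eqP; exact: E.
rewrite -(fineK (fin_num_measure mu _ mS)) -EFinB => /esym[] h1.
by congr EFin; apply/eqP; rewrite eq_sym -subr_eq0 h1.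
Qed.

(** An event of positive probability on which [S_n] is nonzero contains a point where [S_n] is
    accessible, and there all the pairings are nonzero at once. *)
Lemma accessible_pairing N (f : 'I_N -> 'rV[K]_d) (v : 'I_N -> 'cV[K]_d) n : (1 <= N)%N ->
  (0 < mu [set x | (\prod_(i < N) (f i *m prodn n x *m v i) ord0 ord0 != 0)%R])%E ->
  exists2 A, accessible mu A & forall i, f i *m A *m v i != 0.
Proof.
case: N f v => // N f v _.
have E11 (z : 'M[K]_1) : (z ord0 ord0 != 0) = (z != 0).
  congr (~~ _); apply/eqP/eqP => [h|->]; last by rewrite mxE.
  by apply/matrixP => i j; rewrite (ord1 i) (ord1 j) h mxE.
have setE : [set x | \prod_(i < N.+1) (f i *m prodn n x *m v i) ord0 ord0 != 0] =
    \bigcap_(i in [set: 'I_N.+1]) [set x : SeqE a d | f i *m prodn n x *m v i != 0].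
  apply/seteqP; split=> x /=.
    by move=> /prodf_neq0 h i _ /=; rewrite -E11; exact: h.
  by move=> h; apply/prodf_neq0 => i _; rewrite E11; exact: h.
rewrite setE => pos.
have mA : measurable (\bigcap_(i in [set: 'I_N.+1]) [set x : SeqE a d | f i *m prodn n x *m v i != 0]).
  apply: fin_bigcap_measurable => // i _; apply: (measurable_neq0 lf).
  by apply: mkmeasM => //; [apply: mkmeasM => //; exact: mkmeas_cst|exact: mkmeas_cst].
have [x h1|x /= hx accx] := accessible_pos lf (n := n) mA pos.
  by apply: contra_neq (h1 ord0 I) => ->; rewrite mulmx0 mul0mx.
by exists (prodn n x) => // i; exact: hx.
Qed.

Lemma sample_moves_vectors : strongly_irreducible P gamma -> moves_vectors mu.
Proof.
(* An extra nonzero form is put in front because the list may be empty, while irreducibility is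
   stated for at least one form. *)
move=> [h _] fs v fs0 v0; pose f0 : 'rV[K]_d := (delta_mx (Ordinal d0) ord0)^T.
have f00 : f0 != 0 by rewrite trmx_eq0 delta_neq0.
have [|n hn] := h (size fs).+1 (fun i => nth 0 (f0 :: fs) i) v isT _ v0.
  move=> i; have : nth 0 (f0 :: fs) i \in f0 :: fs by apply: mem_nth; exact: ltn_ord.
  by rewrite inE => /predU1P[->//|/fs0].
have [|A accA hA] := @accessible_pairing (size fs).+1 (fun i => nth 0 (f0 :: fs) i) (fun=> v) n isT.
  by rewrite muE.
exists A => // f ffs.
have ii : ((index f fs).+1 < (size fs).+1)%N by rewrite ltnS index_mem.
by have := hA (Ordinal ii); rewrite /= nth_index.
Qed.

Lemma sample_moves_forms : strongly_irreducible P gamma -> moves_forms mu.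
Proof.
move=> [_ h] f vs f0 vs0; pose v0 : 'cV[K]_d := delta_mx (Ordinal d0) ord0.
have v00 : v0 != 0 by exact: delta_neq0.
have [|n hn] := h (size vs).+1 f (fun i => nth 0 (v0 :: vs) i) isT f0.
  move=> i; have : nth 0 (v0 :: vs) i \in v0 :: vs by apply: mem_nth; exact: ltn_ord.
  by rewrite inE => /predU1P[->//|/vs0].
have [|A accA hA] := @accessible_pairing (size vs).+1 (fun=> f) (fun i => nth 0 (v0 :: vs) i) n isT.
  by rewrite muE.
exists A => // v vvs.
have ii : ((index v vs).+1 < (size vs).+1)%N by rewrite ltnS index_mem.
by have := hA (Ordinal ii); rewrite /= nth_index.
Qed.

(** One factor [D] comes from the comparison of second exterior powers and four from the square of
    the comparison of norms. *)
Lemma sg_sigma (h : 'M[K]_d) : sg a h <= D ^+ 5 * sigma a h.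
Proof.
have [->|h0] := eqVneq h 0.
  rewrite /sg /gapratio (mn0 aP) mulr0 invr0 mulr0 mulr_ge0 ?exprn_ge0//.
  rewrite /sigma divr_ge0 ?exprn_ge0 ?opnorm_ge0//.
  have := opnorm2_lb aP d2 (0 : 'M[K]_d); rewrite -ler_pdivrMl//; apply: le_trans.
  by rewrite mulr_ge0 ?invr_ge0 ?mx2_ge0.
have mp : 0 < mn h by rewrite (mn_gt0 aP).
have h1 := opnorm2_lb aP d2 h; have h2 := opnorm_ub aP d2 h; have h3 := opnorm_lb aP d2 h.
have op : 0 < opnorm a h by rewrite -(pmulr_rgt0 _ Dp); exact: lt_le_trans h3.
rewrite /sg /gapratio /sigma ler_pdivrMr ?mulr_gt0//; apply: le_trans h1 _.
have o2 : 0 <= opnorm2 a h.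
  have := opnorm2_lb aP d2 h; rewrite -ler_pdivrMl//; apply: le_trans.
  by rewrite mulr_ge0 ?invr_ge0 ?mx2_ge0.
have -> : D ^+ 5 * (opnorm2 a h / opnorm a h ^+ 2) * (mn h * mn h) =
  D * opnorm2 a h * ((D ^+ 2 * mn h) ^+ 2 / opnorm a h ^+ 2) by ring.
rewrite ler_peMr ?mulr_ge0//; rewrite ler_pdivlMr ?exprn_gt0// mul1r.
by apply: lerXn2r; rewrite ?nnegrE ?mulr_ge0 ?exprn_ge0 ?mn_ge0// ltW.
Qed.

(** Almost sure convergence gives convergence in probability: the limsup of the exceptional sets is
    null, so their tail unions become small. A rate [al'] strictly between [al] and [lambda12]
    absorbs the constant between [sg] and [sigma]; a value [+oo] of [lyap_term] means that [sg] is
    0. *)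
Lemma lyapunov_gap (lambda12 : \bar R) (al : R) :
  {ae P, forall t, (fun n => lyap_term a (gbarT gamma n.+1 t) n.+1) @ \oo --> lambda12} ->
  (al%:E < lambda12)%E -> gap_at mu al.
Proof.
move=> [B [mB B0 hB]] lt_al eta eta0.
have [al' al1 lt_al'] : exists2 al' : R, al < al' & (al'%:E < lambda12)%E.
  case: lambda12 lt_al {hB} => [r| |//]; last by exists (al + 1); rewrite ?ltrDl// ltry.
  by rewrite lte_fin => h; exists ((al + r) / 2%:R); rewrite ?lte_fin; lra.
pose A n := [set x : SeqE a d | expR (- (al * n%:R)) < sg a (prodn n x)].
have mA n : measurable (A n).
  have mf : measurable_fun setT (fun x : SeqE a d => expR (- (al * n%:R)) < sg a (prodn n x)).
    by apply: measurable_fun_ltr => //; exact: measurable_gapratio.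
  by have := mf measurableT [set true] I; rewrite setTI.
have mLA : measurable (lim_sup_set A).
  by apply: bigcapT_measurable => n; exact: bigcup_measurable.
have LA0 : mu (lim_sup_set A) = 0%E.
  rewrite muE; apply/eqP; rewrite eq_le measure_ge0 andbT -B0.
  apply: le_measure; rewrite ?inE//.
    by have := measurable_sample measurableT mLA; rewrite setTI.
  move=> t hA; apply: hB => /= cv.
  have [N _ hN] := cv _ (open_nbhs_nbhs (conj (@open_ereal_gt_ereal R al'%:E) lt_al')).
  have rr : 0 < expR (al - al') < 1 by rewrite expR_gt0 expR_lt1 subr_lt0.
  have [N2 hN2] := geometric_small (D ^+ 5) rr ltr01.
  have [n] := hA (maxn N.+1 N2) I; rewrite /= geq_max => /andP[Nn N2n].
  case: n Nn N2n => // n Nn N2n; rewrite /A /=; apply/negP; rewrite -leNgt.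
  apply: le_trans (sg_sigma _) _.
  have : (al'%:E < lyap_term a (prodn n.+1 (sample t)) n.+1)%E by exact: hN.
  rewrite /lyap_term.
  case: ifPn => [/eqP -> _|s0]; first by rewrite mulr0 expR_ge0.
  rewrite /= lte_fin ltr_pdivlMr ?ltr0n// => h.
  set s := sigma a _ in s0 h *.
  have sp : 0 < s.
    rewrite lt_def s0 /=; have := sg_sigma (prodn n.+1 (sample t)); rewrite -ler_pdivrMl ?exprn_gt0//.
    by apply: le_trans; rewrite mulr_ge0 ?invr_ge0 ?exprn_ge0// (sg_ge0 aP).
  have hs : s < expR (- (al' * n.+1%:R)).
    by rewrite -(lnK sp) ltr_expR ltrNr.
  apply: (@le_trans _ _ (D ^+ 5 * expR (- (al' * n.+1%:R)))).
    by apply: ler_wpM2l; [exact: exprn_ge0|exact: ltW].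
  have := hN2 n.+1 N2n; rewrite -expRM_natr mulrBl expRD mulrA => h5.
  rewrite (expRN (al * _)) -[leRHS]mul1r ler_pdivlMr ?expR_gt0// mulrAC; exact: ltW.
have fin0 : (mu (\bigcup_(k in [set k | (0 <= k)%N]) A k) < +oo)%E.
  by apply: le_lt_trans (probability_le1 _ _) (ltry _); exact: bigcup_measurable.
have cv := lim_sup_set_cvg mu A mA fin0.
have LAeta : (mu (lim_sup_set A) < eta%:E)%E by rewrite LA0 lte_fin.
have [N _ hN] := cv _ (open_nbhs_nbhs (conj (@open_ereal_lt_ereal R eta%:E) LAeta)).
exists N => n Nn; apply: le_trans (ltW (hN N (leqnn N))).
apply: le_measure; rewrite ?inE; [exact: (mA n)|exact: bigcup_measurable|].
by move=> x Ax; exists n.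
Qed.

End Transfer.

Unset Implicit Arguments.
Theorem theorem5p13 (R : realType) (K : fieldType) (a : K -> R)
  (d : nat) (dT : measure_display) (T : measurableType dT)
  (P : probability T R) (nu : probability (EndE a d) R)
  (gamma : nat -> T -> EndE a d) :
  local_field a -> (2 <= d)%N ->
  iid_law P nu gamma ->
  strongly_irreducible P gamma -> proximal P gamma ->
  {ae P, forall t, Omega a (fun n => gamma n t : 'M[K]_d)} /\
  forall lambda12 : \bar R,
    {ae P, forall t, (fun n => lyap_term a (gbarT gamma n.+1 t) n.+1)
                        @ \oo --> lambda12} ->
  forall alpha : R, (alpha%:E < lambda12)%E ->
  exists C beta : R, 0 < C /\ 0 < beta /\
    (forall n : nat,
      prob_le P
        [set t | exists u : 'cV[K]_d, u != 0 /\ inU a 1 (gbarT gamma n t) u /\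
           expR (- alpha * n%:R) <=
             pdist a u (linf a (fun k => gamma k t : 'M[K]_d))]
        (C * expR (- beta * n%:R))%:E) /\
    (forall (v : 'cV[K]_d) (n : nat),
      prob_le P
        [set t | gbarT gamma n t *m v != 0 /\
           expR (- alpha * n%:R) <=
             pdist a (gbarT gamma n t *m v) (linf a (fun k => gamma k t : 'M[K]_d))]
        ((C * expR (- beta * n%:R))%:E *
          P [set t | (gbarT gamma n t *m v != 0)%R])%E).
Proof.
move=> lf d2 law si [px0 [n pr]].
have aP := local_field_nneg lf; have d0 : (0 < d)%N by exact: ltnW.
have [mu muE] := sample_law law; have ms := law_splice law muE.
have prox := sample_neq0 lf muE px0.
have [|u [f [uf0 accuf]]] := accessible_rank_one lf d2 ms (n := n).
  by rewrite -(convE muE n [set g | rho2 a g < rho1 a g]).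
have [e e0 he] := schottky_exists lf d2 ms (sample_moves_vectors lf d2 muE si)
  (sample_moves_forms lf d2 muE si) uf0 accuf.
have Dp : (0 : R) < d%:R by rewrite ltr0n.
(* The first term is for the lower bound on triple products, the second for good blocks to halve the
   gap. *)
pose tau := Num.min (e ^+ 3 / (2%:R * d%:R ^+ 3 * (e + d%:R))) (e ^+ 6 / (16%:R * d%:R ^+ 6)).
have den1 : 0 < 2%:R * d%:R ^+ 3 * (e + d%:R) :> R.
  by apply: mulr_gt0; [apply: mulr_gt0 => //; exact: exprn_gt0|exact: addr_gt0].
have den2 : 0 < 16%:R * d%:R ^+ 6 :> R by apply: mulr_gt0 => //; exact: exprn_gt0.
have tau0 : 0 < tau by rewrite lt_min !divr_gt0 ?exprn_gt0.
have tau1 : 2%:R * d%:R ^+ 3 * (e + d%:R) * tau <= e ^+ 3.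
  by rewrite mulrC -ler_pdivlMr// ge_min lexx.
have tau2 : 16%:R * d%:R ^+ 6 * tau <= e ^+ 6.
  by rewrite mulrC -ler_pdivlMr// ge_min lexx orbT.
have [M [T0 [theta sch]]] := he tau tau0; have tau0' := ltW tau0.
split=> [|lambda12 lyap alpha lt_al].
  have [A [mA A0 hA]] := Omega_ae lf d2 ms sch tau0' tau1 tau2 prox.
  by apply: (ae_sample law muE mA A0) => t; exact: hA.
have [al1 al10 gap1] := gap_at_exists lf d2 ms sch tau0' tau1 tau2.
have [al' [al'0 al'1 gap]] : exists al', [/\ 0 < al', alpha < al' & gap_at mu al'].
  (* The positive rate [al1] serves every smaller [alpha], negative ones included; otherwise
     [alpha > 0], and a rate strictly between it and [lambda12] is taken. *)
  have [h|h] := ltP alpha al1; first by exists al1.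
  have alp : 0 < alpha by exact: lt_le_trans h.
  have [al' h1 h2] : exists2 al' : R, alpha < al' & (al'%:E < lambda12)%E.
    case: lambda12 lt_al {lyap} => [r| |//]; last by exists (alpha + 1); rewrite ?ltrDl// ltry.
    by rewrite lte_fin => h1; exists ((alpha + r) / 2%:R); rewrite ?lte_fin; lra.
  exists al'; split=> //; first exact: lt_trans h1.
  exact: (lyapunov_gap lf d2 law muE lyap h2).
have [C [beta [C0 [b0 [h1 h2]]]]] := deviation lf d2 ms sch tau1 prox al'0 al'1 gap.
exists C, beta; split=> //; split=> //; split=> [k|v k].
  exact: (prob_le_sample law muE (h1 k)).
by have := prob_le_sample law muE (h2 v k); rewrite muE.
Qed.
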